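(* Let $f$ be the function, and $(\Omega,\mathcal{A},\mu,T)$, $(\mathcal{F}_j)_{j\in\mathbb{Z}}$ the ergodic dynamical system and filtration, constructed in the context. Let $m\in\mathcal{M}$, i.e. $m\in L^2(\mu)$ is $\mathcal{F}_0$-measurable and $E(m\circ T|\mathcal{F}_0)=0$. Then $$\frac{S_n(m+f)}{\sqrt{n}}\Rightarrow \mathrm{Normal}[0,\Vert m\Vert_2^2]\qquad (n\to\infty)$$ under $\mu$, but the convergence is not $\mathcal{F}_0$-quenched: there is no single (non-random) distribution $G$ such that, for $\mu$-a.e. $\omega$, the regular conditional distribution of $S_n(m+f)/\sqrt{n}$ given $\mathcal{F}_0$, evaluated at $\omega$, converges weakly to $G$.
   Context: Notation: $U^ig=g\circ T^i$ for $i\in\mathbb{Z}$; $S_n(h)=\sum_{i=1}^nU^ih$; $\Rightarrow$ denotes convergence in distribution; $\mathrm{Normal}[0,0]$ is the point mass at $0$. Construction. Let $\ell_1,\ell_2,\dots$ and $M_1,M_2,\dots$ be strictly increasing sequences of positive integers, with $M_0=1$, such that $M_k\ge 2\ell_k$ for all $k\ge1$ and $$\sum_{k=1}^\infty\left[\frac{1}{\sqrt{k\ell_k}}+\ell_k^2\sqrt{\frac{M_{k-1}}{M_k}}\right]<\infty .$$ Let $(\Omega,\mathcal{A},\mu)$ be a probability space with an invertible (bijective, with measurable inverse), ergodic, measure preserving transformation $T$, carrying random variables $e_k$, $k\ge1$, such that the variables $U^ie_k=e_k\circ T^i$, $i\in\mathbb{Z}$, $k\ge1$, are independent, and $e_k$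 takes each of the values $\sqrt{M_k}/\ell_k$ and $-\sqrt{M_k}/\ell_k$ with probability $\frac{1}{2kM_k}$, and the value $0$ otherwise. Let $\mathcal{F}_j=\sigma\{U^ie_k:i\le j,\ k\ge1\}$, so that $\mathcal{F}_{j+1}=T^{-1}\mathcal{F}_j$. Let $N_k=M_1+\cdots+M_k$, $h_k=\sum_{i=0}^{\ell_k-1}U^ie_k$, $f_k=h_k-U^{\ell_k}h_k$, and $$f=\sum_{k=1}^\infty U^{-N_k}f_k ,$$ a series which converges in $L^2(\mu)$. *)

(* Defs.v *)
From HB Require Import structures.
From mathcomp Require Export all_boot all_order all_algebra.
From mathcomp Require Export all_classical all_reals all_analysis.

Set Implicit Arguments.
Unset Strict Implicit.
Unset Printing Implicit Defensive.

Export Order.TTheory GRing.Theory Num.Theory.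
Export numFieldNormedType.Exports.

Local Open Scope classical_set_scope.
Local Open Scope ring_scope.

Definition measure_preserving d (Omega : measurableType d) (R : realType)
    (mu : probability Omega R) (T : Omega -> Omega) : Prop :=
  measurable_fun setT T /\
  forall A : set Omega, measurable A -> mu (T @^-1` A) = mu A.

Definition ergodic d (Omega : measurableType d) (R : realType)
    (mu : probability Omega R) (T : Omega -> Omega) : Prop :=
  forall A : set Omega, measurable A -> T @^-1` A = A ->
    mu A = 0%E \/ mu A = 1%E.

(* T^i for i : int; Tinv is meant to be the two-sided inverse of T. *)
Definition iterz (Omega : Type) (T Tinv : Omega -> Omega) (i : int) :
    Omega -> Omega :=
  match i with
  | Posz n => iter n T
  | Negz n => iter n.+1 Tinv
  end.

Definition koopman (Omega : Type) (R : realType) (T Tinv : Omega -> Omega)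
    (i : int) (g : Omega -> R) : Omega -> R :=
  g \o iterz T Tinv i.

Definition birkhoff_sum (Omega : Type) (R : realType)
    (T Tinv : Omega -> Omega) (h : Omega -> R) (n : nat) : Omega -> R :=
  fun w => \sum_(1 <= i < n.+1) koopman T Tinv i%:Z h w.

Definition normalized_sum (Omega : Type) (R : realType)
    (T Tinv : Omega -> Omega) (h : Omega -> R) (n : nat) : Omega -> R :=
  fun w => birkhoff_sum T Tinv h n w / Num.sqrt n%:R.

(* The product rule is required for every finite subfamily (repetition-free
   sequence of indices taken in D). *)
Definition mutually_independent d (Omega : measurableType d) (R : realType)
    (mu : probability Omega R) (I : eqType) (D : set I)
    (X : I -> Omega -> R) : Prop :=
  forall (s : seq I) (B : I -> set (measurableTypeR R)),
    uniq s -> (forall i, i \in s -> D i) -> (forall i, measurable (B i)) ->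
    mu (\bigcap_(i in [set i | i \in s]) (X i @^-1` B i)) =
    (\prod_(i <- s) mu (X i @^-1` B i))%E.

(* Generating class of F_j = sigma{U^i e_k : i <= j, k >= 1}; the sigma-algebra
   itself is <<s past_gen T Tinv e j >>. *)
Definition past_gen (Omega : Type) (R : realType) (T Tinv : Omega -> Omega)
    (e : nat -> Omega -> R) (j : int) : set (set Omega) :=
  \bigcup_(ik in [set ik : int * nat | (ik.1 <= j)%R /\ (1 <= ik.2)%N])
    preimage_set_system setT (koopman T Tinv ik.1 (e ik.2))
      (@measurable _ (measurableTypeR R)).

(* Y is a version of E(X | <<s G >>), for an integrable X. *)
Definition is_cond_exp d (Omega : measurableType d) (R : realType)
    (mu : probability Omega R) (G : set (set Omega)) (X Y : Omega -> R) :
    Prop :=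
  [/\ measurable_fun setT (Y : g_sigma_algebraType G -> measurableTypeR R),
      mu.-integrable setT (EFin \o Y) &
      forall A : set Omega, <<s G >> A ->
        (\int[mu]_(w in A) (Y w)%:E = \int[mu]_(w in A) (X w)%:E)%E].

(* K is a version of the regular conditional distribution of X given <<s G >>:
   a probability kernel, measurable in its first argument for <<s G >>. *)
Definition is_reg_cond_distr d (Omega : measurableType d) (R : realType)
    (mu : probability Omega R) (G : set (set Omega)) (X : Omega -> R)
    (K : R.-pker (g_sigma_algebraType G) ~> measurableTypeR R) : Prop :=
  forall (A : set Omega) (B : set (measurableTypeR R)),
    <<s G >> A -> measurable B ->
    (\int[mu]_(w in A) K w B = mu (A `&` X @^-1` B))%E.

(* The arguments are plain set functions so that pushforward measures can be
   used without packing a measurability proof. *)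
Definition weak_cvg (R : realType)
    (P : nat -> set (measurableTypeR R) -> \bar R)
    (Q : set (measurableTypeR R) -> \bar R) : Prop :=
  forall phi : R -> R, continuous phi ->
    (exists C : R, forall x, `|phi x| <= C) ->
    (\int[P n]_x (phi x)%:E @[n --> \oo] --> \int[Q]_x (phi x)%:E)%E.

(* Centered normal law of variance v. The degenerate case is separate because
   normal_prob takes the standard deviation and its value at 0 is the uniform
   law on [0, 1]. *)
Definition centered_normal (R : realType) (v : R) :
    set (measurableTypeR R) -> \bar R :=
  if v == 0 then dirac (0 : measurableTypeR R)
  else normal_prob 0 (Num.sqrt v).

Definition partial_shift (M : nat -> nat) (k : nat) : nat :=
  (\sum_(1 <= j < k.+1) M j)%N.

Definition block (Omega : Type) (R : realType) (T Tinv : Omega -> Omega)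
    (ell : nat -> nat) (e : nat -> Omega -> R) (k : nat) : Omega -> R :=
  fun w => \sum_(0 <= i < ell k) koopman T Tinv i%:Z (e k) w.

Definition coboundary (Omega : Type) (R : realType) (T Tinv : Omega -> Omega)
    (ell : nat -> nat) (e : nat -> Omega -> R) (k : nat) : Omega -> R :=
  fun w => block T Tinv ell e k w
           - koopman T Tinv (ell k)%:Z (block T Tinv ell e k) w.

Definition f_partial (Omega : Type) (R : realType) (T Tinv : Omega -> Omega)
    (ell M : nat -> nat) (e : nat -> Omega -> R) (n : nat) : Omega -> R :=
  fun w => \sum_(1 <= k < n.+1)
    koopman T Tinv (- (partial_shift M k)%:Z) (coboundary T Tinv ell e k) w.

(* Main.v *)
(* The Birkhoff sum of U^{-N_k} f_k telescopes to [bump k] minus its image under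
   T^n, where [bump k] is nonzero with probability at most 2 l_k / (k M_k), a
   summable bound.  Hence S_n(f) / sqrt n tends to 0 in probability, and by
   Slutsky's lemma the limit law is that of S_n(m) / sqrt n.  The latter is found
   by Lindeberg replacement against the heat kernel u(v, x): replacing the
   increments m o T^i one by one, the first-order terms vanish by the martingale
   property, and the conditional second moments are replaced by E m^2 because the
   filtration of a family of independent variables is mixing.

   A quenched limit would make S_n(m + f) / sqrt n tight along random times
   measurable with respect to F_0.  S_n(m) / sqrt n is tight along all such times,
   by the maximal ergodic inequality.  But for n of order M_k / p the event
   {e_k o T^(n + l_k - N_k) != 0} belongs to F_0, because N_k >= M_k, and on
   it |S_n(f)| is about sqrt (M_k), hence at least sqrt p sqrt n.  The number of
   admissible n times 1 / (k M_k) is of order 1 / (p k), a divergent series, so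
   almost surely such a time exists for every p. *)

From HB Require Import structures.
From mathcomp Require Import ring lra zify measurable_realfun.
Require Import Defs.

Set Implicit Arguments.
Unset Strict Implicit.
Unset Printing Implicit Defensive.

Local Open Scope classical_set_scope.
Local Open Scope ring_scope.

(** A random time is encoded by finitely many disjoint sets of the past, the [i]-th carrying a
    deterministic time [t i], so no measure along a random index is ever formed. The contradiction
    is numerical: along such times a quenched limit allows mass 1/2 for large normalized sums, the
    martingale part is given 1/8, and the coboundary part forces 3/4. Tightness of the martingale
    part rests on the equality of the conditional second moment of [S_n(m)] given the past with the
    conditional mean of [S_n(m^2)]: the maximal inequality bounds the latter by a multiple of [n],
    for all relevant [n] at once, outside a small event of the past. The heat kernel plays two
    roles. Its heat equation turns a step in variance into the second-order term in space, and its
    translates are densities of Gaussian noise, so the limit found for it is a pointwise convergence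
    of mollified densities; Scheffe's lemma then reaches Lipschitz tests once the noise is removed.
    Since [f] is only an L2 limit, [S_n(f)] is always handled up to a finite horizon, through a
    truncation level [K] chosen after that horizon. *)

Section measurable_comparisons.
Context d (Omega : measurableType d) (R : realType) (f g : Omega -> R).
Hypotheses (mf : measurable_fun setT f) (mg : measurable_fun setT g).

Lemma measurable_set_le : measurable [set w | f w <= g w].
Proof. by rewrite -[X in measurable X]setTI; exact: measurable_fun_ler. Qed.

Lemma measurable_set_lt : measurable [set w | f w < g w].
Proof. by rewrite -[X in measurable X]setTI; exact: measurable_fun_ltr. Qed.

End measurable_comparisons.

(** * Integrals of real functions *)

Section Rintegral_lemmas.
Context d (Omega : measurableType d) (R : realType) (P : {measure set Omega -> \bar R}).
Implicit Types f g : Omega -> R.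

Local Notation intg f := (P.-integrable setT (EFin \o f)).
Local Notation E f := (Rintegral P setT f).

Lemma intg_measurable f : intg f -> measurable_fun setT f.
Proof. by move=> /measurable_int/measurable_EFinP. Qed.

Lemma intg_le f g : measurable_fun setT f -> intg g ->
  (forall x, `|f x| <= g x) -> intg f.
Proof.
move=> mf ig fg; apply: (le_integrable measurableT) ig => //.
  exact/measurable_EFinP.
by move=> x _ /=; rewrite lee_fin (le_trans (fg x)) ?ler_norm.
Qed.

Lemma intgD f g : intg f -> intg g -> intg (fun x => f x + g x).
Proof. exact: integrableD. Qed.

Lemma intgB f g : intg f -> intg g -> intg (fun x => f x - g x).
Proof. exact: integrableB. Qed.

Lemma intgZ (k : R) f : intg f -> intg (fun x => k * f x).
Proof. exact: integrableZl. Qed.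

Lemma intg_norm f : intg f -> intg (fun x => `|f x|).
Proof. exact: integrable_abse. Qed.

Lemma intgMb f g (c : R) : intg f -> measurable_fun setT g ->
  (forall x, `|g x| <= c) -> intg (fun x => f x * g x).
Proof.
move=> iF mg gc; apply: (@intg_le _ (fun x => c * `|f x|)).
- by apply: measurable_funM => //; exact: intg_measurable.
- exact/intgZ/intg_norm.
- by move=> x; rewrite normrM mulrC ler_wpM2r.
Qed.

Lemma intg_indic f (A : set Omega) : intg f -> measurable A ->
  intg (fun x => f x * \1_A x).
Proof.
move=> iF mA; apply: (@intgMb _ _ 1) => //.
by move=> x; rewrite indicE; case: (_ \in _); rewrite ?normr1 ?normr0.
Qed.

Lemma ED f g : intg f -> intg g -> E (fun x => f x + g x) = E f + E g.
Proof. exact: RintegralD. Qed.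

Lemma EB f g : intg f -> intg g -> E (fun x => f x - g x) = E f - E g.
Proof. exact: RintegralB. Qed.

Lemma EZ (k : R) f : intg f -> E (fun x => k * f x) = k * E f.
Proof. exact: RintegralZl. Qed.

Lemma E_le f g : intg f -> intg g -> (forall x, f x <= g x) -> E f <= E g.
Proof. by move=> iF ig fg; apply: le_Rintegral => // x _. Qed.

Lemma E_ge0 f : (forall x, 0 <= f x) -> 0 <= E f.
Proof. by move=> f0; apply: Rintegral_ge0 => x _. Qed.

Lemma normr_E f : intg f -> `|E f| <= E (fun x => `|f x|).
Proof. exact: le_normr_Rintegral. Qed.

Lemma normr_E_le f g : measurable_fun setT f -> intg g ->
  (forall x, `|f x| <= g x) -> `|E f| <= E g.
Proof.
move=> mf ig fg; have iF := intg_le mf ig fg.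
by apply: (le_trans (normr_E iF)); apply: E_le => //; exact: intg_norm.
Qed.

Lemma eqE f g : f =1 g -> E f = E g.
Proof. by move=> fg; apply: eq_Rintegral => x _. Qed.

Lemma Rintegral_indic f (A : set Omega) :
  Rintegral P A f = E (fun x => f x * \1_A x).
Proof.
rewrite Rintegral_mkcond; apply: eqE => x; rewrite patchE indicE.
by case: (_ \in _); rewrite ?mulr1 ?mulr0.
Qed.

Lemma integral_E f : intg f -> (\int[P]_x (f x)%:E)%E = (E f)%:E.
Proof. by move=> iF; rewrite /Rintegral fineK//; exact: integrable_fin_num. Qed.

Lemma integral_indic_E f (A : set Omega) : intg f -> measurable A ->
  (\int[P]_(x in A) (f x)%:E)%E = (E (fun x => f x * \1_A x))%:E.
Proof.
move=> iF mA; rewrite -Rintegral_indic /Rintegral fineK//.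
by apply: integrable_fin_num => //; exact: integrableS iF.
Qed.

Lemma E_cvg (F : nat -> Omega -> R) f g : (forall n, measurable_fun setT (F n)) ->
  measurable_fun setT f -> intg g -> (forall n x, `|F n x| <= g x) ->
  (forall x, F n x @[n --> \oo] --> f x) -> E (F n) @[n --> \oo] --> E f.
Proof.
move=> mF mf ig Fg Ff.
have [iF _ cvgF] : [/\ P.-integrable setT (EFin \o f),
  ([sequence \int[P]_(x in setT) `|(F n x)%:E - (f x)%:E|]_n @ \oo --> 0)%E &
  ([sequence \int[P]_(x in setT) (F n x)%:E]_n @ \oo --> \int[P]_x (f x)%:E)%E].
  apply: (@dominated_convergence _ _ _ P setT measurableT
    (fun n x => (F n x)%:E) (EFin \o f) (EFin \o g)) => //.
  - by move=> n; exact/measurable_EFinP.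
  - exact/measurable_EFinP.
  - by apply: aeW => x _; apply/fine_cvgP; split; [exact: nearW|exact: Ff].
  - by apply: aeW => x n _; rewrite lee_fin.
move: cvgF; rewrite integral_E// => /fine_cvgP[_]; exact.
Qed.

End Rintegral_lemmas.

Section expectation_lemmas.
Context d (Omega : measurableType d) (R : realType) (P : probability Omega R).
Implicit Types f g : Omega -> R.

Local Notation intg f := (P.-integrable setT (EFin \o f)).
Local Notation E f := (Rintegral P setT f).

Lemma intg_cst (c : R) : intg (cst c).
Proof. exact: finite_measure_integrable_cst. Qed.

Lemma intg_bounded f (c : R) : measurable_fun setT f ->
  (forall x, `|f x| <= c) -> intg f.
Proof. by move=> mf fc; exact: intg_le (intg_cst c) fc. Qed.

Lemma intg_sum (I : Type) (s : seq I) (F : I -> Omega -> R) :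
  (forall i, intg (F i)) -> intg (fun x => \sum_(i <- s) F i x).
Proof.
move=> iF; elim: s => [|i s IHs].
  by under eq_fun do rewrite big_nil; exact: intg_cst.
by under eq_fun do rewrite big_cons; exact: intgD.
Qed.

Lemma E_cst (c : R) : E (fun=> c) = c.
Proof. by rewrite Rintegral_cst//= probability_setT mulr1. Qed.

Lemma normr_E_bounded f (c : R) : measurable_fun setT f ->
  (forall x, `|f x| <= c) -> `|E f| <= c.
Proof. by move=> mf fc; rewrite -[leRHS]E_cst; apply: normr_E_le => //; exact: intg_cst. Qed.

Lemma E_sum (I : Type) (s : seq I) (F : I -> Omega -> R) :
  (forall i, intg (F i)) ->
  E (fun x => \sum_(i <- s) F i x) = \sum_(i <- s) E (F i).
Proof.
move=> iF; elim: s => [|i s IHs].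
  by under eq_Rintegral do rewrite big_nil; rewrite big_nil E_cst.
under eq_Rintegral do rewrite big_cons.
by rewrite big_cons ED ?IHs//; exact: intg_sum.
Qed.

Lemma E_indic (A : set Omega) : measurable A -> E (\1_A) = fine (P A).
Proof. by move=> mA; rewrite /Rintegral integral_indic// setIT. Qed.

Lemma PE (A : set Omega) : measurable A -> P A = (fine (P A))%:E.
Proof. by move=> mA; rewrite fineK// fin_num_measure. Qed.

Lemma le_fineP (A B : set Omega) : measurable A -> measurable B ->
  A `<=` B -> fine (P A) <= fine (P B).
Proof.
by move=> mA mB AB; rewrite fine_le ?fin_num_measure// le_measure ?inE.
Qed.

Lemma fineP_ge0 (A : set Omega) : 0 <= fine (P A).
Proof. exact/fine_ge0/measure_ge0. Qed.

Lemma markov_E f (c : R) : 0 < c -> intg f ->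
  fine (P [set x | c <= `|f x|]) <= E (fun x => `|f x|) / c.
Proof.
move=> c0 iF; have mf := intg_measurable iF.
have mA : measurable [set x | c <= `|f x|].
  apply: measurable_set_le => //.
  exact: measurableT_comp.
rewrite -E_indic// ler_pdivlMr// mulrC -EZ; last first.
  by have := intg_indic (intg_cst 1) mA; under eq_fun do rewrite mul1r.
apply: E_le; [|exact: intg_norm|].
  apply: intgZ; have := intg_indic (intg_cst 1) mA.
  by under eq_fun do rewrite mul1r.
move=> x; rewrite indicE; case: (boolP (x \in _)) => [|_]; last by rewrite mulr0.
by rewrite inE mulr1.
Qed.

Lemma E_measure_preserving (S : Omega -> Omega) f : measure_preserving P S ->
  intg f -> intg (f \o S) /\ E (f \o S) = E f.
Proof.
move=> [mS PS] iF; have mf := intg_measurable iF.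
have e A : measurable A -> pushforward P S A = P A by move=> mA; exact: PS.
have inf : intg (f \o S).
  apply/integrableP; split; first exact/measurable_EFinP/measurableT_comp.
  have /integrableP[_] := iF; rewrite (eq_measure_integral (pushforward P S)).
    rewrite ge0_integral_pushforward//.
    by apply: measurableT_comp => //; exact/measurable_EFinP.
  by move=> A mA _; exact/esym/e.
split=> //; rewrite /Rintegral; congr fine.
rewrite [RHS](eq_measure_integral (pushforward P S)); last first.
  by move=> A mA _; exact/esym/e.
rewrite integral_pushforward//.
exact/measurable_EFinP.
Qed.

End expectation_lemmas.

(** * Generated sigma-algebras and independence *)

Lemma cvg_cst_eq (R : realType) (c l : R) :
  (fun _ : nat => c) @ \oo --> l -> l = c.
Proof. by move=> h; apply: (cvg_unique _ h (cvg_cst c)). Qed.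

Section generated_measurability.
Context d (Omega : measurableType d) (R : realType).
Implicit Types (G H : set (set Omega)) (X Y : Omega -> R).

Definition gmeas G X := measurable_fun setT
  (X : g_sigma_algebraType G -> measurableTypeR R).

Lemma gmeas_preimage G X (B : set (measurableTypeR R)) :
  gmeas G X -> measurable B -> <<s G >> (X @^-1` B).
Proof. by move=> gX mB; have := gX measurableT B mB; rewrite setTI. Qed.

Lemma preimage_gmeas G X :
  (forall B : set (measurableTypeR R), measurable B -> <<s G >> (X @^-1` B)) -> gmeas G X.
Proof. by move=> h _ B mB; rewrite setTI; exact: h. Qed.

Lemma gmeas_sub G H X : <<s G >> `<=` <<s H >> -> gmeas G X -> gmeas H X.
Proof. by move=> GH gX; apply: preimage_gmeas => B mB; apply: GH; exact: gmeas_preimage. Qed.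

Lemma sigma_sub_measurable G : G `<=` measurable -> <<s G >> `<=` @measurable d Omega.
Proof.
by move=> Gm; apply: smallest_sub => //; exact: sigma_algebra_measurable.
Qed.

Lemma gmeas_measurable G X : G `<=` measurable -> gmeas G X -> measurable_fun setT X.
Proof.
move=> Gm gX _ B mB; rewrite setTI; apply: (sigma_sub_measurable Gm).
exact: gmeas_preimage.
Qed.

Lemma gmeas_cst G (c : R) : gmeas G (fun=> c).
Proof. exact: measurable_cst. Qed.

Lemma gmeasD G X Y : gmeas G X -> gmeas G Y -> gmeas G (fun x => X x + Y x).
Proof. exact: measurable_funD. Qed.

Lemma gmeasB G X Y : gmeas G X -> gmeas G Y -> gmeas G (fun x => X x - Y x).
Proof. exact: measurable_funB. Qed.

Lemma gmeasM G X Y : gmeas G X -> gmeas G Y -> gmeas G (fun x => X x * Y x).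
Proof. exact: measurable_funM. Qed.

Lemma gmeas_max G X Y : gmeas G X -> gmeas G Y ->
  gmeas G (fun x => Num.max (X x) (Y x)).
Proof. exact: measurable_maxr. Qed.

Lemma gmeas_sum G (I : Type) (s : seq I) (F : I -> Omega -> R) :
  (forall i, gmeas G (F i)) -> gmeas G (fun x => \sum_(i <- s) F i x).
Proof.
move=> gF; elim: s => [|i s IHs].
  by under eq_fun do rewrite big_nil; exact: gmeas_cst.
by under eq_fun do rewrite big_cons; exact: gmeasD.
Qed.

Lemma gmeas_comp G X (phi : R -> R) : measurable_fun setT phi -> gmeas G X ->
  gmeas G (phi \o X).
Proof. by move=> mphi gX; exact: measurableT_comp. Qed.

Lemma gmeas_indic G (A : set Omega) : <<s G >> A -> gmeas G (\1_A).
Proof.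
by move=> sA; apply: (@measurable_indic _ (g_sigma_algebraType G)).
Qed.

Lemma gmeas_ltr G X Y : gmeas G X -> gmeas G Y -> <<s G >> [set x | X x < Y x].
Proof.
move=> gX gY; rewrite -[X in <<s _ >> X]setTI.
exact: (@measurable_fun_ltr _ (g_sigma_algebraType G) _ setT X Y).
Qed.

Lemma sigma_preimage G H (S : Omega -> Omega) :
  (forall A, G A -> <<s H >> (S @^-1` A)) ->
  forall A, <<s G >> A -> <<s H >> (S @^-1` A).
Proof.
move=> GH A sA.
have mS : measurable_fun setT
    (S : g_sigma_algebraType H -> g_sigma_algebraType G).
  apply: (@measurability _ _ (g_sigma_algebraType H) (g_sigma_algebraType G) setT S G) => //.
  by move=> _ [B GB <-]; rewrite setTI; exact: GH.
by have := mS measurableT A sA; rewrite setTI.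
Qed.

Lemma gmeas_shift G H (S : Omega -> Omega) X :
  (forall A, G A -> <<s H >> (S @^-1` A)) -> gmeas G X -> gmeas H (X \o S).
Proof.
move=> GH gX; apply: preimage_gmeas => B mB.
by rewrite comp_preimage; apply: sigma_preimage GH _ _; exact: gmeas_preimage.
Qed.

Lemma sigmaI G (A B : set Omega) : <<s G >> A -> <<s G >> B -> <<s G >> (A `&` B).
Proof. by move=> sA sB; apply: (@measurableI _ (g_sigma_algebraType G)). Qed.

Lemma sigmaD G (A B : set Omega) : <<s G >> A -> <<s G >> B -> <<s G >> (A `\` B).
Proof. by move=> sA sB; apply: (@measurableD _ (g_sigma_algebraType G)). Qed.

End generated_measurability.

Import HBNNSimple.

(** * Extending orthogonality from generating sets to functions *)

Section orthogonality.
Context d (Omega : measurableType d) (R : realType) (P : probability Omega R).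
Implicit Types X Y : Omega -> R.
Local Notation intg f := (P.-integrable setT (EFin \o f)).
Local Notation E f := (Rintegral P setT f).
Variable G : set (set Omega).
Hypothesis Gm : G `<=` measurable.

(** The approximating simple functions are taken over [g_sigma_algebraType G], so their level sets
    lie in [<<s G >>], where the hypothesis applies. Dominating by [|X Y|] covers unbounded [Y]. *)
Let orthogonal_ge0 X Y : intg X ->
  (forall A, <<s G >> A -> E (fun x => X x * \1_A x) = 0) ->
  gmeas G Y -> (forall x, 0 <= Y x) -> intg (fun x => X x * Y x) ->
  E (fun x => X x * Y x) = 0.
Proof.
move=> iX X0 gY Y0 iXY.
have mY' : measurable_fun setT (EFin \o (Y : g_sigma_algebraType G -> R)).
  exact/measurable_EFinP.
pose g n : Omega -> R :=
  nnsfun_approx measurableT mY' n.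
have g_cvg x : g n x @[n --> \oo] --> Y x.
  have := cvg_nnsfun_approx measurableT mY' (fun x _ => Y0 x) (I : setT x).
  by move=> /fine_cvgP[_]; exact.
have g_le n x : g n x <= Y x.
  rewrite -(cvg_lim _ (g_cvg x))//; apply: nondecreasing_cvgn_le.
    by move=> a b ab; have /lefP := nd_nnsfun_approx measurableT mY' ab; exact.
  exact: cvgP (g_cvg x).
have g_ge0 n x : 0 <= g n x by rewrite /g.
have gg n : gmeas G (g n).
  exact: (measurable_funP (nnsfun_approx measurableT mY' n)).
have gXg n : E (fun x => X x * g n x) = 0.
  pose s : seq R := finmap.enum_fset (fset_set (range (g n))).
  have -> : (fun x => X x * g n x) =
     (fun x => \sum_(y <- s) y * (X x * \1_(g n @^-1` [set y]) x)).
    apply/funext => x; rewrite {1}/g fimfunE fsbig_finite//= big_distrr/=.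
    by apply: eq_bigr => y _; rewrite mulrCA.
  have sg y : <<s G >> (g n @^-1` [set y]) by exact: gmeas_preimage.
  have ig y : intg (fun x => X x * \1_(g n @^-1` [set y]) x).
    exact/(intg_indic iX)/(sigma_sub_measurable Gm).
  rewrite E_sum => [|y]; last exact: intgZ.
  by rewrite big1// => y _; rewrite EZ ?X0 ?mulr0.
have : E (fun x => X x * g n x) @[n --> \oo] --> E (fun x => X x * Y x).
  apply: (@E_cvg _ _ _ _ _ _ (fun x => `|X x * Y x|)).
  - move=> n; apply: measurable_funM; first exact: intg_measurable iX.
    exact: gmeas_measurable (gg n).
  - exact: intg_measurable iXY.
  - exact: intg_norm.
  - move=> n x; rewrite !normrM ler_wpM2l//.
    by rewrite !ger0_norm.
  - by move=> x; apply: cvgMr; exact: g_cvg.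
under eq_fun do rewrite gXg.
exact: cvg_cst_eq.
Qed.

Lemma orthogonal X Y : intg X ->
  (forall A, <<s G >> A -> E (fun x => X x * \1_A x) = 0) ->
  gmeas G Y -> intg (fun x => X x * Y x) -> E (fun x => X x * Y x) = 0.
Proof.
move=> iX X0 gY iXY.
have mX := intg_measurable iX; have mY := gmeas_measurable Gm gY.
have gp : gmeas G (fun x => Num.max (Y x) 0) by apply: gmeas_max => //; exact: gmeas_cst.
have gn : gmeas G (fun x => Num.max (- Y x) 0).
  apply: gmeas_max; last exact: gmeas_cst.
  by apply: (gmeas_comp (phi := -%R)) => //; exact: oppr_measurable.
have ip : intg (fun x => X x * Num.max (Y x) 0).
  apply: (intg_le _ (intg_norm iXY)).
    by apply: measurable_funM => //; exact: gmeas_measurable gp.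
  move=> x; rewrite !normrM ler_wpM2l//.
  by case: (lerP (Y x) 0) => h; rewrite ?normr0.
have in_ : intg (fun x => X x * Num.max (- Y x) 0).
  apply: (intg_le _ (intg_norm iXY)).
    by apply: measurable_funM => //; exact: gmeas_measurable gn.
  move=> x; rewrite !normrM ler_wpM2l//.
  by case: (lerP (- Y x) 0) => h; rewrite ?normr0 ?normrN.
have -> : (fun x => X x * Y x) =
    (fun x => X x * Num.max (Y x) 0 - X x * Num.max (- Y x) 0).
  apply/funext => x; rewrite -mulrBr; congr (_ * _).
  by case: (lerP (Y x) 0); case: (lerP (- Y x) 0); lra.
rewrite EB// !orthogonal_ge0 ?subr0// => x; exact: ler_maxr_r || by rewrite le_max lexx orbT.
Qed.

Lemma orthogonal_pi_lambda (Z : Omega -> R) : setI_closed G -> intg Z ->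
  E Z = 0 -> (forall A, G A -> E (fun x => Z x * \1_A x) = 0) ->
  forall A, <<s G >> A -> E (fun x => Z x * \1_A x) = 0.
Proof.
move=> GI iZ Z0 ZG.
suff : <<s G >> `<=` [set A | measurable A /\ E (fun x => Z x * \1_A x) = 0].
  by move=> h A /h[].
apply: lambda_system_subset => //; last first.
  by move=> A GA; split; [exact: Gm|exact: ZG].
split => //.
- split => //; rewrite -[RHS]Z0; apply: eqE => x.
  by rewrite indicT mulr1.
- move=> B A AB [mB ZB] [mA ZA]; split; first exact: measurableD.
  rewrite -[RHS](subrr 0) -{1}ZB -ZA -EB; [|exact: intg_indic..].
  apply: eqE => x; rewrite -mulrBr; congr (_ * _); rewrite !indicE in_setD.
  case: (boolP (x \in A)) => xA; rewrite ?andbT ?andbF/= ?subr0//.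
  by rewrite (mem_set (AB _ (set_mem xA))) subrr.
- move=> F ndF FZ; have mF n : measurable (F n) by case: (FZ n).
  have mU : measurable (\bigcup_n F n) by exact: bigcup_measurable.
  split => //.
  have : E (fun x => Z x * \1_(F n) x) @[n --> \oo] -->
      E (fun x => Z x * \1_(\bigcup_n F n) x).
    apply: (@E_cvg _ _ _ _ _ _ (fun x => `|Z x|)).
    - by move=> n; apply: (@intg_measurable _ _ _ P); exact: intg_indic.
    - by apply: (@intg_measurable _ _ _ P); exact: intg_indic.
    - exact: intg_norm.
    - move=> n x; rewrite normrM ler_piMr// indicE.
      by case: (_ \in _); rewrite ?normr1 ?normr0.
    - move=> x; apply: cvgMr; apply: cvg_near_cst.
      case: (pselect ((\bigcup_n F n) x)) => [[N _ FNx]|Fx].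
      + exists N => // n /= Nn; rewrite !indicE !mem_set//; first by exists N.
        by move/ndF : Nn => /subsetPset; exact.
      + apply: nearW => n; rewrite !indicE !memNset// => Fnx.
        by apply: Fx; exists n.
  under eq_fun do rewrite (FZ _).2.
  exact: cvg_cst_eq.
Qed.

End orthogonality.

(** * Independence of sigma-algebras generated by disjoint sets of coordinates *)

Section independence.
Context d (Omega : measurableType d) (R : realType) (P : probability Omega R).
Local Notation intg f := (P.-integrable setT (EFin \o f)).
Local Notation E f := (Rintegral P setT f).
Variables (I : eqType) (D : set I) (X : I -> Omega -> R).
Hypothesis mX : forall i, D i -> measurable_fun setT (X i).
Hypothesis indepX : mutually_independent P D X.

(** An arbitrary index set is allowed, so that the past, a remote past and a finite set of
    coordinates are all instances; [past_gen T Tinv e j] is convertible to the instance at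
    [past j]. *)
Definition coord_gen (J : set I) : set (set Omega) :=
  \bigcup_(i in J) preimage_set_system setT (X i) (@measurable _ (measurableTypeR R)).

(* The sets [B i] are [setT] off [s], so that two cylinders can be rewritten
   over a common sequence of indices. *)
Definition cylinder (J : set I) : set (set Omega) :=
  [set A | exists (s : seq I) (B : I -> set (measurableTypeR R)),
    [/\ forall i, i \in s -> J i, forall i, measurable (B i),
        forall i, i \notin s -> B i = setT &
        A = \bigcap_(i in [set i | i \in s]) (X i @^-1` B i)]].

Lemma cylinder_setI (J : set I) : setI_closed (cylinder J).
Proof.
move=> _ _ [s1 [B1 [s1J mB1 B1T ->]]] [s2 [B2 [s2J mB2 B2T ->]]].
exists (s1 ++ s2), (fun i => B1 i `&` B2 i); split.
- by move=> i; rewrite mem_cat => /orP[/s1J|/s2J].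
- by move=> i; exact: measurableI.
- move=> i; rewrite mem_cat negb_or => /andP[i1 i2].
  by rewrite B1T// B2T// setTI.
- apply/seteqP; split => [x [h1 h2] i /= _|x h].
    split.
      by have [/h1//|/B1T] := boolP (i \in s1); rewrite /preimage/= => ->.
    by have [/h2//|/B2T] := boolP (i \in s2); rewrite /preimage/= => ->.
  split=> i /= ins; have := h i; rewrite /= mem_cat ins ?orbT.
    by move=> /(_ isT)[].
  by move=> /(_ isT)[].
Qed.

Lemma cylinder_measurable (J : set I) : J `<=` D -> cylinder J `<=` measurable.
Proof.
move=> JD _ [s [B [sJ mB _ ->]]].
apply: fin_bigcap_measurable; first exact: finite_seq.
move=> i /= /sJ/JD/mX mXi.
by have := mXi measurableT _ (mB i); rewrite setTI.
Qed.

Lemma coord_gen_measurable (J : set I) : J `<=` D -> coord_gen J `<=` measurable.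
Proof. by move=> JD _ [i /JD/mX mXi] [B mB <-]; exact: mXi. Qed.

Lemma coord_gen_sub_cylinder (J : set I) : coord_gen J `<=` cylinder J.
Proof.
move=> _ [i Ji] [B mB <-]; exists [:: i], (fun j => if j == i then B else setT).
split => [j|j|j|].
- by rewrite inE => /eqP ->.
- by case: ifP => // _; exact: measurableT.
- by rewrite inE => /negbTE ->.
- rewrite setTI; apply/seteqP; split => [x Bx j /=|x /(_ i)/=].
    by rewrite inE => /eqP ->; rewrite eqxx.
  by rewrite inE eqxx; apply.
Qed.

Lemma sigma_coord_gen (J : set I) : <<s coord_gen J >> `<=` <<s cylinder J >>.
Proof. by apply: sub_sigma_algebra2; exact: coord_gen_sub_cylinder. Qed.

Lemma coord_gen_sub (J K : set I) : J `<=` K -> <<s coord_gen J >> `<=` <<s coord_gen K >>.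
Proof.
by move=> JK; apply: sub_sigma_algebra2 => A [i Ji Ai]; exists i => //; exact: JK.
Qed.

Lemma cylinder_indep (J1 J2 : set I) (A B : set Omega) :
  J1 `<=` D -> J2 `<=` D -> J1 `&` J2 = set0 ->
  cylinder J1 A -> cylinder J2 B -> P (A `&` B) = (P A * P B)%E.
Proof.
move=> J1D J2D J12 [s1 [B1 [s1J mB1 B1T ->]]] [s2 [B2 [s2J mB2 B2T ->]]].
have disj i : i \in s1 -> i \notin s2.
  move=> i1; apply/negP => i2; have : (J1 `&` J2) i by split; [exact: s1J|exact: s2J].
  by rewrite J12.
(* The product rule is available for repetition-free sequences only, hence [undup]. *)
have e s (C : I -> set (measurableTypeR R)) :
    (forall i, measurable (C i)) -> (forall i, i \in s -> D i) ->
    P (\bigcap_(i in [set i | i \in s]) (X i @^-1` C i)) =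
    (\prod_(i <- undup s) P (X i @^-1` C i))%E.
  move=> mC sD; rewrite -indepX ?undup_uniq//; last first.
    by move=> i; rewrite mem_undup; exact: sD.
  by congr (P _); apply: eq_bigcapl; split=> i /=; rewrite mem_undup.
rewrite [in RHS]e//; last by move=> i /s1J/J1D.
rewrite [in RHS]e//; last by move=> i /s2J/J2D.
have -> : \bigcap_(i in [set i | i \in s1]) X i @^-1` B1 i `&`
          \bigcap_(i in [set i | i \in s2]) X i @^-1` B2 i =
  \bigcap_(i in [set i | i \in s1 ++ s2]) X i @^-1` (B1 i `&` B2 i).
  apply/seteqP; split => [x [h1 h2] i /= _|x h].
    split.
      by have [/h1//|/B1T] := boolP (i \in s1); rewrite /preimage/= => ->.
    by have [/h2//|/B2T] := boolP (i \in s2); rewrite /preimage/= => ->.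
  split=> i /= ins; have := h i; rewrite /= mem_cat ins ?orbT.
    by move=> /(_ isT)[].
  by move=> /(_ isT)[].
rewrite e; last 2 first.
- by move=> i; exact: measurableI.
- by move=> i; rewrite mem_cat => /orP[/s1J/J1D|/s2J/J2D].
rewrite (_ : undup (s1 ++ s2) = undup s1 ++ undup s2); last first.
  rewrite undup_cat; congr (_ ++ _); apply/all_filterP/allP => i.
  by rewrite mem_undup => /disj.
rewrite big_cat/=; congr (_ * _)%E; apply: eq_big_seq => i; rewrite mem_undup.
  by move=> /disj/B2T ->; rewrite setIT.
move=> i2; rewrite B1T ?setTI//; apply/negP => /disj; by rewrite i2.
Qed.

(** The expression is the covariance of the two indicators, hence symmetric. The pi-lambda argument
    is therefore run twice, each time with one set frozen, down to [cylinder_indep]. *)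
Lemma sigma_indep (J1 J2 : set I) (A B : set Omega) :
  J1 `<=` D -> J2 `<=` D -> J1 `&` J2 = set0 ->
  <<s coord_gen J1 >> A -> <<s coord_gen J2 >> B ->
  E (fun x => (\1_B x - fine (P B)) * \1_A x) = 0.
Proof.
move=> J1D J2D J12.
have m1 := cylinder_measurable J1D; have m2 := cylinder_measurable J2D.
have iI C : measurable C -> intg (\1_C).
  move=> mC; have := intg_indic (intg_cst P 1) mC.
  by under eq_fun do rewrite mul1r.
have iZ C : measurable C -> intg (fun x => \1_C x - fine (P C)).
  by move=> mC; apply: (intgB (iI _ mC)); exact: intg_cst.
have Z0 C : measurable C -> E (fun x => \1_C x - fine (P C)) = 0.
  move=> mC; rewrite EB ?E_indic ?E_cst ?subrr//; [exact: iI|exact: intg_cst].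
have ZP C C' : measurable C -> measurable C' ->
    E (fun x => (\1_C x - fine (P C)) * \1_C' x) =
    fine (P (C' `&` C)) - fine (P C) * fine (P C').
  move=> mC mC'; under eqE do rewrite mulrBl.
  rewrite EB//; last 2 first.
    by apply: intg_indic => //; exact: iI.
    by apply: intgZ; exact: iI.
  rewrite EZ ?E_indic//; last exact: iI.
  congr (_ - _); rewrite -E_indic//; last exact: measurableI.
  by apply: eqE => x; rewrite indicI mulrC.
move=> sA sB.
have mA : measurable A.
  by apply: (sigma_sub_measurable m1); exact: sigma_coord_gen.
have mB : measurable B.
  by apply: (sigma_sub_measurable m2); exact: sigma_coord_gen.
suff : E (fun x => (\1_A x - fine (P A)) * \1_B x) = 0.
  by rewrite !ZP// setIC mulrC.
have {sB} := sigma_coord_gen sB.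
apply: orthogonal_pi_lambda => //; [exact: cylinder_setI|exact: iZ|exact: Z0|].
move=> B' cB'; have mB' := m2 _ cB'.
suff : E (fun x => (\1_B' x - fine (P B')) * \1_A x) = 0.
  by rewrite !ZP// setIC mulrC.
have := sigma_coord_gen sA.
apply: orthogonal_pi_lambda => //; [exact: cylinder_setI|exact: iZ|exact: Z0|].
move=> A' cA'; have mA' := m1 _ cA'.
rewrite ZP// (cylinder_indep J1D J2D J12 cA' cB') fineM ?fin_num_measure//.
by rewrite mulrC subrr.
Qed.

(** [orthogonal] is used twice: a centered indicator of the first sigma-algebra against the bounded
    [Z], then the centered [Z] against the integrable [Y]. *)
Lemma EM_indep (J1 J2 : set I) (Y Z : Omega -> R) (c : R) :
  J1 `<=` D -> J2 `<=` D -> J1 `&` J2 = set0 ->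
  gmeas (coord_gen J1) Y -> gmeas (coord_gen J2) Z -> intg Y ->
  (forall x, `|Z x| <= c) -> E (fun x => Y x * Z x) = E Y * E Z.
Proof.
move=> J1D J2D J12 gY gZ iY Zc.
have m1 := coord_gen_measurable J1D; have m2 := coord_gen_measurable J2D.
have mY := gmeas_measurable m1 gY; have mZ := gmeas_measurable m2 gZ.
have iZ : intg Z by exact: intg_bounded Zc.
have iY1 A : <<s coord_gen J1 >> A -> intg (fun x => \1_A x - fine (P A)).
  move=> sA; apply: intgB; last exact: intg_cst.
  apply: (@intg_bounded _ _ _ _ _ 1); last first.
    by move=> x; rewrite indicE; case: (_ \in _); rewrite ?normr0 ?normr1.
  by apply: measurable_indic; exact: (sigma_sub_measurable m1).
have step A : <<s coord_gen J1 >> A ->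
    E (fun x => (Z x - E Z) * \1_A x) = 0.
  move=> sA; have mA := sigma_sub_measurable m1 sA.
  have h : E (fun x => (\1_A x - fine (P A)) * Z x) = 0.
    apply: (orthogonal m2) => //; [exact: iY1| |].
      move=> B sB; apply: (sigma_indep J2D J1D) => //; by rewrite setIC.
    by apply: intgMb Zc => //; exact: iY1.
  have -> : (fun x => (Z x - E Z) * \1_A x) =
      (fun x => (\1_A x - fine (P A)) * Z x +
        (fine (P A) * Z x - E Z * \1_A x)).
    by apply/funext => x; ring.
  have iA : intg (\1_A).
    by have := intg_indic (intg_cst P 1) mA; under eq_fun do rewrite mul1r.
  rewrite ED; last 2 first.
    by apply: intgMb Zc => //; exact: iY1.
    by apply: intgB; exact: intgZ.
  by rewrite h EB ?EZ ?E_indic//; [ring|exact: intgZ..].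
have iZE : intg (fun x => Z x - E Z) by apply: intgB => //; exact: intg_cst.
have iYZ : intg (fun x => Y x * Z x) by exact: intgMb Zc.
have iZY : intg (fun x => (Z x - E Z) * Y x).
  have := intgB iYZ (intgZ (E Z) iY); congr (_.-integrable _ (_ \o _)).
  by apply/funext => x; ring.
have := orthogonal m1 iZE step gY iZY.
have -> : (fun x => (Z x - E Z) * Y x) = (fun x => Y x * Z x - E Z * Y x).
  by apply/funext => x; ring.
rewrite EB//; last exact: intgZ.
by rewrite EZ// => /eqP; rewrite subr_eq0 => /eqP ->; rewrite mulrC.
Qed.

End independence.

(** * Dynamics and mixing *)

Section iterz_lemmas.
Context (Omega : Type) (R : realType) (T Tinv : Omega -> Omega).
Hypotheses (TK : cancel T Tinv) (TinvK : cancel Tinv T).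

Lemma iterz_succ (i : int) w : iterz T Tinv (i + 1) w = T (iterz T Tinv i w).
Proof.
case: i => [n|[|n]].
- by rewrite -PoszD addn1.
- by rewrite /= TinvK.
- by rewrite (_ : Negz n.+1 + 1 = Negz n)//=; lia.
Qed.

Lemma iterz_pred (i : int) w : iterz T Tinv (i - 1) w = Tinv (iterz T Tinv i w).
Proof. by rewrite -{2}(subrK 1 i) iterz_succ TK. Qed.

Lemma iterzD (i j : int) w :
  iterz T Tinv (i + j) w = iterz T Tinv i (iterz T Tinv j w).
Proof.
elim/int_rec: i => [|n IHn|n IHn]; first by rewrite add0r.
  by rewrite -addn1 PoszD addrAC iterz_succ IHn iterz_succ.
by rewrite -addn1 PoszD opprD addrAC iterz_pred IHn iterz_pred.
Qed.

Lemma iterz_oppn (n : nat) w : iterz T Tinv (- n%:Z) w = iter n Tinv w.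
Proof. by case: n => [|n]; rewrite ?oppr0// -NegzE. Qed.

Lemma koopmanD (i j : int) (g : Omega -> R) :
  koopman T Tinv i (koopman T Tinv j g) = koopman T Tinv (j + i) g.
Proof. by apply/funext => w; rewrite /koopman /= iterzD. Qed.

End iterz_lemmas.

Section dynamics.
Context d (Omega : measurableType d) (R : realType) (P : probability Omega R).
Implicit Types Y Z : Omega -> R.
Local Notation intg f := (P.-integrable setT (EFin \o f)).
Local Notation E f := (Rintegral P setT f).
Variables (T Tinv : Omega -> Omega).
Hypotheses (TK : cancel T Tinv) (TinvK : cancel Tinv T).
Hypothesis mTinv : measurable_fun setT Tinv.
Hypothesis T_pres : measure_preserving P T.

Lemma mp_comp (S1 S2 : Omega -> Omega) : measure_preserving P S1 ->
  measure_preserving P S2 -> measure_preserving P (S1 \o S2).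
Proof.
move=> [m1 p1] [m2 p2]; split; first exact: measurableT_comp.
move=> A mA; rewrite comp_preimage p2 ?p1//.
by have := m1 measurableT A mA; rewrite setTI.
Qed.

Lemma mp_Tinv : measure_preserving P Tinv.
Proof.
split=> // A mA.
have mA' : measurable (Tinv @^-1` A) by have := mTinv measurableT mA; rewrite setTI.
rewrite -T_pres.2//; congr (P _); apply/seteqP; split => w; rewrite /preimage/= TK//.
Qed.

Lemma mp_id : measure_preserving P idfun.
Proof. by split => //; exact: measurable_id. Qed.

Lemma mp_iterz (i : int) : measure_preserving P (iterz T Tinv i).
Proof.
case: i => n /=.
  elim: n => [|n IHn]; first exact: mp_id.
  exact: (mp_comp T_pres IHn).
elim: n => [|n IHn]; first exact: mp_Tinv.
exact: (mp_comp mp_Tinv IHn).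
Qed.

Lemma mp_iter_inv (n : nat) : measure_preserving P (iter n Tinv).
Proof.
have -> : iter n Tinv = iterz T Tinv (- n%:Z) by apply/funext => w; rewrite iterz_oppn.
exact: mp_iterz.
Qed.

Lemma E_koopman (i : int) f : intg f -> E (koopman T Tinv i f) = E f.
Proof. by move=> iF; have [_] := E_measure_preserving (mp_iterz i) iF. Qed.

Lemma intg_koopman (i : int) f : intg f -> intg (koopman T Tinv i f).
Proof. by move=> iF; have [] := E_measure_preserving (mp_iterz i) iF. Qed.

Variable e : nat -> Omega -> R.
Hypothesis me : forall k : nat, (1 <= k)%N -> measurable_fun setT (e k).

Definition coordinate (ik : int * nat) : Omega -> R := koopman T Tinv ik.1 (e ik.2).
Definition coord_dom : set (int * nat) := [set ik | (1 <= ik.2)%N].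
Definition past (j : int) : set (int * nat) :=
  [set ik | (ik.1 <= j)%R /\ (1 <= ik.2)%N].

Hypothesis e_indep : mutually_independent P coord_dom coordinate.

Lemma measurable_coord ik : coord_dom ik -> measurable_fun setT (coordinate ik).
Proof.
move=> /me mk; apply: measurableT_comp => //.
by have [] := mp_iterz ik.1.
Qed.

Lemma past_dom j : past j `<=` coord_dom.
Proof. by move=> ik []. Qed.

Lemma past_measurable j : past_gen T Tinv e j `<=` measurable.
Proof. exact: (coord_gen_measurable measurable_coord (@past_dom j)). Qed.

(** Composing [U^i e_k] with [T^r] gives [U^(i+r) e_k], so the time indices of the generators move
    by [r]. *)
Lemma coord_gen_shift (r : int) (J J' : set (int * nat)) A :
  (forall ik, J ik -> J' (ik.1 + r, ik.2)) ->
  coord_gen coordinate J A -> <<s coord_gen coordinate J' >> (iterz T Tinv r @^-1` A).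
Proof.
move=> JJ' [ik Jik [B mB <-]]; apply: sub_sigma_algebra.
exists (ik.1 + r, ik.2); first exact: JJ'.
exists B => //; rewrite !setTI; apply/seteqP.
by split => w; rewrite /preimage /coordinate /koopman /= iterzD.
Qed.

Lemma gmeas_koopman (r : int) (J J' : set (int * nat)) Y :
  (forall ik, J ik -> J' (ik.1 + r, ik.2)) ->
  gmeas (coord_gen coordinate J) Y -> gmeas (coord_gen coordinate J') (koopman T Tinv r Y).
Proof.
by move=> JJ'; apply: gmeas_shift => A; exact: coord_gen_shift.
Qed.

Lemma gmeas_past_shift (r j : int) Y :
  gmeas (past_gen T Tinv e j) Y ->
  gmeas (past_gen T Tinv e (j + r)) (koopman T Tinv r Y).
Proof.
apply: gmeas_koopman => ik [h1 h2]; split => //=.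
by rewrite lerD2r.
Qed.

Lemma past_sub (i j : int) : (i <= j)%R ->
  <<s past_gen T Tinv e i >> `<=` <<s past_gen T Tinv e j >>.
Proof.
by move=> ij; apply: coord_gen_sub => ik [h1 h2]; split => //; exact: le_trans ij.
Qed.

Lemma gmeas_past_le (i j : int) Y : (i <= j)%R ->
  gmeas (past_gen T Tinv e i) Y -> gmeas (past_gen T Tinv e j) Y.
Proof. by move=> ij; apply: gmeas_sub; exact: past_sub. Qed.

Lemma gmeas_past_iter_inv (n : nat) Y : gmeas (past_gen T Tinv e 0) Y ->
  gmeas (past_gen T Tinv e (- n%:Z)) (Y \o iter n Tinv).
Proof.
move=> gY; have -> : Y \o iter n Tinv = koopman T Tinv (- n%:Z) Y.
  by apply/funext => w; rewrite /koopman /= iterz_oppn.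
by rewrite -[X in past_gen _ _ _ X]add0r; exact: gmeas_past_shift.
Qed.

(* Kolmogorov mixing, uniformly over the test functions of the remote past. *)
Definition mixes (Z : Omega -> R) : Prop := intg Z /\
  forall eps : R, 0 < eps -> exists L : nat, forall n : nat, (L <= n)%N ->
  forall Y : Omega -> R, gmeas (past_gen T Tinv e 0) Y -> (forall w, `|Y w| <= 1) ->
  `|E (fun w => Z w * Y (iter n Tinv w)) - E Z * E Y| <= eps.

Let intg_past n Y : gmeas (past_gen T Tinv e 0) Y -> (forall w, `|Y w| <= 1) ->
  [/\ intg Y, measurable_fun setT (fun w => Y (iter n Tinv w)) & `|E Y| <= 1].
Proof.
move=> gY Y1; have mY := gmeas_measurable (@past_measurable 0) gY.
split; first exact: intg_bounded Y1.
  by apply: measurableT_comp => //; have [] := mp_iter_inv n.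
exact: normr_E_bounded.
Qed.

Lemma mixesB Z1 Z2 : mixes Z1 -> mixes Z2 -> mixes (fun w => Z1 w - Z2 w).
Proof.
move=> [i1 h1] [i2 h2]; split; first exact: intgB.
move=> eps eps0; have e2 : 0 < eps / 2 by rewrite divr_gt0.
have [L1 {}h1] := h1 _ e2; have [L2 {}h2] := h2 _ e2.
exists (maxn L1 L2) => n; rewrite geq_max => /andP[/h1 {}h1 /h2 {}h2] Y gY Y1.
have [iY mYn _] := intg_past n gY Y1.
have Y1n w := Y1 (iter n Tinv w).
have -> : (fun w => (Z1 w - Z2 w) * Y (iter n Tinv w)) =
  (fun w => Z1 w * Y (iter n Tinv w) - Z2 w * Y (iter n Tinv w)).
  by apply/funext => w; rewrite mulrBl.
rewrite (EB (intgMb i1 mYn Y1n) (intgMb i2 mYn Y1n)) (EB i1 i2).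
set a1 := E _; set a2 := E _.
have -> : a1 - a2 - (E Z1 - E Z2) * E Y =
  (a1 - E Z1 * E Y) - (a2 - E Z2 * E Y) by ring.
apply: (le_trans (ler_normB _ _)).
by rewrite (splitr eps) lerD//; [exact: h1|exact: h2].
Qed.

(** Since [|Y| <= 1], trading [Z] for [Z'] changes the correlation by at most twice their L1
    distance, uniformly in [Y] and [n]. *)
Lemma mixes_approx Z : intg Z ->
  (forall eps : R, 0 < eps -> exists2 Z', mixes Z' & E (fun w => `|Z w - Z' w|) <= eps) ->
  mixes Z.
Proof.
move=> iZ approxZ; split=> // eps eps0.
have e4 : 0 < eps / 4 by rewrite divr_gt0.
have [Z' [iZ' hZ'] ZZ'] := approxZ _ e4.
have [L hL] := hZ' _ e4.
exists L => n Ln Y gY Y1; have {}hL := hL n Ln Y gY Y1.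
have [iY mYn EY] := intg_past n gY Y1.
have iD := intgB iZ iZ'.
have Y1n w := Y1 (iter n Tinv w).
have iDY : intg (fun w => (Z w - Z' w) * Y (iter n Tinv w)) by exact: (intgMb iD mYn Y1n).
have iZ'Y : intg (fun w => Z' w * Y (iter n Tinv w)) by exact: (intgMb iZ' mYn Y1n).
have -> : (fun w => Z w * Y (iter n Tinv w)) =
  (fun w => (Z w - Z' w) * Y (iter n Tinv w) + Z' w * Y (iter n Tinv w)).
  by apply/funext => w; ring.
rewrite ED//.
have -> : E Z = E (fun w => Z w - Z' w) + E Z' by rewrite EB//; ring.
set a := E _ in hL *; set b := E (fun w => (_ - _) * _); set c := E (fun w => _ - _).
have hb : `|b| <= eps / 4.
  apply: (le_trans _ ZZ'); apply: normr_E_le; [|exact: intg_norm|].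
    by apply: (@intg_measurable _ _ _ P).
  by move=> w; rewrite normrM ler_piMr.
have hc : `|c * E Y| <= eps / 4.
  rewrite normrM; apply: (@le_trans _ _ `|c|); first by rewrite ler_piMr.
  by apply: (le_trans _ ZZ'); exact: normr_E.
have -> : b + a - (c + E Z') * E Y = b + (a - E Z' * E Y) - c * E Y by ring.
apply: (le_trans (ler_normB _ _)); apply: (le_trans (lerD (ler_normD _ _) hc)).
by move: hb hL; lra.
Qed.

Lemma mixesZ (c : R) Z : mixes Z -> mixes (fun w => c * Z w).
Proof.
move=> [iZ hZ]; split; first exact: intgZ.
move=> eps eps0; have c1 : 0 < `|c| + 1 by rewrite ltr_wpDl.
have [L hL] := hZ (eps / (`|c| + 1)) (divr_gt0 eps0 c1).
exists L => n /hL {}hL Y gY Y1; have {}hL := hL Y gY Y1.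
have [iY mYn EY] := intg_past n gY Y1.
have -> : (fun w => c * Z w * Y (iter n Tinv w)) =
  (fun w => c * (Z w * Y (iter n Tinv w))) by apply/funext => w; ring.
rewrite !EZ//; last exact: (intgMb iZ mYn (fun w => Y1 (iter n Tinv w))).
rewrite -mulrA -mulrBr normrM.
apply: (le_trans (ler_wpM2l _ hL)) => //.
by rewrite mulrCA ler_piMr ?(ltW eps0)// ler_pdivrMr// mul1r lerDl.
Qed.

Lemma mixes_sum (I : Type) (s : seq I) (F : I -> Omega -> R) :
  (forall i, mixes (F i)) -> mixes (fun w => \sum_(i <- s) F i w).
Proof.
have mixes0 : mixes (fun=> 0).
  split; first exact: intg_cst.
  move=> eps eps0; exists 0 => n _ Y _ _.
  under eqE do rewrite mul0r.
  by rewrite !E_cst mul0r subrr normr0 ltW.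
move=> hF; elim: s => [|i s IHs].
  by under eq_fun do rewrite big_nil.
under eq_fun do rewrite big_cons.
have := mixesB (hF i) (mixesB mixes0 IHs); congr mixes.
by apply/funext => w; ring.
Qed.

(** A cylinder sees finitely many times, all later than [-n] once [n] is large. The test function
    moved back by [n] then depends on other coordinates, and the correlation vanishes exactly. *)
Lemma mixes_cylinder A : cylinder coordinate (past 0) A -> mixes (\1_A).
Proof.
move=> cA; have mA := cylinder_measurable measurable_coord (@past_dom 0) cA.
have i1 : intg (\1_A).
  by have := intg_indic (intg_cst P 1) mA; under eq_fun do rewrite mul1r.
split=> // eps eps0; case: cA => s [B [sJ mB BT AE]].
(* A sum plus one stands in for a maximum: it exceeds the absolute value of every time index in
   [s]. *)
exists (\sum_(ik <- s) `|ik.1|%N).+1%N => n Ln Y gY Y1.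
have [iY mYn EY] := intg_past n gY Y1.
have bound ik : ik \in s -> (- n%:Z < ik.1)%R.
  move=> iks; have : (`|ik.1| <= \sum_(ik <- s) `|ik.1|)%N.
    by rewrite (big_rem _ iks)/= leq_addr.
  by move: Ln; lia.
have sD : [set` s] `<=` coord_dom by move=> ik /= /sJ[].
have disj : [set` s] `&` past (- n%:Z) = set0.
  apply/seteqP; split => // ik [] /= /bound h1 [h2 _]; move: (lt_le_trans h1 h2).
  by rewrite ltxx.
have gA : gmeas (coord_gen coordinate [set` s]) (\1_A : Omega -> R).
  apply: gmeas_indic; rewrite AE.
  apply: (@fin_bigcap_measurable _ (g_sigma_algebraType (coord_gen coordinate [set` s]))).
    exact: finite_seq.
  move=> ik /= iks; apply: sub_sigma_algebra; exists ik => //.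
  by exists (B ik) => //; rewrite setTI.
have := EM_indep measurable_coord e_indep sD (@past_dom _) disj gA
  (gmeas_past_iter_inv (n:=n) gY) i1 (fun w => Y1 (iter n Tinv w)).
rewrite /comp => ->.
have [_] := E_measure_preserving (mp_iter_inv n) iY; rewrite /comp => ->.
by rewrite subrr normr0 ltW.
Qed.

(** The sets whose indicator mixes form a lambda-system. For increasing unions, the uniformity over
    [Y] built into [mixes] is what lets [mixes_approx] pass to the limit. *)
Lemma mixes_set A : <<s past_gen T Tinv e 0 >> A -> mixes (\1_A).
Proof.
have ind C : measurable C -> intg (\1_C).
  move=> mC; have := intg_indic (intg_cst P 1) mC.
  by under eq_fun do rewrite mul1r.
move=> /sigma_coord_gen; have := cylinder_measurable measurable_coord (@past_dom 0).
move=> cm sA.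
suff : <<s cylinder coordinate (past 0) >> `<=` [set A | measurable A /\ mixes (\1_A)].
  by move=> h; have [] := h A sA.
apply: lambda_system_subset => //; [exact: cylinder_setI| |]; last first.
  by move=> C cC; split; [exact: cm|exact: mixes_cylinder].
split => //.
- split => //; split; first exact: ind.
  move=> eps eps0; exists 0 => n _ Y gY Y1; have [iY _ _] := intg_past n gY Y1.
  have -> : (fun w => \1_setT w * Y (iter n Tinv w)) = Y \o iter n Tinv.
    by apply/funext => w; rewrite indicT mul1r.
  have [_ ->] := E_measure_preserving (mp_iter_inv n) iY.
  by rewrite E_indic// probability_setT mul1r subrr normr0 ltW.
- move=> B C CB [mB xB] [mC xC]; split; first exact: measurableD.
  have := mixesB xB xC; congr mixes; apply/funext => w.
  rewrite !indicE in_setD.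
  case: (boolP (w \in C)) => wC; rewrite ?andbT ?andbF/= ?subr0//.
  by rewrite (mem_set (CB _ (set_mem wC))) subrr.
- move=> F ndF hF; have mF n : measurable (F n) by case: (hF n).
  have mU : measurable (\bigcup_n F n) by exact: bigcup_measurable.
  split=> //; apply: mixes_approx; first exact: ind.
  have : E (fun w => `|\1_(\bigcup_n F n) w - \1_(F n) w|) @[n --> \oo] --> (0 : R).
    rewrite -[X in _ --> X](E_cst P 0).
    apply: (@E_cvg _ _ _ _ _ _ (cst 1)); [|exact: measurable_cst|exact: intg_cst| |].
    - move=> n; apply: measurableT_comp => //.
      by apply: measurable_funB; exact: measurable_indic.
    - move=> n x; rewrite normr_id !indicE.
      by do 2 case: (_ \in _); rewrite ?subrr ?subr0 ?sub0r ?normrN ?normr0 ?normr1.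
    - move=> x; apply: cvg_near_cst.
      case: (pselect ((\bigcup_n F n) x)) => [[N _ FNx]|Fx].
      + exists N => // n /= Nn.
        have Fnx : F n x by move/ndF : Nn => /subsetPset; exact.
        by rewrite !indicE !mem_set ?subrr ?normr0//; exists n.
      + apply: nearW => n; rewrite !indicE !memNset ?subrr ?normr0// => Fnx.
        by apply: Fx; exists n.
  move=> /cvgr0_norm_le h eps eps0; have [N _ /(_ N (leqnn N)) hN] := h _ eps0.
  exists (\1_(F N)); first by have [] := hF N.
  by apply: le_trans hN; exact: ler_norm.
Qed.

Lemma mixes_ge0 Z : gmeas (past_gen T Tinv e 0) Z -> intg Z -> (forall w, 0 <= Z w) ->
  mixes Z.
Proof.
set G := past_gen T Tinv e 0 => gZ iZ Z0; apply: mixes_approx => //.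
have mZ' : measurable_fun setT (EFin \o (Z : g_sigma_algebraType G -> R)).
  exact/measurable_EFinP.
pose g n : Omega -> R := nnsfun_approx measurableT mZ' n.
have g_cvg x : g n x @[n --> \oo] --> Z x.
  have := cvg_nnsfun_approx measurableT mZ' (fun x _ => Z0 x) (I : setT x).
  by move=> /fine_cvgP[_]; exact.
have g_le n x : g n x <= Z x.
  rewrite -(cvg_lim _ (g_cvg x))//; apply: nondecreasing_cvgn_le.
    by move=> a b ab; have /lefP := nd_nnsfun_approx measurableT mZ' ab; exact.
  exact: cvgP (g_cvg x).
have g_ge0 n x : 0 <= g n x by rewrite /g.
have gg n : gmeas G (g n).
  exact: (measurable_funP (nnsfun_approx measurableT mZ' n)).
have mg n : mixes (g n).
  have -> : g n = (fun x =>
      \sum_(y <- finmap.enum_fset (fset_set (range (g n)))) y * \1_(g n @^-1` [set y]) x).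
    by apply/funext => x; rewrite {1}/g fimfunE fsbig_finite.
  by apply: mixes_sum => y; apply/mixesZ/mixes_set; exact: gmeas_preimage.
have : E (fun w => `|Z w - g n w|) @[n --> \oo] --> (0 : R).
  rewrite -[X in _ --> X](E_cst P 0).
  apply: (@E_cvg _ _ _ _ _ _ Z) => //.
  - move=> n; apply: measurableT_comp => //.
    by apply: measurable_funB; [|have [] := mg n => ? _];
      apply: (@intg_measurable _ _ _ P).
  - by move=> n x; rewrite normr_id ger0_norm ?subr_ge0// gerBl.
  - move=> x; have : `|Z x - g n x| @[n --> \oo] --> `|Z x - Z x|.
      by apply: cvg_norm; apply: cvgB; [exact: cvg_cst|exact: g_cvg].
    by rewrite subrr normr0.
move=> /cvgr0_norm_le h eps eps0; have [N _ /(_ N (leqnn N)) hN] := h _ eps0.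
by exists (g N) => //; apply: le_trans hN; exact: ler_norm.
Qed.

End dynamics.

(** * Conditional expectation and martingale increments *)

Section conditional_expectation.
Context d (Omega : measurableType d) (R : realType) (P : probability Omega R).
Local Notation intg f := (P.-integrable setT (EFin \o f)).
Local Notation E f := (Rintegral P setT f).

(** A Radon-Nikodym derivative: the charge with density [X] and the measure [P] are both pushed to
    the coarser measurable space by the identity map, and the derivative found there is
    automatically measurable for [<<s G >>]. *)
Lemma cond_exp_exists (G : set (set Omega)) (X : Omega -> R) :
  G `<=` measurable -> intg X ->
  exists Y : Omega -> R, [/\ gmeas G Y, intg Y &
    forall A, <<s G >> A -> E (fun x => Y x * \1_A x) = E (fun x => X x * \1_A x)].
Proof.
move=> Gm iX.
pose pi : Omega -> g_sigma_algebraType G := idfun.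
have mpi : measurable_fun setT pi.
  by move=> _ B sB; rewrite setTI; exact: (sigma_sub_measurable Gm).
pose pim : {mfun Omega >-> g_sigma_algebraType G} :=
  MeasurableFun.Pack (MeasurableFun.Class (isMeasurableFun.Build _ _ _ _ _ mpi)).
pose mu' := distribution P pim.
pose nu' : {charge set g_sigma_algebraType G -> \bar R} :=
  measure_function_pushforward__canonical__charge_Charge (induced_charge iX) mpi.
have nu'E A : nu' A = (\int[P]_(x in A) (X x)%:E)%E by [].
have mu'E A : mu' A = P A by [].
have dom : nu' `<< mu'.
  apply/null_content_dominatesP => A mA muA0; have PA0 : P A = 0%E by exact: muA0.
  apply: null_set_integral => //; first exact: (sigma_sub_measurable Gm).
  by apply: measurable_funTS; exact: measurable_int iX.
pose D := Radon_Nikodym nu' mu'.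
have iD : mu'.-integrable setT D by exact: Radon_Nikodym_integrable.
have mD : measurable_fun setT D by exact: measurable_int iD.
have Dfin x : (fine (D x))%:E = D x by rewrite fineK//; exact: Radon_Nikodym_fin_num.
pose Y : Omega -> R := fun x => fine (D x).
have gY : gmeas G Y.
  by apply: (measurableT_comp (f := fine)) => //; exact: fine_measurable.
have iY : intg Y.
  apply/integrableP; split.
    by apply/measurable_EFinP; exact: gmeas_measurable gY.
  have /integrableP[_] := iD; rewrite ge0_integral_distribution//; last first.
    exact: measurableT_comp.
  by under eq_integral do rewrite /= -Dfin.
exists Y; split=> // A sA; have mA := sigma_sub_measurable Gm sA.
apply: EFin_inj; rewrite -!integral_indic_E// -nu'E.
rewrite (Radon_Nikodym_integral dom sA) (integral_pushforward mpi mD)//.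
  by apply: eq_integral => x _; rewrite /Y Dfin.
apply: eq_integrable (integrableS _ _ _ iY) => //.
by move=> x _; rewrite /= /Y Dfin.
Qed.
End conditional_expectation.

Lemma sqr_normr (R : realDomainType) (x : R) : `|x| ^+ 2 = x ^+ 2.
Proof. by rewrite real_normK// num_real. Qed.

(** * Second moments of the martingale and tightness along random times *)

Section martingale.
Context d (Omega : measurableType d) (R : realType) (P : probability Omega R).
Local Notation intg f := (P.-integrable setT (EFin \o f)).
Local Notation E f := (Rintegral P setT f).
Implicit Types Y Z : Omega -> R.
Variables (T Tinv : Omega -> Omega).
Hypotheses (TK : cancel T Tinv) (TinvK : cancel Tinv T).
Hypothesis mTinv : measurable_fun setT Tinv.
Hypothesis T_pres : measure_preserving P T.
Variable e : nat -> Omega -> R.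
Hypothesis me : forall k : nat, (1 <= k)%N -> measurable_fun setT (e k).
Let F0 := past_gen T Tinv e 0.
Let S (h : Omega -> R) n := birkhoff_sum T Tinv h n.

Let F0m : F0 `<=` measurable.
Proof. exact: (past_measurable TK mTinv T_pres me). Qed.

Lemma intg_ind (A : set Omega) : measurable A -> intg (\1_A).
Proof.
by move=> mA; have := intg_indic (intg_cst P 1) mA; under eq_fun do rewrite mul1r.
Qed.

Lemma intgM_sqr Y Z : measurable_fun setT Y -> measurable_fun setT Z ->
  intg (fun w => Y w ^+ 2) -> intg (fun w => Z w ^+ 2) ->
  intg (fun w => Y w * Z w).
Proof.
move=> mY mZ iY iZ; apply: (intg_le _ (intgD iY iZ)).
  exact: measurable_funM.
move=> w; rewrite normrM -[Y w ^+ 2]sqr_normr -[Z w ^+ 2]sqr_normr.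
have := sqr_ge0 (`|Y w| - `|Z w|); have := normr_ge0 (Y w); have := normr_ge0 (Z w).
set a := `|Y w|; set b := `|Z w|; nra.
Qed.

Lemma birkhoff_sumS (h : Omega -> R) n w :
  S h n.+1 w = S h n w + koopman T Tinv n.+1%:Z h w.
Proof. by rewrite /S /birkhoff_sum big_nat_recr. Qed.

Lemma birkhoff_sum0 (h : Omega -> R) w : S h 0 w = 0.
Proof. by rewrite /S /birkhoff_sum big_geq. Qed.

Lemma birkhoff_sumSl (h : Omega -> R) n w :
  S h n.+1 w = h (T w) + S h n (T w).
Proof.
rewrite /S /birkhoff_sum big_nat_recl//; congr (_ + _).
by apply: eq_big_nat => i _; rewrite /koopman/= -iterSr.
Qed.

Lemma intg_birkhoff (h : Omega -> R) n : intg h -> intg (S h n).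
Proof. by move=> ih; apply: intg_sum => i; exact: intg_koopman. Qed.

Variable m : Omega -> R.
Hypothesis mF0 : gmeas F0 m.
Hypothesis im2 : intg (fun w => m w ^+ 2).
Hypothesis m_mart : forall A, <<s F0 >> A -> E (fun w => m (T w) * \1_A w) = 0.

Let mm : measurable_fun setT m.
Proof. exact: gmeas_measurable mF0. Qed.

Lemma sqr_intg : intg m.
Proof.
apply: (intg_le mm (intgD (intg_cst P 1) im2)) => w.
rewrite -[m w ^+ 2]sqr_normr /=; have := normr_ge0 (m w); set a := `|m w|; nra.
Qed.
Let im := sqr_intg.

Let imT : intg (fun w => m (T w)).
Proof. by have [] := E_measure_preserving T_pres im. Qed.

Lemma martingale_orth Y : gmeas F0 Y -> intg (fun w => m (T w) * Y w) ->
  E (fun w => m (T w) * Y w) = 0.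
Proof. by move=> gY iY; exact: (orthogonal F0m imT m_mart gY iY). Qed.

Lemma gmeas_birkhoff n : gmeas (past_gen T Tinv e n%:Z) (S m n).
Proof.
elim: n => [|n IHn].
  have -> : S m 0 = (fun=> 0) by apply/funext => w; rewrite birkhoff_sum0.
  exact: gmeas_cst.
have -> : S m n.+1 = (fun w => S m n w + koopman T Tinv n.+1%:Z m w).
  by apply/funext => w; rewrite birkhoff_sumS.
apply: gmeasD; first by apply: gmeas_past_le IHn; rewrite lez_nat.
by rewrite -[X in past_gen _ _ _ X]add0r; exact: gmeas_past_shift.
Qed.

Let mS n : measurable_fun setT (S m n).
Proof. by have := @intg_birkhoff m n im; exact: intg_measurable. Qed.

Let ikm2 i : intg (fun w => koopman T Tinv i m w ^+ 2).
Proof. exact: (intg_koopman TK mTinv T_pres i im2). Qed.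

Lemma intg_birkhoff_sqr n : intg (fun w => S m n w ^+ 2).
Proof.
elim: n => [|n IHn].
  have -> : (fun w => S m 0 w ^+ 2) = cst 0.
    by apply/funext => w; rewrite birkhoff_sum0 expr0n.
  exact: intg_cst.
have -> : (fun w => S m n.+1 w ^+ 2) =
  (fun w => S m n w ^+ 2 + (2 * (S m n w * koopman T Tinv n.+1%:Z m w) +
    koopman T Tinv n.+1%:Z m w ^+ 2)).
  by apply/funext => w; rewrite birkhoff_sumS; ring.
apply: (intgD IHn); apply: intgD (ikm2 _); apply: intgZ.
apply: intgM_sqr => //.
by have := intg_koopman TK mTinv T_pres n.+1%:Z im; exact: intg_measurable.
Qed.

(** The increments are orthogonal given the past, so only the squares remain. Localizing to every
    [A] of [F0] makes this an identity of conditional second moments. *)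
Lemma birkhoff_sqr n A : <<s F0 >> A ->
  E (fun w => S m n w ^+ 2 * \1_A w) =
  E (fun w => S (fun w => m w ^+ 2) n w * \1_A w).
Proof.
move=> sA; have mA : measurable A by exact: (sigma_sub_measurable F0m).
elim: n => [|n IHn].
  by apply: eqE => w; rewrite !birkhoff_sum0 expr0n.
set k := koopman T Tinv n.+1%:Z m.
have mk : measurable_fun setT k.
  by have := intg_koopman TK mTinv T_pres n.+1%:Z im; exact: intg_measurable.
have iSk : intg (fun w => S m n w * k w).
  exact: (intgM_sqr (mS n) mk (intg_birkhoff_sqr n) (ikm2 _)).
have -> : (fun w => S m n.+1 w ^+ 2 * \1_A w) =
  (fun w => S m n w ^+ 2 * \1_A w + (2 * (S m n w * k w * \1_A w) + k w ^+ 2 * \1_A w)).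
  by apply/funext => w; rewrite birkhoff_sumS -/k; ring.
have i1 : intg (fun w => S m n w ^+ 2 * \1_A w).
  exact: (intg_indic (intg_birkhoff_sqr n) mA).
have i2 : intg (fun w => S m n w * k w * \1_A w) by exact: intg_indic.
have i3 : intg (fun w => k w ^+ 2 * \1_A w) by exact: intg_indic (ikm2 _) mA.
rewrite ED//; last by apply: intgD => //; exact: intgZ.
rewrite ED//; last exact: intgZ.
rewrite EZ// IHn.
have -> : E (fun w => S m n w * k w * \1_A w) = 0.
  (* The cross term is moved back by [T^(-n)]: the factor known at time [n] becomes measurable for
     [F0], and the next increment becomes [m \o T]. *)
  pose Y := koopman T Tinv (- n%:Z) (fun w => S m n w * \1_A w).
  have gY : gmeas F0 Y.
    rewrite /F0 -[X in past_gen _ _ _ X](subrr n%:Z).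
    apply: gmeas_past_shift => //; apply: gmeasM; first exact: gmeas_birkhoff.
    by apply: gmeas_indic; exact: (past_sub _ sA).
  have e1 : (fun w => S m n w * k w * \1_A w) =
      koopman T Tinv n%:Z (fun w => m (T w) * Y w).
    apply/funext => w; rewrite /Y /k /koopman /=.
    have -> : iterz T Tinv (- n%:Z) (iter n T w) = w.
      by rewrite -[iter n T w]/(iterz T Tinv n%:Z w) -iterzD// addNr.
    by ring.
  rewrite e1 E_koopman//; last first.
    have -> : (fun w => m (T w) * Y w) =
        koopman T Tinv (- n%:Z) (fun w => S m n w * k w * \1_A w).
      by rewrite e1 koopmanD// addrN.
    exact: intg_koopman.
  apply: martingale_orth => //.
  have -> : (fun w => m (T w) * Y w) =
      koopman T Tinv (- n%:Z) (fun w => S m n w * k w * \1_A w).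
    by rewrite e1 koopmanD// addrN.
  exact: intg_koopman.
rewrite mulr0 add0r -ED//; last first.
  by apply: intg_indic => //; exact: intg_birkhoff.
by apply: eqE => w; rewrite birkhoff_sumS /k /koopman /=; ring.
Qed.

(** * Maximal ergodic inequality for conditional expectations *)

Section hopf.
Variable h : Omega -> R.
Hypothesis ih : intg h.

Let ihT X : intg X -> intg (fun w => h (T w) + X (T w)).
Proof.
by move=> iX; have [] := E_measure_preserving T_pres (intgD ih iX).
Qed.

(* [s n] is a version of the conditional expectation given [F0] of the
   Birkhoff sum [S h n]. *)
Lemma cond_birkhoff : exists s : nat -> Omega -> R,
  [/\ s 0 = (fun=> 0), forall n, gmeas F0 (s n), forall n, intg (s n) &
  forall n A, <<s F0 >> A -> E (fun w => s n.+1 w * \1_A w) =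
    E (fun w => (h (T w) + s n (T w)) * \1_A w)].
Proof.
(* The recursion [s_(n+1) = E(h \o T + s_n \o T | F0)] mirrors [birkhoff_sumSl]; it runs on a
   subtype because each step needs the integrability of the previous term. *)
pose Q (X : Omega -> R) := gmeas F0 X /\ intg X.
pose rel (x y : {X | Q X}) := forall A, <<s F0 >> A ->
  E (fun w => sval y w * \1_A w) = E (fun w => (h (T w) + sval x (T w)) * \1_A w).
have step (x : {X | Q X}) : {y | rel x y}.
  apply: cid; case: x => X [gX iX]; have [Y [gY iY YE]] := cond_exp_exists F0m (ihT iX).
  by exists (exist _ Y (conj gY iY)).
have Q0 : Q (fun=> 0) by split; [exact: gmeas_cst|exact: intg_cst].
pose s := fix s n := if n is n'.+1 then sval (step (s n')) else exist _ _ Q0.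
exists (fun n => sval (s n)); split => [//|n|n|n A sA].
- by case: (s n) => X [].
- by case: (s n) => X [].
- by rewrite /=; case: (step (s n)) => y /= ->.
Qed.

Variable s : nat -> Omega -> R.
Hypotheses (s0 : s 0 = (fun=> 0)) (gs : forall n, gmeas F0 (s n))
  (is_ : forall n, intg (s n))
  (sE : forall n A, <<s F0 >> A -> E (fun w => s n.+1 w * \1_A w) =
    E (fun w => (h (T w) + s n (T w)) * \1_A w)).

(** Induction for all sets at once: invariance trades [A] for its image under [T], which belongs to
    the sigma-algebra at time -1, hence to [F0], so that the induction hypothesis applies to it. *)
Lemma cond_birkhoffE n A : <<s F0 >> A ->
  E (fun w => s n w * \1_A w) = E (fun w => S h n w * \1_A w).
Proof.
elim: n A => [|n IHn] A sA.
  by apply: eqE => w; rewrite s0 birkhoff_sum0.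
have mA : measurable A by exact: (sigma_sub_measurable F0m).
have sA' : <<s F0 >> (Tinv @^-1` A).
  have sh B : F0 B -> <<s past_gen T Tinv e (0 - 1) >> (iterz T Tinv (-1) @^-1` B).
    apply: coord_gen_shift => // ik [h1 h2]; split => //=.
    by rewrite lerD2r.
  by apply: (@past_sub _ _ _ _ _ _ (0 - 1) 0) => //; exact: (sigma_preimage sh sA).
have mA' : measurable (Tinv @^-1` A) by exact: (sigma_sub_measurable F0m).
have shift X : intg X -> E (fun w => X (T w) * \1_A w) =
    E (fun w => X w * \1_(Tinv @^-1` A) w).
  move=> iX; have [_ <-] := E_measure_preserving T_pres (intg_indic iX mA').
  by apply: eqE => w /=; rewrite !indicE; congr (_ * (_ : bool)%:R);
    apply/idP/idP => /set_mem; rewrite /preimage/= ?TK => ?; apply/mem_set; rewrite /preimage/= ?TK.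
rewrite sE//.
have ihT' : intg (fun w => h (T w)) by have [] := E_measure_preserving T_pres ih.
have isT : intg (fun w => s n (T w)).
  by have [] := E_measure_preserving T_pres (is_ n).
have iST : intg (fun w => S h n (T w)).
  by have [] := E_measure_preserving T_pres (@intg_birkhoff h n ih).
have -> : (fun w => (h (T w) + s n (T w)) * \1_A w) =
  (fun w => h (T w) * \1_A w + s n (T w) * \1_A w) by apply/funext => w; ring.
have -> : (fun w => S h n.+1 w * \1_A w) =
  (fun w => h (T w) * \1_A w + S h n (T w) * \1_A w).
  by apply/funext => w; rewrite birkhoff_sumSl; ring.
rewrite !ED ?shift ?IHn//; try exact: intg_indic.
exact: intg_birkhoff.
Qed.

Fixpoint running_max n : Omega -> R :=
  if n is n'.+1 then fun w => Num.max (running_max n' w) (s n'.+1 w) else fun=> 0.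

Lemma gmeas_running_max n : gmeas F0 (running_max n).
Proof. by elim: n => [|n IHn]; [exact: gmeas_cst|exact: gmeas_max]. Qed.

Lemma running_max_ge0 n w : 0 <= running_max n w.
Proof. by elim: n => //= n IHn; rewrite le_max IHn. Qed.

Lemma le_running_max i n w : (i <= n)%N -> s i w <= running_max n w.
Proof.
elim: n => [|n IHn]; first by rewrite leqn0 => /eqP ->; rewrite s0.
rewrite leq_eqVlt => /orP[/eqP -> /=|/IHn h']; first by rewrite le_max lexx orbT.
by rewrite /= le_max h'.
Qed.

Lemma intg_running_max n : intg (running_max n).
Proof.
elim: n => [|n IHn]; first exact: intg_cst.
apply: (intg_le _ (intgD (intg_norm IHn) (intg_norm (is_ n.+1)))).
  exact: gmeas_measurable (gmeas_running_max n.+1).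
move=> w /=; case: (lerP (running_max n w) (s n.+1 w)) => _.
  by rewrite lerDr.
by rewrite lerDl.
Qed.

(** Induction on [n] with [N] fixed, splitting [B] by whether [s n.+1] is a new record. Where it is,
    the maximum equals [s n.+1], whose recursion involves only [s n <= running_max N]. Where it is
    not, the maximum is still the positive [running_max n], and the induction hypothesis applies. *)
Let running_max_ineq N n B : (n <= N)%N -> <<s F0 >> B ->
  B `<=` [set w | 0 < running_max n w] ->
  E (fun w => running_max n w * \1_B w) <=
  E (fun w => (h (T w) + running_max N (T w)) * \1_B w).
Proof.
elim: n B => [|n IHn] B nN sB BM.
  have B0 : B = set0 by apply/seteqP; split => // w /BM /=; rewrite ltxx.
  by rewrite le_eqVlt; apply/orP; left; apply/eqP/eqE => w; rewrite B0 indic0 !mulr0.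
pose B1 := B `&` [set w | running_max n w < s n.+1 w].
pose B2 := B `\` [set w | running_max n w < s n.+1 w].
have sC : <<s F0 >> [set w | running_max n w < s n.+1 w].
  by apply: gmeas_ltr => //; exact: gmeas_running_max.
have sB1 : <<s F0 >> B1 by exact: sigmaI.
have sB2 : <<s F0 >> B2 by exact: sigmaD.
have mB1 := sigma_sub_measurable F0m sB1; have mB2 := sigma_sub_measurable F0m sB2.
have BE X : (fun w => X w * \1_B w) = (fun w => X w * \1_B1 w + X w * \1_B2 w) :> (Omega -> R).
  apply/funext => w; rewrite -mulrDr; congr (_ * _).
  rewrite !indicE in_setI in_setD.
  by case: (w \in B); case: (w \in [set w | running_max n w < s n.+1 w]);
    rewrite /= ?addr0 ?add0r.
have iM := intg_running_max n.+1; have ihM := ihT (intg_running_max N).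
rewrite !BE !ED; try exact: intg_indic.
apply: lerD; last first.
  have -> : (fun w => running_max n.+1 w * \1_B2 w) = (fun w => running_max n w * \1_B2 w).
    apply/funext => w; rewrite !indicE; case: (boolP (w \in B2)) => [|_]; last by rewrite !mulr0.
    by move=> /set_mem[_ /negP]; rewrite -leNgt => h' /=; rewrite max_l.
  apply: IHn => //; first exact: ltnW.
  by move=> w [/BM /=]; rewrite lt_max => /orP[//|h1 /negP]; rewrite -leNgt; exact: lt_le_trans.
have -> : (fun w => running_max n.+1 w * \1_B1 w) = (fun w => s n.+1 w * \1_B1 w).
  apply/funext => w; rewrite !indicE; case: (boolP (w \in B1)) => [|_]; last by rewrite !mulr0.
  by move=> /set_mem[_ /=] h'; rewrite max_r// ltW.
rewrite sE//; apply: E_le; [exact: intg_indic (ihT (is_ n)) mB1|exact: intg_indic|].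
move=> w; apply: ler_wpM2r; first by rewrite indicE.
by rewrite lerD2l; apply: le_running_max; exact: ltnW.
Qed.

(* Garsia's argument: on [A] the maximum [M] satisfies [M <= E(h o T + M o T | F0)],
   and [E M = E (M o T)] *)
Lemma maximal_ergodic N : let A := [set w | 0 < running_max N w] in
  <<s F0 >> A /\ 0 <= E (fun w => h (T w) * \1_A w).
Proof.
move=> A; have sA : <<s F0 >> A.
  by apply: gmeas_ltr; [exact: gmeas_cst|exact: gmeas_running_max].
split=> //; have mA := sigma_sub_measurable F0m sA.
have iM := intg_running_max N.
have := running_max_ineq (leqnn N) sA (@subset_refl _ A).
have -> : (fun w => running_max N w * \1_A w) = running_max N.
  apply/funext => w; rewrite indicE; case: (boolP (w \in A)) => [_|]; first by rewrite mulr1.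
  move=> /negP wA; rewrite mulr0; apply/eqP; rewrite eq_le running_max_ge0/= leNgt.
  by apply/negP => ?; apply: wA; exact: mem_set.
have [iMT EMT] := E_measure_preserving T_pres iM.
have [ihT' _] := E_measure_preserving T_pres ih.
have -> : (fun w => (h (T w) + running_max N (T w)) * \1_A w) =
  (fun w => h (T w) * \1_A w + running_max N (T w) * \1_A w) by apply/funext => w; ring.
rewrite ED; [|exact: intg_indic ihT' mA|exact: intg_indic iMT mA].
have : E (fun w => running_max N (T w) * \1_A w) <= E (running_max N).
  rewrite -EMT; apply: E_le => //; first exact: intg_indic iMT mA.
  move=> w /=; rewrite indicE; case: (_ \in _); rewrite ?mulr1 ?mulr0//.
  exact: running_max_ge0.
lra.
Qed.

End hopf.

Lemma sum_indic_le1 (A : nat -> set Omega) (N : nat) w : trivIset setT A ->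
  \sum_(i < N) \1_(A i) w <= 1 :> R.
Proof.
move=> tA; case: (pselect (exists i : 'I_N, A i w)) => [[i Aiw]|noA].
  rewrite (bigD1 i)//= big1 ?addr0 => [|j ji].
    by rewrite indicE; case: (_ \in _).
  rewrite indicE memNset// => Ajw; move: ji; apply/negP; rewrite negbK.
  apply/eqP/val_inj; apply: (tA _ _ I I); by exists w.
rewrite big1// => i _; rewrite indicE memNset// => Aiw; by apply: noA; exists i.
Qed.

(** Let [B] be the event that the conditional mean of [S_n(m^2)] exceeds [lam n] for some [n] up to
    the largest time. The maximal inequality makes [B] rare; off [B], Chebyshev's inequality given
    the past costs a proportion [lam / C^2] of each [A i], and disjointness bounds the total. *)
Lemma random_time_tight (eps : R) : 0 < eps -> exists2 C : R, 0 < C &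
  forall (N : nat) (A : nat -> set Omega) (t : nat -> nat),
    (forall i, <<s F0 >> (A i)) -> trivIset setT A -> (forall i, (0 < t i)%N) ->
    \sum_(i < N) fine (P (A i `&`
      [set w | C * Num.sqrt (t i)%:R < `|S m (t i) w|])) <= eps.
Proof.
move=> eps0; pose g w := m w ^+ 2.
have Eg0 : 0 <= E g by apply: E_ge0 => w; exact: sqr_ge0.
(* Chosen for [E g / lam <= eps / 2]; the added 1 keeps it positive. *)
pose lam := 2 * (E g + 1) / eps.
have lam0 : 0 < lam by rewrite divr_gt0// mulr_gt0// ltr_wpDl.
(* As [C >= 1], this gives [lam / C ^+ 2 <= lam / C <= eps / 2]. *)
pose C := 2 * lam / eps + 1.
have C1 : 1 <= C by rewrite lerDr ltW// divr_gt0// mulr_gt0.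
exists C; first exact: lt_le_trans C1.
move=> N A t sA tA t0.
pose h w := g w - lam.
have ih : intg h by apply: intgB; [exact: im2|exact: intg_cst].
have [s [s0 gs is_ sE]] := cond_birkhoff ih.
pose N' := (\max_(i < N) t i)%N.
have := maximal_ergodic ih s0 gs is_ sE N'.
set B := [set w | _]; move=> [sB hB].
have mB := sigma_sub_measurable F0m sB.
have mA i := sigma_sub_measurable F0m (sA i).
have igT : intg (fun w => g (T w)) by have [] := E_measure_preserving T_pres im2.
have PB : fine (P B) <= eps / 2.
  have : lam * fine (P B) <= E g.
    rewrite -E_indic// -EZ; last exact: intg_ind.
    rewrite -subr_ge0; apply: (le_trans hB).
    have [_ EgT] := E_measure_preserving T_pres im2.
    rewrite -/(g) in EgT; rewrite -EgT -EB//; last by apply: intgZ; exact: intg_ind.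
    apply: E_le.
    - apply: intg_indic => //; by have [] := E_measure_preserving T_pres ih.
    - by apply: intgB => //; apply: intgZ; exact: intg_ind.
    - move=> w; rewrite /h /= mulrBl lerB// indicE; case: (_ \in _); rewrite ?mulr1// mulr0.
      exact: sqr_ge0.
  rewrite mulrC -ler_pdivlMr// => /le_trans; apply; rewrite ler_pdivrMr//.
  rewrite /lam; have -> : eps / 2 * (2 * (E g + 1) / eps) = E g + 1.
    by field; rewrite gt_eqF.
  by rewrite lerDl.
have mSC i : measurable [set w | C * Num.sqrt (t i)%:R < `|S m (t i) w|].
  apply: measurable_set_lt => //.
  exact: measurableT_comp.
have each (i : 'I_N) : fine (P (A i `&`
      [set w | C * Num.sqrt (t i)%:R < `|S m (t i) w|])) <=
   E (fun w => \1_(A i) w * \1_B w) + lam / C ^+ 2 * E (\1_(A i)).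
  set D := [set w | _].
  have mD : measurable D by exact: mSC.
  have sAB : <<s F0 >> (A i `\` B) by exact: sigmaD.
  have mAB := sigma_sub_measurable F0m sAB.
  have iS2 := intg_indic (intg_birkhoff_sqr (t i)) mAB.
  have tR : 0 < (t i)%:R :> R by rewrite ltr0n.
  have c0 : 0 < C ^+ 2 * (t i)%:R by rewrite mulr_gt0// exprn_gt0//; exact: lt_le_trans C1.
  (* On [B] the indicator of [B] pays; off [B] the second moment does. *)
  have pt w : \1_(A i `&` D) w <= \1_(A i) w * \1_B w +
      (C ^+ 2 * (t i)%:R)^-1 * (S m (t i) w ^+ 2 * \1_(A i `\` B) w).
    rewrite !indicE in_setI in_setD.
    case: (boolP (w \in A i)) => wA /=; last by rewrite !mul0r !mulr0 addr0.
    case: (boolP (w \in B)) => wB /=.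
      by rewrite mulr0 mulr0 addr0 mul1r; case: (_ \in _).
    rewrite mulr0 add0r mulr1; case: (boolP (w \in D)) => /= [/set_mem /= Dw|_]; last first.
      by rewrite mulr_ge0 ?sqr_ge0// invr_ge0 ltW.
    rewrite mulrC ler_pdivlMr// mul1r -[S m (t i) w ^+ 2]sqr_normr.
    rewrite -[(t i)%:R](@sqr_sqrtr R)// -exprMn ler_sqr ?nnegrE//; first exact: ltW.
    by rewrite mulr_ge0// ltW//; exact: lt_le_trans C1.
  have iD : intg (\1_(A i `&` D)) by apply: intg_ind; exact: measurableI.
  have iA : intg (\1_(A i)) by exact: intg_ind.
  rewrite -E_indic; last exact: measurableI.
  apply: (le_trans (E_le iD (intgD (intg_indic iA mB) (intgZ _ iS2)) pt)).
  rewrite ED ?lerD2l; [|exact: intg_indic|exact: intgZ].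
  rewrite EZ// birkhoff_sqr//.
  have hS : (fun w => S (fun w => m w ^+ 2) (t i) w * \1_(A i `\` B) w) =
    (fun w => S h (t i) w * \1_(A i `\` B) w + (lam * (t i)%:R) * \1_(A i `\` B) w).
    apply/funext => w; rewrite -mulrDl; congr (_ * _).
    rewrite /S /birkhoff_sum /h /koopman.
    rewrite [in RHS]big_split/= sumrN [X in _ - X + _]sumr_const_nat subn1.
    by rewrite -[lam *+ _]mulr_natr subrK.
  rewrite hS ED; last 2 first.
    by apply: intg_indic => //; exact: intg_birkhoff.
    by apply: intgZ; exact: intg_ind.
  rewrite EZ; last exact: intg_ind.
  (* Off [B] the conditional mean [s (t i)] is nonpositive, because [t i <= N']. *)
  have neg : E (fun w => S h (t i) w * \1_(A i `\` B) w) <= 0.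
    rewrite -(cond_birkhoffE ih s0 is_ sE)// -(E_cst P 0).
    apply: E_le; [exact: intg_indic (is_ _) mAB|exact: intg_cst|].
    move=> w; rewrite indicE; case: (boolP (_ \in _)) => [|_]; last by rewrite mulr0.
    rewrite mulr1 => /set_mem[_ /negP]; rewrite -leNgt; apply: le_trans.
    apply: (le_running_max s0).
    by rewrite /N' (bigD1 i)//= leq_maxl.
  apply: (@le_trans _ _ ((C ^+ 2 * (t i)%:R)^-1 * (lam * (t i)%:R * E (\1_(A i))))).
    apply: ler_wpM2l; first by rewrite invr_ge0 ltW.
    apply: (@le_trans _ _ (0 + lam * (t i)%:R * E (\1_(A i `\` B)))).
      by rewrite lerD2r.
    rewrite add0r; apply: ler_wpM2l; first by rewrite mulr_ge0 ?ltW.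
    by rewrite !E_indic//; apply: le_fineP => // w [].
  rewrite le_eqVlt; apply/orP; left; apply/eqP.
  by field; rewrite !gt_eqF//=; exact: lt_le_trans C1.
apply: (le_trans (ler_sum _ (fun i _ => each i))).
rewrite big_split/= -mulr_sumr.
have iA i : intg (\1_(A i)) by exact: intg_ind.
rewrite -(E_sum (index_enum _) (F := fun i : 'I_N => \1_(A i))) //.
rewrite -(E_sum (index_enum _) (F := fun (i : 'I_N) w => \1_(A i) w * \1_B w)); last first.
  by move=> i; exact: intg_indic.
rewrite (splitr eps); apply: lerD.
  apply: le_trans PB; rewrite -E_indic//; apply: E_le.
  - by apply: intg_sum => i; exact: intg_indic.
  - exact: intg_ind.
  - move=> w; rewrite -mulr_suml -[leRHS]mul1r ler_wpM2r ?indicE//.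
    exact: sum_indic_le1.
have -> : eps / 2 = eps / 2 * 1 by rewrite mulr1.
apply: ler_pM.
- by rewrite divr_ge0 ?ltW// exprn_gt0//; exact: lt_le_trans C1.
- by apply: E_ge0 => w; apply: sumr_ge0 => i _; rewrite indicE.
- rewrite ler_pdivrMr ?exprn_gt0//; last exact: lt_le_trans C1.
  apply: (@le_trans _ _ (eps / 2 * C)).
    rewrite /C mulrDr mulr1.
    have -> : eps / 2 * (2 * lam / eps) = lam by field; rewrite gt_eqF.
    by rewrite lerDl divr_ge0// ltW.
  apply: ler_wpM2l; first by rewrite divr_ge0 ?ltW.
  by rewrite expr2 ler_peMl//; exact: le_trans C1.
- rewrite -[leRHS](E_cst P 1); apply: E_le; [|exact: intg_cst|].
    by apply: intg_sum => i.
  by move=> w; exact: sum_indic_le1.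
Qed.

End martingale.

(** * The heat kernel *)

Section taylor.
Context (R : realType).
Implicit Types f : R -> R.

Lemma mvt_le f (df : R -> R) (a b K : R) : a <= b ->
  (forall x, a <= x <= b -> is_derive x 1 f (df x)) ->
  (forall x, a <= x <= b -> `|df x| <= K) -> `|f b - f a| <= K * (b - a).
Proof.
move=> ab fdf dfK.
have [||c cab ->] := @MVT_segment R f df a b ab.
- by move=> x /[!in_itv]/= /andP[ax xb]; apply: fdf; rewrite !ltW.
- apply: derivable_within_continuous => x; rewrite in_itv/= => xab.
  by have [] := fdf x xab.
rewrite normrM (ger0_norm (x := b - a)) ?subr_ge0//.
by apply: ler_wpM2r; [rewrite subr_ge0|apply: dfK; move: cab; rewrite in_itv].
Qed.

(** The mean value inequality is applied to the function minus its Taylor polynomial, whose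
    derivative is a remainder of lower order; the factorials of the sharp bound are given up. *)
Lemma taylor1_le f (f1 f2 : R -> R) (a b K : R) : a <= b ->
  (forall x, a <= x <= b -> is_derive x 1 f (f1 x)) ->
  (forall x, a <= x <= b -> is_derive x 1 f1 (f2 x)) ->
  (forall x, a <= x <= b -> `|f2 x| <= K) ->
  `|f b - f a - f1 a * (b - a)| <= K * (b - a) ^+ 2.
Proof.
move=> ab d1 d2 f2K; pose g t := f t - f1 a * t.
have -> : f b - f a - f1 a * (b - a) = g b - g a by rewrite /g; ring.
rewrite expr2 mulrA; apply: (@mvt_le g (fun t => f1 t - f1 a)) => // x xab.
  have := d1 x xab => d1x.
  apply: (@is_derive_eq _ _ _ (f - (f1 a \*: id))).
  by rewrite /GRing.scale /= mulr1.
have /andP[ax xb] := xab.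
apply: (@le_trans _ _ (K * (x - a))).
  apply: (mvt_le ax) => y /andP[ay yx]; [apply: d2|apply: f2K];
    by rewrite ay (le_trans yx).
apply: ler_wpM2l; last by rewrite lerD2r.
by apply: le_trans (f2K a _); rewrite ?lexx.
Qed.

Lemma taylor2_le f (f1 f2 f3 : R -> R) (a b K : R) : a <= b ->
  (forall x, a <= x <= b -> is_derive x 1 f (f1 x)) ->
  (forall x, a <= x <= b -> is_derive x 1 f1 (f2 x)) ->
  (forall x, a <= x <= b -> is_derive x 1 f2 (f3 x)) ->
  (forall x, a <= x <= b -> `|f3 x| <= K) ->
  `|f b - f a - f1 a * (b - a) - f2 a / 2 * (b - a) ^+ 2| <= K * (b - a) ^+ 3.
Proof.
move=> ab d1 d2 d3 f3K; pose g t := f t - f1 a * t - f2 a / 2 * (t - a) ^+ 2.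
have -> : f b - f a - f1 a * (b - a) - f2 a / 2 * (b - a) ^+ 2 = g b - g a.
  by rewrite /g subrr; ring.
rewrite exprSr mulrA.
apply: (@mvt_le g (fun t => f1 t - f1 a - f2 a * (t - a))) => // x xab.
  have := d1 x xab => d1x.
  apply: (@is_derive_eq _ _ _ (f - (f1 a \*: id) - (f2 a / 2 \*: (id - cst a) ^+ 2))).
  rewrite /GRing.scale /= /GRing.scale /=.
  by rewrite -[(id - cst a) x]/(x - a); field.
have /andP[ax xb] := xab.
apply: (@le_trans _ _ (K * (x - a) ^+ 2)).
  apply: (@taylor1_le _ _ f3) => // y /andP[ay yx]; [apply: d2|apply: d3|apply: f3K];
    by rewrite ay (le_trans yx).
apply: ler_wpM2l; first by apply: le_trans (f3K a _); rewrite ?lexx.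
by rewrite ler_sqr ?nnegrE ?subr_ge0// ?lerD2r// (le_trans ax).
Qed.

End taylor.

Section gauss_kernel.
Context (R : realType).
Implicit Types v x : R.

(* [v^(-1/2) exp(-x^2 / (2 v))], an unnormalized heat kernel *)
Definition gker v x : R := expR (- (ln v / 2) - x ^+ 2 / (2 * v)).
Definition gker_x v x : R := - (x / v) * gker v x.
Definition gker_xx v x : R := (x ^+ 2 / v ^+ 2 - v^-1) * gker v x.
Definition gker_xxx v x : R := (3 * x / v ^+ 2 - x ^+ 3 / v ^+ 3) * gker v x.

Lemma gker_gt0 v x : 0 < gker v x. Proof. exact: expR_gt0. Qed.

Lemma is_derive_gker v x : 0 < v -> is_derive x 1 (gker v) (gker_x v x).
Proof.
move=> v0; pose g : R -> R := cst (- (ln v / 2)) - ((2 * v)^-1 \*: id ^+ 2).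
have -> : gker v = expR \o g.
  apply/funext => y; rewrite /gker /=; congr expR.
  by rewrite -[RHS]/(- (ln v / 2) - (2 * v)^-1 * y ^+ 2) [(2 * v)^-1 * _]mulrC.
apply: is_derive_eq.
rewrite /gker_x /gker /g /GRing.scale /= /GRing.scale /=.
rewrite -[(_ - _) x]/(- (ln v / 2) - (2 * v)^-1 * x ^+ 2).
rewrite -[X in expR (_ - X)]mulrC; field.
by rewrite gt_eqF.
Qed.
Lemma is_derive_gker_x v x : 0 < v -> is_derive x 1 (gker_x v) (gker_xx v x).
Proof.
move=> v0; have d1 := is_derive_gker x v0.
have -> : gker_x v = (- v^-1 \*: id) * gker v.
  by apply/funext => y; rewrite -[RHS]/(- v^-1 * y * gker v y) /gker_x; ring.
apply: is_derive_eq; rewrite /GRing.scale /= /GRing.scale /= /gker_xx /gker_x; field.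
by rewrite gt_eqF.
Qed.

Lemma is_derive_gker_xx v x : 0 < v -> is_derive x 1 (gker_xx v) (gker_xxx v x).
Proof.
move=> v0; have d1 := is_derive_gker x v0.
have -> : gker_xx v = (v ^- 2 \*: id ^+ 2 - cst v^-1) * gker v.
  apply/funext => y; rewrite -[RHS]/((v ^- 2 * y ^+ 2 - v^-1) * gker v y) /gker_xx.
  by rewrite [y ^+ 2 / _]mulrC.
apply: is_derive_eq; rewrite /GRing.scale /= /gker_xxx /gker_x.
rewrite -[(_ - _) x]/(v ^- 2 * x ^+ 2 - v^-1) /GRing.scale /=; field.
by rewrite gt_eqF.
Qed.

(** The heat equation [u_v = u_xx / 2]: a step in the variance produces the same second-order term
    as the square of an increment in space. *)
Lemma is_derive_gker_v v x : 0 < v ->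
  is_derive v 1 (fun t => gker t x) (gker_xx v x / 2).
Proof.
move=> v0; have dl := is_derive1_ln v0.
have dV : is_derive v 1 (fun t : R => t^-1) (- v ^- 2 *: 1).
  by apply: (is_deriveV (f := id)); rewrite ?gt_eqF.
pose g : R -> R := - 2^-1 \*: @ln R - (x ^+ 2 / 2 \*: (fun t : R => t^-1)).
have -> : (fun t => gker t x) = expR \o g.
  apply/funext => t; rewrite /gker /=; congr expR.
  by rewrite -[RHS]/(- 2^-1 * ln t - x ^+ 2 / 2 * t^-1) invfM; ring.
apply: is_derive_eq.
rewrite -[g v]/(- 2^-1 * ln v - x ^+ 2 / 2 * v^-1) /GRing.scale /= /gker_xx /gker.
have -> : - 2^-1 * ln v - x ^+ 2 / 2 * v^-1 = - (ln v / 2) - x ^+ 2 / (2 * v).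
  by rewrite invfM; ring.
by field; rewrite gt_eqF.
Qed.

(** By the heat equation used twice, this is a quarter of the fourth derivative in [x]. *)
Definition gker_vv v x : R :=
  ((v ^- 2 - 2 * x ^+ 2 / v ^+ 3) / 2 + (x ^+ 2 / v ^+ 2 - v^-1) ^+ 2 / 4) * gker v x.

Lemma is_derive_gker_xx_v v x : 0 < v ->
  is_derive v 1 (fun t => gker_xx t x / 2) (gker_vv v x).
Proof.
move=> v0; have d1 := is_derive_gker_v x v0.
have dV : is_derive v 1 (fun t : R => t^-1) (- v ^- 2 *: 1).
  by apply: (is_deriveV (f := id)); rewrite ?gt_eqF.
pose i : R -> R := fun t => t^-1.
have -> : (fun t => gker_xx t x / 2) =
  (2^-1 \*: (x ^+ 2 \*: i ^+ 2 - i)) * (fun t => gker t x).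
  apply/funext => t; rewrite -[RHS]/(2^-1 * (x ^+ 2 * t^-1 ^+ 2 - t^-1) * gker t x).
  by rewrite /gker_xx exprVn; ring.
apply: is_derive_eq.
rewrite -[(2^-1 \*: _) v]/(2^-1 * (x ^+ 2 * v^-1 ^+ 2 - v^-1)) /i.
rewrite /GRing.scale /= /gker_vv /gker_xx.
by field; rewrite gt_eqF.
Qed.

(** All three come from [1 + q <= expR q], the last one by squaring it at [q / 2]. *)
Lemma expRN_bounds (q : R) : 0 <= q ->
  [/\ expR (- q) <= 1, q * expR (- q) <= 1 & q ^+ 2 * expR (- q) <= 4].
Proof.
move=> q0; have Eq : 0 < expR q := expR_gt0 q.
have h1 : 1 + q <= expR q by exact: expR_ge1Dx.
have h2 : (1 + q / 2) ^+ 2 <= expR q.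
  have -> : expR q = expR (q / 2) ^+ 2 by rewrite -expRM_natl; congr expR; field.
  rewrite ler_sqr ?nnegrE ?expR_ge0//; first exact: expR_ge1Dx.
  by rewrite addr_ge0// divr_ge0.
rewrite expRN; split.
- by rewrite invf_le1//; lra.
- by rewrite ler_pdivrMr// mul1r; lra.
- by rewrite ler_pdivrMr//; nra.
Qed.

Section bounds.
Variables (kappa v x : R).
Hypotheses (k1 : 1 <= kappa) (v0 : 0 < v) (vk : v^-1 <= kappa).

(** In these variables each derivative is a product of powers of [p], possibly a factor [x p], a
    polynomial in [q], and [r expR (- q)] with [r = v^(-1/2)]. Both [p] and [r] are at most [kappa],
    [|x| p] is at most [kappa (1 + 2 q)], and [expRN_bounds] absorbs the polynomial. *)
Let q := x ^+ 2 / (2 * v).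
Let r := expR (- (ln v / 2)).
Let p := v^-1.

Let q0 : 0 <= q. Proof. by rewrite divr_ge0 ?sqr_ge0// mulr_ge0// ltW. Qed.

Let r0 : 0 <= r. Proof. exact: expR_ge0. Qed.

Let rk : r <= kappa.
Proof.
rewrite -ler_sqr ?nnegrE// ?(le_trans _ k1)//.
have -> : r ^+ 2 = v^-1.
  by rewrite /r -expRM_natl -[in RHS](lnK v0) -expRN; congr expR; field.
by apply: (le_trans vk); rewrite expr2 ler_peMl// (le_trans _ k1).
Qed.

Let p0 : 0 <= p. Proof. by rewrite invr_ge0 ltW. Qed.

Let gE : gker v x = r * expR (- q).
Proof. by rewrite /gker expRD. Qed.

Let xp : `|x| * p <= kappa * (1 + 2 * q).
Proof.
have e : 2 * q = x ^+ 2 * p by rewrite /q /p; field; rewrite gt_eqF.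
have : `|x| * p <= (1 + x ^+ 2) * p.
  apply: ler_wpM2r => //; rewrite -(real_normK (num_real x)).
  have := sqr_ge0 (`|x| - 1); have := normr_ge0 x; nra.
move=> /le_trans; apply; rewrite mulrDl mul1r -e.
have : 0 <= (kappa - 1) * q by rewrite mulr_ge0// subr_ge0.
by move: vk q0; rewrite -/p; nra.
Qed.

Let E := expR (- q).
Let E0 : 0 <= E. Proof. exact: expR_ge0. Qed.

Let xpE : x ^+ 2 * p = 2 * q.
Proof. by rewrite /q /p; field; rewrite gt_eqF. Qed.

Lemma gker_le : `|gker v x| <= kappa.
Proof.
have [E1 _ _] := expRN_bounds q0.
by rewrite gE ger0_norm ?mulr_ge0// -[leRHS]mulr1 ler_pM.
Qed.

Let k0 : 0 <= kappa. Proof. exact: le_trans k1. Qed.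

Lemma gker_x_le : `|gker_x v x| <= 3 * kappa ^+ 2.
Proof.
have [E1 E2 _] := expRN_bounds q0.
rewrite /gker_x gE -/E mulNr normrN normrM normrM (ger0_norm p0) (ger0_norm (x := r * E)) ?mulr_ge0//.
have : `|x| * p * (r * E) <= kappa * (1 + 2 * q) * (kappa * E).
  by apply: ler_pM; rewrite ?mulr_ge0// ler_wpM2r.
move=> /le_trans; apply.
have -> : kappa * (1 + 2 * q) * (kappa * E) = (E + 2 * (q * E)) * kappa ^+ 2 by ring.
by apply: ler_wpM2r; rewrite ?sqr_ge0//; move: E1 E2; rewrite -/E; lra.
Qed.

Lemma gker_xx_le : `|gker_xx v x| <= 3 * kappa ^+ 2.
Proof.
have [E1 E2 _] := expRN_bounds q0.
have -> : gker_xx v x = p * (2 * q - 1) * (r * E).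
  by rewrite /gker_xx gE -/E -xpE /p; field; rewrite gt_eqF.
rewrite normrM normrM (ger0_norm p0) (ger0_norm (x := r * E)) ?mulr_ge0//.
have : p * `|2 * q - 1| * (r * E) <= kappa * (1 + 2 * q) * (kappa * E).
  apply: ler_pM; rewrite ?mulr_ge0// ?ler_wpM2r//; apply: ler_pM => //.
  by rewrite ler_norml; move: q0; lra.
move=> /le_trans; apply.
have -> : kappa * (1 + 2 * q) * (kappa * E) = (E + 2 * (q * E)) * kappa ^+ 2 by ring.
by apply: ler_wpM2r; rewrite ?sqr_ge0//; move: E1 E2; rewrite -/E; lra.
Qed.

Lemma gker_xxx_le : `|gker_xxx v x| <= 27 * kappa ^+ 3.
Proof.
have [E1 E2 E3] := expRN_bounds q0.
have -> : gker_xxx v x = x * p * (p * (3 - 2 * q)) * (r * E).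
  by rewrite /gker_xxx gE -/E -xpE /p; field; rewrite gt_eqF.
rewrite normrM normrM normrM (ger0_norm p0) normrM (ger0_norm p0) (ger0_norm (x := r * E)) ?mulr_ge0//.
have : `|x| * p * (p * `|3 - 2 * q|) * (r * E) <=
   kappa * (1 + 2 * q) * (kappa * (3 + 2 * q)) * (kappa * E).
  have a1 : p * `|3 - 2 * q| <= kappa * (3 + 2 * q).
    by apply: ler_pM => //; rewrite ler_norml; move: q0; lra.
  have a2 : r * E <= kappa * E by exact: ler_wpM2r.
  apply: ler_pM a2; rewrite ?mulr_ge0//.
  by apply: ler_pM a1; rewrite ?mulr_ge0.
move=> /le_trans; apply.
have -> : kappa * (1 + 2 * q) * (kappa * (3 + 2 * q)) * (kappa * E) =
  (3 * E + 8 * (q * E) + 4 * (q ^+ 2 * E)) * kappa ^+ 3 by ring.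
by apply: ler_wpM2r; rewrite ?exprn_ge0//; move: E1 E2 E3; rewrite -/E; lra.
Qed.

Lemma gker_vv_le : `|gker_vv v x| <= 8 * kappa ^+ 3.
Proof.
have [E1 E2 E3] := expRN_bounds q0.
have -> : gker_vv v x = p ^+ 2 * ((1 - 4 * q) / 2 + (2 * q - 1) ^+ 2 / 4) * (r * E).
  rewrite /gker_vv gE -/E; have -> : 4 * q = 2 * (x ^+ 2 * p) by rewrite xpE; ring.
  by rewrite -xpE /p; field; rewrite gt_eqF.
rewrite normrM normrM (ger0_norm (x := p ^+ 2)) ?sqr_ge0// (ger0_norm (x := r * E)) ?mulr_ge0//.
have : p ^+ 2 * `|(1 - 4 * q) / 2 + (2 * q - 1) ^+ 2 / 4| * (r * E) <=
   kappa ^+ 2 * (3 / 4 + 3 * q + q ^+ 2) * (kappa * E).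
  apply: ler_pM; rewrite ?mulr_ge0// ?ler_wpM2r// ?sqr_ge0//.
  apply: ler_pM; rewrite ?sqr_ge0//; first by rewrite ler_sqr ?nnegrE.
  by rewrite ler_norml; apply/andP; split; have := sqr_ge0 q; move: q0; nra.
move=> /le_trans; apply.
have -> : kappa ^+ 2 * (3 / 4 + 3 * q + q ^+ 2) * (kappa * E) =
  (3 / 4 * E + 3 * (q * E) + q ^+ 2 * E) * kappa ^+ 3 by ring.
by apply: ler_wpM2r; rewrite ?exprn_ge0//; move: E1 E2 E3; rewrite -/E; lra.
Qed.

End bounds.

Lemma gkerN v x : gker v (- x) = gker v x.
Proof. by rewrite /gker sqrrN. Qed.

Lemma gker_xN v x : gker_x v (- x) = - gker_x v x.
Proof. by rewrite /gker_x gkerN; ring. Qed.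

Lemma gker_xxN v x : gker_xx v (- x) = gker_xx v x.
Proof. by rewrite /gker_xx gkerN sqrrN. Qed.

(** One constant serves all [v >= s], as needed for an interpolation in which the variance decreases
    to [s]. The remainder in space is bounded by the square of [t] as well as by its cube, because
    only the second moment of [m] is assumed finite. *)
Lemma gker_smooth (s : R) : 0 < s -> exists2 C : R, 0 < C & forall v, s <= v ->
  [/\ forall x, `|gker v x| <= C /\ `|gker_x v x| <= C /\ `|gker_xx v x| <= C,
      forall x y, `|gker_xx v x - gker_xx v y| <= C * `|x - y|,
      forall x t, `|gker v (x + t) - gker v x - gker_x v x * t - gker_xx v x / 2 * t ^+ 2|
        <= C * Num.min (t ^+ 2) (`|t| ^+ 3) &
      forall x h, 0 <= h -> `|gker (v + h) x - gker v x - gker_xx v x / 2 * h| <= C * h ^+ 2].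
Proof.
move=> s0; pose k : R := 1 + s^-1.
have k1 : 1 <= k by rewrite lerDl invr_ge0 ltW.
have k0 : 0 < k by exact: lt_le_trans k1.
have k2 : k ^+ 2 <= k ^+ 3 by exact: ler_weXn2l.
have k13 : k <= k ^+ 3 by rewrite -{1}[k]expr1; exact: ler_weXn2l.
have k30 : 0 < k ^+ 3 by rewrite exprn_gt0.
(* 30 exceeds the 27 of the third derivative, the 8 of the second derivative in [v], and the 3 + 3/2
   from bounding the quadratic term separately. *)
exists (30 * k ^+ 3); first by rewrite mulr_gt0.
move=> v sv; have vpos t : s <= t -> 0 < t by exact: lt_le_trans.
have v0 := vpos _ sv.
have vk t : s <= t -> t^-1 <= k.
  move=> st; apply: (@le_trans _ _ s^-1); last by rewrite lerDr.
  by rewrite lef_pV2 ?posrE// vpos.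
have lip x y : x <= y -> `|gker_xx v y - gker_xx v x| <= 30 * k ^+ 3 * (y - x).
  move=> xy; apply: (@mvt_le _ (gker_xx v) (gker_xxx v) _ _ _ xy) => z _; first exact: is_derive_gker_xx.
  by apply: (le_trans (gker_xxx_le _ k1 v0 (vk _ sv))); lra.
have tay x t : 0 <= t ->
   `|gker v (x + t) - gker v x - gker_x v x * t - gker_xx v x / 2 * t ^+ 2|
     <= 30 * k ^+ 3 * Num.min (t ^+ 2) (t ^+ 3).
  move=> t0; have xt : x <= x + t by rewrite lerDl.
  have tE : x + t - x = t by rewrite addrC addKr.
  set D := `|_|; suff [D2 D3] : D <= 30 * k ^+ 3 * t ^+ 2 /\ D <= 30 * k ^+ 3 * t ^+ 3.
    by case: (lerP (t ^+ 2) (t ^+ 3)).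
  rewrite {}/D; split.
    have := @taylor1_le _ (gker v) (gker_x v) (gker_xx v) x (x + t) (3 * k ^+ 2) xt.
    rewrite tE => h.
    have {}h : `|gker v (x + t) - gker v x - gker_x v x * t| <= 3 * k ^+ 2 * t ^+ 2.
      apply: h => z _; [exact: is_derive_gker|exact: is_derive_gker_x|].
      exact: gker_xx_le (vk _ sv).
    apply: (le_trans (ler_normB _ _)).
    have := gker_xx_le x k1 v0 (vk _ sv).
    rewrite [X in _ + X]normrM [`|_ / 2|]normrM (ger0_norm (x := t ^+ 2)) ?sqr_ge0//.
    rewrite (ger0_norm (x := 2^-1))// => h2.
    have : `|gker_xx v x| / 2 * t ^+ 2 <= 3 * k ^+ 2 / 2 * t ^+ 2.
      by apply: ler_wpM2r; rewrite ?sqr_ge0//; apply: ler_wpM2r.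
    have : k ^+ 2 * t ^+ 2 <= k ^+ 3 * t ^+ 2 by rewrite ler_wpM2r ?sqr_ge0.
    have : 0 <= k ^+ 3 * t ^+ 2 by rewrite mulr_ge0 ?sqr_ge0// ltW.
    by move: h; lra.
  have := @taylor2_le _ (gker v) (gker_x v) (gker_xx v) (gker_xxx v) x (x + t) (27 * k ^+ 3) xt.
  rewrite tE => h.
  apply: (@le_trans _ _ (27 * k ^+ 3 * t ^+ 3)).
    apply: h => z _; [exact: is_derive_gker|exact: is_derive_gker_x|
      exact: is_derive_gker_xx|exact: gker_xxx_le (vk _ sv)].
  by apply: ler_wpM2r; rewrite ?exprn_ge0//; lra.
split.
- move=> x; split; [|split].
  + by apply: (le_trans (gker_le x k1 v0 (vk _ sv))); lra.
  + by apply: (le_trans (gker_x_le x k1 v0 (vk _ sv))); lra.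
  + by apply: (le_trans (gker_xx_le x k1 v0 (vk _ sv))); lra.
- move=> x y; case: (lerP x y) => xy.
    by rewrite (distrC (gker_xx v x)); exact: lip.
  by apply: lip; exact: ltW.
(* Negative increments reduce to positive ones because the kernel is even. *)
- move=> x t; have [t0|t0] := leP 0 t; first by rewrite (ger0_norm t0); exact: tay.
  have := tay (- x) (- t); rewrite -opprD !gkerN gker_xN gker_xxN mulrNN sqrrN.
  by rewrite (ltr0_norm t0) => h; apply: h; lra.
- move=> x h h0; have vh : v <= v + h by rewrite lerDl.
  have := @taylor1_le _ (fun t => gker t x) (fun t => gker_xx t x / 2)
    (fun t => gker_vv t x) v (v + h) (8 * k ^+ 3) vh.
  rewrite (addrC v) addrK => hh.
  apply: (@le_trans _ _ (8 * k ^+ 3 * h ^+ 2)).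
    apply: hh => t /andP[vt _]; have st := le_trans sv vt.
    + exact: is_derive_gker_v (vpos _ st).
    + exact: is_derive_gker_xx_v (vpos _ st).
    + exact: gker_vv_le k1 (vpos _ st) (vk _ st).
  by apply: ler_wpM2r; rewrite ?sqr_ge0//; lra.
Qed.

End gauss_kernel.

Lemma measurable_gker (R : realType) (v : R) : measurable_fun setT (gker v).
Proof.
apply: measurableT_comp => //; apply: measurable_funB => //.
by apply: measurable_funM => //; exact: exprn_measurable.
Qed.

Lemma measurable_gker_x (R : realType) (v : R) : measurable_fun setT (gker_x v).
Proof.
apply: measurable_funM; last exact: measurable_gker.
by apply: measurableT_comp => //; exact: measurable_funM.
Qed.

Lemma measurable_gker_xx (R : realType) (v : R) : measurable_fun setT (gker_xx v).
Proof.
apply: measurable_funM; last exact: measurable_gker.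
apply: measurable_funB => //.
by apply: measurable_funM => //; exact: exprn_measurable.
Qed.

Lemma cvg_div_sqrt (R : realType) (c : R) :
  c / Num.sqrt n%:R @[n --> \oo] --> (0 : R).
Proof.
apply/cvgr0Pnorm_le => eps eps0; near=> n.
have n0 : 0 < n%:R :> R by rewrite ltr0n; near: n; exact: nbhs_infty_gt.
have r0 : 0 < Num.sqrt n%:R :> R by rewrite sqrtr_gt0.
rewrite normrM normfV (gtr0_norm r0) ler_pdivrMr// mulrC -ler_pdivrMr//.
rewrite -ler_sqr ?nnegrE ?(ltW r0)//; last by rewrite divr_ge0// ltW.
rewrite sqr_sqrtr ?(ltW n0)//.
near: n; exact: nbhs_infty_ger.
Unshelve. all: by end_near.
Qed.

Lemma cvg_div_nat (R : realType) (c : R) : c / n%:R @[n --> \oo] --> (0 : R).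
Proof.
apply/cvgr0Pnorm_le => eps eps0; near=> n.
have n0 : 0 < n%:R :> R by rewrite ltr0n; near: n; exact: nbhs_infty_gt.
rewrite normrM normfV (gtr0_norm n0) ler_pdivrMr// mulrC -ler_pdivrMr//.
near: n; exact: nbhs_infty_ger.
Unshelve. all: by end_near.
Qed.

(** * Martingale central limit theorem *)

Section lindeberg.
Context d (Omega : measurableType d) (R : realType) (P : probability Omega R).
Local Notation intg f := (P.-integrable setT (EFin \o f)).
Local Notation E f := (Rintegral P setT f).
Implicit Types Y Z : Omega -> R.
Variables (T Tinv : Omega -> Omega).
Hypotheses (TK : cancel T Tinv) (TinvK : cancel Tinv T).
Hypothesis mTinv : measurable_fun setT Tinv.
Hypothesis T_pres : measure_preserving P T.
Variable e : nat -> Omega -> R.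
Hypothesis me : forall k : nat, (1 <= k)%N -> measurable_fun setT (e k).
Hypothesis e_indep : mutually_independent P coord_dom (coordinate T Tinv e).
Let F0 := past_gen T Tinv e 0.
Variable m : Omega -> R.
Hypothesis mF0 : gmeas F0 m.
Hypothesis im2 : intg (fun w => m w ^+ 2).
Hypothesis m_mart : forall A, <<s F0 >> A -> E (fun w => m (T w) * \1_A w) = 0.

Let F0m : F0 `<=` measurable.
Proof. exact: (past_measurable TK mTinv T_pres me). Qed.

Let mm : measurable_fun setT m.
Proof. exact: gmeas_measurable mF0. Qed.

Let im : intg m. Proof. exact: (sqr_intg TK mTinv T_pres me mF0 im2). Qed.

(** The Birkhoff sum moved back by [T^(-n)]. It has the same law and is measurable for [F0] whatever
    [n] is, so every step of the replacement conditions on one and the same sigma-algebra. *)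
Definition past_sum (n : nat) (w : Omega) : R := \sum_(0 <= r < n) m (iter r Tinv w).

Lemma past_sum_shift n w : past_sum n.+1 (T w) = m (T w) + past_sum n w.
Proof.
rewrite /past_sum big_nat_recl//=; congr (_ + _); apply: eq_bigr => r _.
by rewrite -iterS iterSr TK.
Qed.

Lemma birkhoff_past_sum n w : birkhoff_sum T Tinv m n w = past_sum n (iter n T w).
Proof.
elim: n => [|n IHn]; first by rewrite birkhoff_sum0 /past_sum big_geq.
by rewrite birkhoff_sumS iterS past_sum_shift -IHn addrC.
Qed.

Lemma gmeas_past_sum n : gmeas F0 (past_sum n).
Proof.
apply: gmeas_sum => r; apply: (@gmeas_past_le _ _ _ _ _ _ (- r%:Z)).
  by rewrite oppr_le0.
exact: gmeas_past_iter_inv.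
Qed.

(** Separates the [L] most recent terms from a function of [T^(-L)]; truncated subtraction covers
    [i <= L], where the second part is empty. *)
Lemma past_sum_split L i w :
  past_sum i w = past_sum (minn i L) w + past_sum (i - L) (iter L Tinv w).
Proof.
case: (leqP i L) => iL.
  have /eqP -> : (i - L == 0)%N by rewrite subn_eq0.
  by rewrite [in X in _ + X]/past_sum big_geq ?addr0.
rewrite /past_sum (big_cat_nat (n := L))// ?(ltnW iL)//=; congr (_ + _).
rewrite -{1}[L]add0n big_addn; apply: eq_bigr => r _.
by rewrite iterD.
Qed.

Let s2 : R := E (fun w => m w ^+ 2).
Let rt (n : nat) : R := Num.sqrt n%:R.

(** [alpha] is [n] times the Taylor remainder for the increment [m / sqrt n]. [beta] is the price of
    deleting the [L] most recent increments, of total size at most [B], before the square of the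
    next one is averaged. For fixed [L] both tend to 0 in mean by dominated convergence. *)
Let alpha n w : R := Num.min (m w ^+ 2) (`|m w| ^+ 3 / rt n).
Let B L w : R := \sum_(0 <= r < L) `|m (iter r Tinv w)|.
Let beta L n w : R := Num.min 1 (B L w / rt n) * `|m (T w) ^+ 2 - s2|.

Let im2T : intg (fun w => m (T w) ^+ 2).
Proof. by have [] := E_measure_preserving T_pres im2. Qed.

Let mmT : measurable_fun setT (fun w => m (T w)).
Proof. by apply: measurableT_comp => //; have [] := T_pres. Qed.

Let mB L : measurable_fun setT (B L).
Proof.
apply: measurable_sum => r; apply: measurableT_comp => //.
by apply: measurableT_comp => //; have [] := mp_iter_inv TK mTinv T_pres r.
Qed.

Let B0 L w : 0 <= B L w. Proof. exact: sumr_ge0. Qed.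

Let cvg_rt (c : R) : c / rt n @[n --> \oo] --> (0 : R).
Proof. exact: cvg_div_sqrt. Qed.

Let malpha n : measurable_fun setT (alpha n).
Proof.
apply: measurable_minr; first exact: measurable_funX.
by apply: measurable_funM => //; apply: measurable_funX; exact: measurableT_comp.
Qed.

Let alpha0 n w : 0 <= alpha n w.
Proof. by rewrite le_min sqr_ge0/= divr_ge0// ?exprn_ge0// sqrtr_ge0. Qed.

Let alpha_cvg : E (alpha n) @[n --> \oo] --> (0 : R).
Proof.
rewrite -[X in _ --> X](E_cst P 0).
apply: (@E_cvg _ _ _ _ _ _ (fun w => m w ^+ 2)) => //.
- by move=> n w; rewrite ger0_norm// ge_min lexx.
- move=> w; apply: (@squeeze_cvgr _ _ _ _ (fun=> 0) (fun n => `|m w| ^+ 3 / rt n)).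
  + by apply: nearW => n; rewrite alpha0/= ge_min lexx orbT.
  + exact: cvg_cst.
  + exact: cvg_rt.
Qed.

Let im2s : intg (fun w => m (T w) ^+ 2 - s2).
Proof. by apply: intgB => //; exact: intg_cst. Qed.

Let min01 L n w : 0 <= Num.min 1 (B L w / rt n) <= 1.
Proof. by rewrite le_min ler01/= divr_ge0 ?sqrtr_ge0//= ge_min lexx. Qed.

Let mbeta L n : measurable_fun setT (beta L n).
Proof.
apply: measurable_funM.
  by apply: measurable_minr => //; exact: measurable_funM.
by apply: (@intg_measurable _ _ _ P); exact: intg_norm.
Qed.

Let beta_cvg L : E (beta L n) @[n --> \oo] --> (0 : R).
Proof.
rewrite -[X in _ --> X](E_cst P 0).
apply: (@E_cvg _ _ _ _ _ _ (fun w => `|m (T w) ^+ 2 - s2|)) => //.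
- exact: intg_norm.
- move=> n w; rewrite /beta normrM normr_id.
  have /andP[h0 h1] := min01 L n w.
  by rewrite ger0_norm// ler_piMl.
- move=> w; pose c : R := `|m (T w) ^+ 2 - s2|.
  apply: (@squeeze_cvgr _ _ _ _ (fun=> 0) (fun n => B L w * c / rt n)).
  + apply: nearW => n; have /andP[h0 h1] := min01 L n w.
    rewrite /beta -/c mulr_ge0 ?normr_ge0//= mulrAC ler_wpM2r ?normr_ge0//.
    by rewrite ge_min lexx orbT.
  + exact: cvg_cst.
  + exact: cvg_rt.
Qed.

Variables (s a : R).
Hypothesis s0 : 0 < s.

Let X n i w : R := past_sum i w / rt n - a.

Let gX n i : gmeas F0 (X n i).
Proof.
apply: gmeasB; last exact: gmeas_cst.
by apply: gmeasM; [exact: gmeas_past_sum|exact: gmeas_cst].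
Qed.

Let mX n i : measurable_fun setT (X n i).
Proof. exact: gmeas_measurable (gX n i). Qed.

Let s20 : 0 <= s2. Proof. by apply: E_ge0 => w; exact: sqr_ge0. Qed.

Section step.
Variables (C eps : R) (L : nat).
Hypothesis C0 : 0 < C.
Hypothesis Cbnd : forall v, s <= v ->
  [/\ forall x, `|gker v x| <= C /\ `|gker_x v x| <= C /\ `|gker_xx v x| <= C,
      forall x y, `|gker_xx v x - gker_xx v y| <= C * `|x - y|,
      forall x t, `|gker v (x + t) - gker v x - gker_x v x * t - gker_xx v x / 2 * t ^+ 2|
        <= C * Num.min (t ^+ 2) (`|t| ^+ 3) &
      forall x h, 0 <= h -> `|gker (v + h) x - gker v x - gker_xx v x / 2 * h| <= C * h ^+ 2].
Hypothesis mixL : forall Y, gmeas F0 Y -> (forall w, `|Y w| <= 1) ->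
  `|E (fun w => m w ^+ 2 * Y (iter L.+1 Tinv w)) - s2 * E Y| <= eps.

(** This is [mixL] for [Y / C] composed with [T], which accounts for [L.+1] there and [L] here. *)
Let mixT Y : gmeas F0 Y -> (forall w, `|Y w| <= C) ->
  `|E (fun w => (m (T w) ^+ 2 - s2) * Y (iter L Tinv w))| <= C * eps.
Proof.
move=> gY YC; have gY' : gmeas F0 (fun w => C^-1 * Y w).
  by apply: gmeasM => //; exact: gmeas_cst.
have Y1 w : `|C^-1 * Y w| <= 1.
  by rewrite normrM gtr0_norm ?invr_gt0// mulrC ler_pdivrMr// mul1r.
have mY := gmeas_measurable F0m gY.
have mpL n := mp_iter_inv TK mTinv T_pres n.
have iY : intg Y by exact: intg_bounded YC.
have mYn n : measurable_fun setT (fun w => Y (iter n Tinv w)).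
  by apply: measurableT_comp => //; have [] := mpL n.
have := mixL gY' Y1; rewrite EZ//.
have -> : (fun w => m w ^+ 2 * (C^-1 * Y (iter L.+1 Tinv w))) =
  (fun w => C^-1 * (m w ^+ 2 * Y (iter L.+1 Tinv w))).
  by apply/funext => w; ring.
have imY : intg (fun w => m w ^+ 2 * Y (iter L.+1 Tinv w)).
  exact: (intgMb im2 (mYn _) (fun w => YC (iter L.+1 Tinv w))).
rewrite EZ//.
have [_ <-] := E_measure_preserving T_pres imY.
have -> : (fun w => m w ^+ 2 * Y (iter L.+1 Tinv w)) \o T =
   (fun w => m (T w) ^+ 2 * Y (iter L Tinv w)).
  by apply/funext => w; rewrite /comp iterSr TK.
have imYT : intg (fun w => m (T w) ^+ 2 * Y (iter L Tinv w)).
  exact: (intgMb im2T (mYn _) (fun w => YC (iter L Tinv w))).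
have -> : (fun w => (m (T w) ^+ 2 - s2) * Y (iter L Tinv w)) =
  (fun w => m (T w) ^+ 2 * Y (iter L Tinv w) - s2 * Y (iter L Tinv w)).
  by apply/funext => w; ring.
have [iYL EYL] := E_measure_preserving (mpL L) iY.
rewrite EB//; last exact: intgZ.
rewrite EZ//; rewrite /comp in EYL; rewrite EYL.
have -> : s2 * (C^-1 * E Y) = C^-1 * (s2 * E Y) by ring.
by rewrite -mulrBr normrM gtr0_norm ?invr_gt0// mulrC ler_pdivrMr// [eps * C]mulrC.
Qed.

(** The weight at [X n i] depends on the recent past, about which mixing says nothing. At the price
    of [beta] it is replaced by the weight of the sum without its [L] latest terms, a function of
    [T^(-L)], against which [m^2 \o T] can be averaged. *)
Let xx_term n i v : s <= v ->
  `|E (fun w => gker_xx v (X n i w) * (m (T w) ^+ 2 - s2))| <=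
  2 * C * E (beta L n) + C * eps.
Proof.
move=> sv; have [h1 h2 _ _] := Cbnd sv.
have gC x : `|gker_xx v x| <= C by have [_ []] := h1 x.
pose Y w := gker_xx v (X n (i - L) w).
have gY : gmeas F0 Y by apply: (gmeas_comp (measurable_gker_xx v)); exact: gX.
have YC w : `|Y w| <= C by exact: gC.
have mYL : measurable_fun setT (fun w => Y (iter L Tinv w)).
  apply: measurableT_comp; first exact: gmeas_measurable gY.
  by have [] := mp_iter_inv TK mTinv T_pres L.
have mg : measurable_fun setT (fun w => gker_xx v (X n i w)).
  by apply: measurableT_comp; [exact: measurable_gker_xx|exact: mX].
pose D w := gker_xx v (X n i w) - Y (iter L Tinv w).
have mD : measurable_fun setT D by exact: measurable_funB.
have Dle w : `|D w| <= 2 * C * Num.min 1 (B L w / rt n).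
  have D1 : `|D w| <= 2 * C.
    by apply: (le_trans (ler_normB _ _)); rewrite mulrDl mul1r lerD.
  have D2 : `|D w| <= C * (B L w / rt n).
    apply: (le_trans (h2 _ _)); apply: ler_wpM2l; first exact: ltW.
    rewrite /X [in X in `|X - _|](past_sum_split L) opprB addrA subrK mulrDl addrK.
    rewrite normrM (ger0_norm (x := (rt n)^-1)) ?invr_ge0 ?sqrtr_ge0//.
    apply: ler_wpM2r; first by rewrite invr_ge0 sqrtr_ge0.
    apply: (le_trans (ler_norm_sum _ _ _)).
    rewrite /B; case: (leqP i L) => iL; last by rewrite lexx.
    rewrite [leRHS](big_cat_nat (n := i))//= lerDl; exact: sumr_ge0.
  have Bge : 0 <= C * (B L w / rt n) by rewrite mulr_ge0 ?divr_ge0 ?sqrtr_ge0// ltW.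
  by case: (lerP 1 (B L w / rt n)) => _; rewrite ?mulr1//; lra.
have iD : intg (fun w => D w * (m (T w) ^+ 2 - s2)).
  have := intgMb im2s mD (c := 2 * C); under eq_fun do rewrite mulrC.
  apply => w; apply: (le_trans (Dle w)); rewrite -[leRHS]mulr1.
  have /andP[_ h] := min01 L n w.
  by apply: ler_wpM2l => //; rewrite mulr_ge0// ltW.
have iY : intg (fun w => (m (T w) ^+ 2 - s2) * Y (iter L Tinv w)).
  exact: (intgMb im2s mYL (fun w => YC (iter L Tinv w))).
have -> : (fun w => gker_xx v (X n i w) * (m (T w) ^+ 2 - s2)) =
  (fun w => D w * (m (T w) ^+ 2 - s2) + (m (T w) ^+ 2 - s2) * Y (iter L Tinv w)).
  by apply/funext => w; rewrite /D; ring.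
rewrite ED//; apply: (le_trans (ler_normD _ _)); apply: lerD; last exact: mixT.
have ib : intg (beta L n).
  apply: (intg_le _ (intg_norm im2s)) => //= w.
  rewrite /beta normrM normr_id.
  have /andP[h h'] := min01 L n w.
  by rewrite ger0_norm// ler_piMl.
rewrite -EZ//; apply: normr_E_le; [exact: intg_measurable iD|exact: intgZ|].
by move=> w; rewrite normrM /beta mulrA ler_wpM2r.
Qed.

(** By invariance [X n i.+1] may be composed with [T], which makes it [X n i] plus an increment.
    After expanding in space on one side and in the variance on the other, the heat equation leaves
    two remainders, a first-order term killed by the martingale property, and the term of
    [xx_term]. *)
Let step_le n i v (h := s2 / n%:R) : (0 < n)%N -> s <= v ->
  `|E (fun w => gker v (X n i.+1 w)) - E (fun w => gker (v + h) (X n i w))| <=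
  (C * E (alpha n) + (C * E (beta L n) + C * eps / 2) + C * s2 ^+ 2 / n%:R) / n%:R.
Proof.
move=> n0 sv; have [h1 _ h3 h4] := Cbnd sv.
have nR : 0 < n%:R :> R by rewrite ltr0n.
have rt0 : 0 < rt n by rewrite sqrtr_gt0.
have rt2 : rt n ^+ 2 = n%:R by rewrite sqr_sqrtr// ltW.
have hge0 : 0 <= h by rewrite divr_ge0// ltW.
pose t w := m (T w) / rt n.
have mt : measurable_fun setT t by exact: measurable_funM.
have XS w : X n i.+1 (T w) = X n i w + t w.
  by rewrite /X past_sum_shift /t; ring.
have mpsi (psi : R -> R) j : measurable_fun setT psi -> measurable_fun setT (fun w => psi (X n j w)).
  by move=> mpsi; apply: measurableT_comp => //; exact: mX.
have ig u j : s <= u -> intg (fun w => gker u (X n j w)).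
  move=> su; apply: (intg_bounded P (c := C)); first by apply: mpsi; exact: measurable_gker.
  by move=> w; have [k1 _ _ _] := Cbnd su; have [] := k1 (X n j w).
have svh : s <= v + h by rewrite (le_trans sv)// lerDl.
have [igT <-] := E_measure_preserving T_pres (ig v i.+1 sv).
pose R1 w := gker v (X n i w + t w) - gker v (X n i w) - gker_x v (X n i w) * t w
  - gker_xx v (X n i w) / 2 * t w ^+ 2.
pose R2 w := gker (v + h) (X n i w) - gker v (X n i w) - gker_xx v (X n i w) / 2 * h.
have mR2 : measurable_fun setT R2.
  apply: measurable_funB; last first.
    apply: measurable_funM => //; apply: measurable_funM => //.
    by apply: mpsi; exact: measurable_gker_xx.
  by apply: measurable_funB; apply: mpsi; exact: measurable_gker.
have mR1 : measurable_fun setT R1.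
  apply: measurable_funB; last first.
    apply: measurable_funM; last exact: measurable_funX.
    by apply: measurable_funM => //; apply: mpsi; exact: measurable_gker_xx.
  apply: measurable_funB; last first.
    by apply: measurable_funM => //; apply: mpsi; exact: measurable_gker_x.
  apply: measurable_funB; last by apply: mpsi; exact: measurable_gker.
  by apply: measurableT_comp; [exact: measurable_gker|apply: measurable_funD => //; exact: mX].
have ialpha : intg (alpha n).
  apply: (intg_le _ im2) => // w; rewrite ger0_norm//.
  by rewrite ge_min lexx.
have [ialT EalT] := E_measure_preserving T_pres ialpha.
have R1le w : `|R1 w| <= C / n%:R * alpha n (T w).
  apply: (le_trans (h3 _ _)); rewrite -mulrA; apply: ler_wpM2l; first exact: ltW.
  have t2 : t w ^+ 2 = n%:R^-1 * m (T w) ^+ 2.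
    by rewrite /t expr_div_n rt2 mulrC.
  have t3 : `|t w| ^+ 3 = n%:R^-1 * (`|m (T w)| ^+ 3 / rt n).
    rewrite /t normrM (ger0_norm (x := (rt n)^-1)) ?invr_ge0 ?ltW// -rt2.
    by field; rewrite gt_eqF.
  rewrite t2 t3 /alpha.
  have nV : 0 <= n%:R^-1 :> R by rewrite invr_ge0 ltW.
  by rewrite (minr_pMr _ _ nV).
have iR1 : intg R1 by apply: (intg_le mR1 _ R1le); exact: intgZ.
have R2le w : `|R2 w| <= C * h ^+ 2 by exact: h4.
have iR2 : intg R2 by exact: intg_bounded R2le.
have igx : intg (fun w => m (T w) * ((rt n)^-1 * gker_x v (X n i w))).
  apply: (@intgMb _ _ _ _ _ _ ((rt n)^-1 * C)).
  - by have [] := E_measure_preserving T_pres im.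
  - by apply: measurable_funM => //; apply: mpsi; exact: measurable_gker_x.
  - have rV : 0 <= (rt n)^-1 by rewrite invr_ge0 ltW.
    move=> w; rewrite normrM (ger0_norm rV).
    by apply: ler_wpM2l => //; have [_ []] := h1 (X n i w).
have igxx : intg (fun w => gker_xx v (X n i w) * (m (T w) ^+ 2 - s2)).
  have := intgMb im2s (mpsi _ i (measurable_gker_xx v)) (c := C).
  under eq_fun do rewrite mulrC.
  by apply => w; have [_ []] := h1 (X n i w).
have decomp : (fun w => gker v (X n i.+1 (T w)) - gker (v + h) (X n i w)) =
  (fun w => R1 w + (m (T w) * ((rt n)^-1 * gker_x v (X n i w)) +
    ((2 * n%:R)^-1 * (gker_xx v (X n i w) * (m (T w) ^+ 2 - s2)) - R2 w))).
  apply/funext => w; rewrite XS /R1 /R2 /h /t -rt2.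
  by field; rewrite gt_eqF.
have -> : E ((fun w => gker v (X n i.+1 w)) \o T) - E (fun w => gker (v + h) (X n i w)) =
  E (fun w => gker v (X n i.+1 (T w)) - gker (v + h) (X n i w)).
  by rewrite EB//; exact: ig.
have i3 := intgZ (2 * n%:R)^-1 igxx.
have i4 := intgB i3 iR2.
have gY : gmeas F0 (fun w => (rt n)^-1 * gker_x v (X n i w)).
  apply: gmeasM; first exact: gmeas_cst.
  by apply: (gmeas_comp (measurable_gker_x v)); exact: gX.
rewrite decomp (ED iR1 (intgD igx i4)) (ED igx i4).
rewrite (martingale_orth TK mTinv T_pres me mF0 im2 m_mart gY igx).
rewrite (EB i3 iR2) (EZ _ igxx) add0r addrA.
have b1 : `|E R1| <= C / n%:R * E (alpha n).
  by rewrite -EalT -EZ//; apply: normr_E_le => //; exact: intgZ.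
have b2 := @xx_term n i v sv.
have b3 : `|E R2| <= C * h ^+ 2 by exact: normr_E_bounded.
apply: (le_trans (ler_normB _ _)); apply: (le_trans (lerD (ler_normD _ _) (lexx _))).
have {}b2 : `|(2 * n%:R)^-1 * E (fun w => gker_xx v (X n i w) * (m (T w) ^+ 2 - s2))| <=
   (C * E (beta L n) + C * eps / 2) / n%:R.
  have nV : 0 <= (2 * n%:R)^-1 :> R by rewrite invr_ge0 mulr_ge0// ltW.
  rewrite normrM (ger0_norm nV); apply: (le_trans (ler_wpM2l nV b2)).
  by rewrite le_eqVlt; apply/orP; left; apply/eqP; field; rewrite gt_eqF.
apply: (le_trans (lerD (lerD b1 b2) b3)).
by rewrite le_eqVlt; apply/orP; left; apply/eqP; rewrite /h; field; rewrite gt_eqF.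
Qed.

Lemma lindeberg_le n : (0 < n)%N ->
  `|E (fun w => gker s (X n n w)) - gker (s + s2) (- a)| <=
  C * E (alpha n) + (C * E (beta L n) + C * eps / 2) + C * s2 ^+ 2 / n%:R.
Proof.
move=> n0; have nR : 0 < n%:R :> R by rewrite ltr0n.
(* The variance not yet spent on increments: [v n = s], while at [i = 0] the sum is empty and the
   value is the deterministic [gker (s + s2) (- a)]. *)
pose v i := s + (n - i)%:R * (s2 / n%:R).
pose u i := E (fun w => gker (v i) (X n i w)).
have u0 : u 0 = gker (s + s2) (- a).
  rewrite /u /v subn0.
  have -> : n%:R * (s2 / n%:R) = s2 by field; rewrite gt_eqF.
  rewrite -[RHS](E_cst P); apply: eqE => w.
  by rewrite /X /past_sum big_geq// mul0r sub0r.
have un : u n = E (fun w => gker s (X n n w)) by rewrite /u /v subnn mul0r addr0.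
rewrite -un -u0.
pose bnd : R := C * E (alpha n) + (C * E (beta L n) + C * eps / 2) + C * s2 ^+ 2 / n%:R.
have step i : (i < n)%N -> `|u i.+1 - u i| <= bnd / n%:R.
  move=> iln.
  have vi : v i = v i.+1 + s2 / n%:R.
    have ni : (n - i)%:R = (n - i.+1)%:R + 1 :> R by rewrite natr1 -subSn// subSS.
    by rewrite /v ni; ring.
  rewrite {2}/u vi.
  by apply: step_le => //; rewrite lerDl mulr_ge0// divr_ge0// ltW.
have tele j : (j <= n)%N -> `|u j - u 0| <= j%:R * (bnd / n%:R).
  elim: j => [|j IHj] jn; first by rewrite subrr normr0 mul0r.
  have -> : u j.+1 - u 0 = (u j.+1 - u j) + (u j - u 0) by ring.
  apply: (le_trans (ler_normD _ _)).
  by rewrite mulrS mulrDl mul1r; apply: lerD; [exact: step|exact/IHj/ltnW].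
have := tele n (leqnn n).
by rewrite mulrC divfK// gt_eqF.
Qed.

End step.

(** Order of choices: [L] from mixing at accuracy [eps / C], which costs [eps / 2], and only then
    [n], for the terms in [alpha], [beta] and [1 / n]. *)
Lemma lindeberg : E (fun w => gker s (birkhoff_sum T Tinv m n w / Num.sqrt n%:R - a))
  @[n --> \oo] --> gker (s + s2) (- a).
Proof.
have [C C0 Cbnd] := gker_smooth s0.
apply/cvgrPdist_le => eps eps0.
have mixm2 : mixes P T Tinv e (fun w => m w ^+ 2).
  apply: (mixes_ge0 TK TinvK mTinv T_pres me e_indep) => //.
    by apply: gmeasM => //.
  by move=> w; exact: sqr_ge0.
have eC : 0 < eps / C by rewrite divr_gt0.
have [_ /(_ _ eC)[L hL]] := mixm2.
have mixL Y : gmeas F0 Y -> (forall w, `|Y w| <= 1) ->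
    `|E (fun w => m w ^+ 2 * Y (iter L.+1 Tinv w)) - s2 * E Y| <= eps / C.
  by apply: hL; exact: leqW.
have cvgsum : C * E (alpha n) + (C * E (beta L n) + C * (eps / C) / 2)
   + C * s2 ^+ 2 / n%:R @[n --> \oo] --> C * 0 + (C * 0 + C * (eps / C) / 2) + 0.
  apply: cvgD; first apply: cvgD.
  - by apply: cvgMr; exact: alpha_cvg.
  - by apply: cvgD; [apply: cvgMr; exact: beta_cvg|exact: cvg_cst].
  - exact: cvg_div_nat.
have lt_eps : C * 0 + (C * 0 + C * (eps / C) / 2) + 0 < eps.
  have -> : C * (eps / C) = eps by field; rewrite gt_eqF.
  lra.
near=> n.
have n0 : (0 < n)%N by near: n; exact: nbhs_infty_gt.
have -> : E (fun w => gker s (birkhoff_sum T Tinv m n w / Num.sqrt n%:R - a)) =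
  E (fun w => gker s (X n n w)).
  have mpn := mp_iterz TK mTinv T_pres n%:Z.
  have igX : intg (fun w => gker s (X n n w)).
    apply: (intg_bounded P (c := C)).
      by apply: measurableT_comp; [exact: measurable_gker|exact: mX].
    by move=> w; have [k1 _ _ _] := Cbnd s (lexx s); have [] := k1 (X n n w).
  have [_ <-] := E_measure_preserving mpn igX.
  by apply: eqE => w; rewrite birkhoff_past_sum.
rewrite distrC; apply: (le_trans (lindeberg_le C0 Cbnd mixL n0)); apply: ltW.
near: n.
exact: (cvgr_lt _ cvgsum).
Unshelve. all: by end_near.
Qed.

End lindeberg.

(** * Gaussian tests and weak convergence *)

(** Equal masses give [E|q - p| = 2 E(p - q)^+], and the positive part is dominated by [p]. *)
Lemma scheffe d (T : measurableType d) (R : realType) (mu : {measure set T -> \bar R})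
    (q : nat -> T -> R) (p : T -> R) :
  (forall n, mu.-integrable setT (EFin \o q n)) -> mu.-integrable setT (EFin \o p) ->
  (forall n x, 0 <= q n x) -> (forall x, 0 <= p x) ->
  (forall n, Rintegral mu setT (q n) = Rintegral mu setT p) ->
  (forall x, q n x @[n --> \oo] --> p x) ->
  Rintegral mu setT (fun x => `|q n x - p x|) @[n --> \oo] --> (0 : R).
Proof.
move=> iq ip q0 p0 qp cvgq.
pose h n x := Num.max (p x - q n x) 0.
have ipq n := intgB ip (iq n).
have mh n : measurable_fun setT (h n).
  by apply: measurable_maxr => //; apply: intg_measurable (ipq n).
have h0 n x : 0 <= h n x by rewrite le_max lexx orbT.
have hp n x : h n x <= p x by rewrite ge_max p0 andbT lerBlDr lerDl.
have ih n : mu.-integrable setT (EFin \o h n).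
  by apply: (intg_le (mh n) ip) => x; rewrite ger0_norm.
have e n : Rintegral mu setT (fun x => `|q n x - p x|) = 2 * Rintegral mu setT (h n).
  have -> : (fun x => `|q n x - p x|) = (fun x => 2 * h n x - (p x - q n x)).
    apply/funext => x; rewrite /h; case: (lerP (p x - q n x) 0) => hx.
      by rewrite ger0_norm; lra.
    by rewrite ltr0_norm; lra.
  by rewrite (EB (intgZ 2 (ih n)) (ipq n)) (EB ip (iq n)) qp subrr subr0 (EZ _ (ih n)).
under eq_fun do rewrite e.
have -> : (0 : R) = 2 * Rintegral mu setT (fun x : T => 0 * p x).
  by rewrite (EZ _ ip) mul0r mulr0.
apply: cvgMr; apply: (E_cvg mh _ ip).
- by apply: measurable_funM => //; exact: intg_measurable ip.
- by move=> n x; rewrite ger0_norm.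
move=> x; rewrite mul0r.
apply: (@squeeze_cvgr _ _ _ _ (fun=> 0) (fun n => `|p x - q n x|)); last 2 first.
- exact: cvg_cst.
- have : `|p x - q n x| @[n --> \oo] --> `|p x - p x|.
    by apply: cvg_norm; apply: cvgB; [exact: cvg_cst|exact: cvgq].
  by rewrite subrr normr0.
by apply: nearW => n; rewrite h0/= ge_max ler_norm normr_ge0.
Qed.

Lemma scheffe_test d (T : measurableType d) (R : realType) (mu : {measure set T -> \bar R})
    (q : nat -> T -> R) (p phi : T -> R) (C : R) :
  (forall n, mu.-integrable setT (EFin \o q n)) -> mu.-integrable setT (EFin \o p) ->
  (forall n x, 0 <= q n x) -> (forall x, 0 <= p x) ->
  (forall n, Rintegral mu setT (q n) = Rintegral mu setT p) ->
  (forall x, q n x @[n --> \oo] --> p x) ->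
  measurable_fun setT phi -> (forall x, `|phi x| <= C) ->
  Rintegral mu setT (fun x => phi x * q n x) @[n --> \oo] -->
  Rintegral mu setT (fun x => phi x * p x).
Proof.
move=> iq ip q0 p0 qp cvgq mphi phiC.
have ipp f : mu.-integrable setT (EFin \o f) ->
    mu.-integrable setT (EFin \o (fun x => phi x * f x)).
  move=> iF; have := intgMb iF mphi phiC; congr (_.-integrable _ (_ \o _)).
  by apply/funext => x; rewrite mulrC.
apply/subr_cvg0.
apply: (@squeeze_cvgr _ _ _ _
  (fun n => - (C * Rintegral mu setT (fun x => `|q n x - p x|)))
  (fun n => C * Rintegral mu setT (fun x => `|q n x - p x|))); last 2 first.
- by rewrite -(oppr0 R) -[X in - X](mulr0 C); apply: cvgN; apply: cvgMr; exact: scheffe.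
- by rewrite -[X in _ --> X](mulr0 C); apply: cvgMr; exact: scheffe.
apply: nearW => n; rewrite -ler_norml.
have iqp := intgB (iq n) ip.
rewrite -(EB (ipp _ (iq n)) (ipp _ ip)) -(EZ C (intg_norm iqp)).
apply: normr_E_le.
- by apply: intg_measurable (intgB (ipp _ (iq n)) (ipp _ ip)).
- exact/intgZ/intg_norm.
- by move=> x; rewrite -mulrBr normrM ler_wpM2r.
Qed.

(** * Gaussian mollification of test functions *)

Section gaussian_smoothing.
Context (R : realType).
Local Notation leb := (@lebesgue_measure R).
Local Notation I f := (Rintegral leb setT f).
Implicit Types v x a : R.

Definition gdens v x : R := (Num.sqrt (2 * pi))^-1 * gker v x.

Lemma gdens_normal v x a : 0 < v -> gdens v (x - a) = normal_pdf x (Num.sqrt v) a.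
Proof.
move=> v0; have sv0 : Num.sqrt v != 0 by rewrite gt_eqF// sqrtr_gt0.
have p0 : 0 < 2 * pi :> R by rewrite mulr_gt0// pi_gt0.
rewrite normal_pdfE// /normal_peak /normal_fun sqr_sqrtr ?ltW// /gdens /gker expRD mulrA.
congr (_ * expR _); last first.
  rewrite mulNr; congr (- (_ / _)); last by rewrite mulr2n; ring.
  by ring.
have -> : expR (- (ln v / 2)) = (Num.sqrt v)^-1.
  rewrite expRN; congr (_^-1); apply/eqP.
  rewrite -(@eqrXn2 _ 2) ?expR_ge0 ?sqrtr_ge0// sqr_sqrtr ?ltW//.
  by rewrite -expRM_natl -[X in _ == X](lnK v0); apply/eqP; congr expR; field.
by rewrite -invfM -sqrtrM ?(ltW p0)//; congr (Num.sqrt _)^-1; rewrite -mulr_natr; ring.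
Qed.

Lemma gdens_ge0 v x : 0 <= gdens v x.
Proof. by rewrite mulr_ge0 ?invr_ge0 ?sqrtr_ge0// ltW// gker_gt0. Qed.

Lemma measurable_gdens v : measurable_fun setT (gdens v).
Proof. by apply: measurable_funM => //; exact: measurable_gker. Qed.

Lemma integral_gdens v x : 0 < v -> (\int[leb]_a (gdens v (x - a))%:E)%E = 1%E.
Proof.
move=> v0; under eq_integral do rewrite gdens_normal//.
exact: integral_normal_pdf.
Qed.

Lemma intg_gdens v x : 0 < v -> leb.-integrable setT (EFin \o (fun a => gdens v (x - a))).
Proof.
move=> v0; have -> : (fun a => gdens v (x - a)) = normal_pdf x (Num.sqrt v).
  by apply/funext => a; rewrite gdens_normal.
exact: integrable_normal_pdf.
Qed.

Lemma Rintegral_gdens v x : 0 < v -> I (fun a => gdens v (x - a)) = 1.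
Proof. by move=> v0; rewrite /Rintegral integral_gdens. Qed.

Lemma gdensN v x : gdens v (- x) = gdens v x.
Proof. by rewrite /gdens gkerN. Qed.

Lemma intg_gdens0 v : 0 < v -> leb.-integrable setT (EFin \o gdens v).
Proof.
move=> v0; have := intg_gdens 0 v0; congr (_.-integrable _ (_ \o _)).
by apply/funext => a; rewrite sub0r gdensN.
Qed.

Lemma Rintegral_gdens0 v : 0 < v -> I (gdens v) = 1.
Proof.
move=> v0; rewrite -(Rintegral_gdens 0 v0); apply: eqE => a.
by rewrite sub0r gdensN.
Qed.

(* [sqrt z exp(-2 z) <= exp(-z)] for [z = y^2 / (4 s)] *)
Lemma gdens_moment s y : 0 < s -> `|y| * gdens s y <= 4 * Num.sqrt s * gdens (2 * s) y.
Proof.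
move=> s0; have r0 : 0 < Num.sqrt s by rewrite sqrtr_gt0.
pose u := `|y| / (2 * Num.sqrt s).
have u0 : 0 <= u by rewrite divr_ge0// mulr_ge0// ltW.
have yu : `|y| = 2 * Num.sqrt s * u by rewrite /u; field; rewrite gt_eqF.
have y2 : y ^+ 2 = 4 * s * u ^+ 2.
  rewrite -(real_normK (num_real y)) yu exprMn exprMn sqr_sqrtr ?ltW//.
  by congr (_ * _ * _); ring.
have g2 : gker s y <= 2 * (expR (- u ^+ 2) * gker (2 * s) y).
  have e2 (z : R) : 2 * z = expR (ln 2) * z by rewrite lnK ?posrE.
  rewrite e2 /gker lnM ?posrE// -!expRD ler_expR.
  have -> : y ^+ 2 / (2 * s) = 2 * u ^+ 2 by rewrite y2; field; rewrite gt_eqF.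
  have -> : y ^+ 2 / (2 * (2 * s)) = u ^+ 2 by rewrite y2; field; rewrite gt_eqF.
  have : 0 <= ln 2 :> R by rewrite ln_ge0// ler1n.
  by lra.
have u1 : u * expR (- u ^+ 2) <= 1.
  rewrite expRN ler_pdivrMr ?expR_gt0// mul1r.
  apply: (le_trans _ (expR_ge1Dx _)).
  have := sqr_ge0 (u - 1); nra.
rewrite /gdens mulrCA [leRHS]mulrCA ler_wpM2l ?invr_ge0 ?sqrtr_ge0//.
rewrite yu; apply: (@le_trans _ _ (2 * Num.sqrt s * u * (2 * (expR (- u ^+ 2) * gker (2 * s) y)))).
  by apply: ler_wpM2l => //; rewrite !mulr_ge0// ltW.
have -> : 2 * Num.sqrt s * u * (2 * (expR (- u ^+ 2) * gker (2 * s) y)) =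
  4 * Num.sqrt s * (u * expR (- u ^+ 2)) * gker (2 * s) y by ring.
apply: ler_wpM2r; first exact/ltW/gker_gt0.
by rewrite -[leRHS]mulr1 ler_wpM2l// mulr_ge0// ltW.
Qed.

Variables (phi : R -> R) (C Lip : R).
Hypotheses (mphi : measurable_fun setT phi) (phiC : forall x, `|phi x| <= C)
  (phiL : forall x y, `|phi x - phi y| <= Lip * `|x - y|).

(** The Lipschitz constant times the first absolute moment of the Gaussian, which [gdens_moment]
    bounds by [4 sqrt s] through the mass of a wider Gaussian. *)
Lemma smoothing_le s x : 0 < s ->
  `|I (fun a => phi a * gdens s (x - a)) - phi x| <= Lip * (4 * Num.sqrt s).
Proof.
move=> s0; have s20 : 0 < 2 * s by rewrite mulr_gt0.
have Lip0 : 0 <= Lip.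
  by have := phiL 1 0; rewrite subr0 normr1 mulr1; apply: le_trans.
have mg u : measurable_fun setT (fun a => gdens u (x - a)).
  by apply: measurableT_comp; [exact: measurable_gdens|exact: measurable_funB].
have ipg : leb.-integrable setT (EFin \o (fun a => phi a * gdens s (x - a))).
  have := intgMb (intg_gdens x s0) mphi phiC; congr (_.-integrable _ (_ \o _)).
  by apply/funext => a; rewrite mulrC.
have icg := intgZ (phi x) (intg_gdens x s0).
have -> : I (fun a => phi a * gdens s (x - a)) - phi x =
   I (fun a => phi a * gdens s (x - a) - phi x * gdens s (x - a)).
  by rewrite (EB ipg icg) (EZ _ (intg_gdens x s0)) Rintegral_gdens// mulr1.
have iD := intgB ipg icg.
have -> : Lip * (4 * Num.sqrt s) = I (fun a => Lip * (4 * Num.sqrt s) * gdens (2 * s) (x - a)).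
  by rewrite (EZ _ (intg_gdens x s20)) Rintegral_gdens// mulr1.
apply: normr_E_le; [exact: intg_measurable iD|exact: intgZ (intg_gdens x s20)|].
move=> a; rewrite -mulrBl normrM (ger0_norm (gdens_ge0 _ _)).
apply: (@le_trans _ _ (Lip * (`|x - a| * gdens s (x - a)))).
  rewrite [leRHS]mulrA; apply: ler_wpM2r; first exact: gdens_ge0.
  by rewrite (distrC x); exact: phiL.
by rewrite -[leRHS]mulrA; apply: ler_wpM2l => //; exact: gdens_moment.
Qed.

Lemma gdens_cvg (v : R) : 0 < v -> forall x : R,
  gdens (v + k.+1%:R^-1) x @[k --> \oo] --> gdens v x.
Proof.
move=> v0 x; apply: cvgMr.
have [dv _] := is_derive_gker_v x v0.
have cv : {for v, continuous (fun t => gker t x)}.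
  by apply: differentiable_continuous; apply/derivable1_diffP.
apply: (cvg_comp (fun k : nat => v + k.+1%:R^-1) (fun t => gker t x)); last exact: cv.
have : v + k.+1%:R^-1 @[k --> \oo] --> v + 0.
  by apply: cvgD; [exact: cvg_cst|exact: cvg_harmonic].
by rewrite addr0.
Qed.

Lemma smooth_gdens_cvg v : 0 < v ->
  I (fun a => phi a * gdens (v + k.+1%:R^-1) a) @[k --> \oo] --> I (fun a => phi a * gdens v a).
Proof.
move=> v0; have vk k : 0 < v + k.+1%:R^-1 :> R by rewrite addr_gt0.
apply: (scheffe_test (C := C)) => //.
- by move=> n; exact: intg_gdens0.
- exact: intg_gdens0.
- by move=> n x; exact: gdens_ge0.
- by move=> x; exact: gdens_ge0.
- by move=> n; rewrite !Rintegral_gdens0.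
- exact: gdens_cvg.
Qed.

End gaussian_smoothing.

Section gauss_tests.
Context (R : realType) d (Omega : measurableType d) (P : probability Omega R).
Local Notation leb := (@lebesgue_measure R).
Local Notation I f := (Rintegral leb setT f).
Local Notation intg f := (P.-integrable setT (EFin \o f)).
Local Notation E f := (Rintegral P setT f).

(** Fubini: averaging the mollified test function amounts to integrating [phi] against the density
    of [X] plus independent Gaussian noise. Integrating in [a] first shows absolute integrability,
    the inner integral being at most [C]. *)
Lemma E_smoothing (phi : R -> R) (C : R) (X : Omega -> R) s :
  measurable_fun setT phi -> (forall x, `|phi x| <= C) ->
  0 < s -> measurable_fun setT X ->
  [/\ intg (fun w => I (fun a => phi a * gdens s (X w - a))),
      leb.-integrable setT (EFin \o (fun a => phi a * E (fun w => gdens s (X w - a)))) &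
      E (fun w => I (fun a => phi a * gdens s (X w - a))) =
      I (fun a => phi a * E (fun w => gdens s (X w - a)))].
Proof.
move=> mphi phiC s0 mX.
pose F (z : Omega * R) : \bar R := (phi z.2 * gdens s (X z.1 - z.2))%:E.
have mF : measurable_fun setT F.
  apply/measurable_EFinP; apply: measurable_funM; first exact: measurableT_comp.
  apply: measurableT_comp; first exact: measurable_gdens.
  by apply: measurable_funB => //; exact: measurableT_comp.
have ia x : leb.-integrable setT (EFin \o (fun a => phi a * gdens s (x - a))).
  have := intgMb (intg_gdens x s0) mphi phiC; congr (_.-integrable _ (_ \o _)).
  by apply/funext => a; rewrite mulrC.
have iFF : (P \x leb)%E.-integrable setT F.
  apply/integrable12ltyP => //.
  apply: (@le_lt_trans _ _ (\int[P]_w C%:E)%E); last first.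
    by rewrite integral_cst//= probability_setT mule1 ltry.
  apply: ge0_le_integral => //.
  - by move=> w _; apply: integral_ge0.
  - apply: (measurable_fun_fubini_tonelli_F (m2 := leb) (abse \o F)).
      exact: measurableT_comp.
    by move=> z; exact: abse_ge0.
  - move=> w _; have := integral_gdens (X w) s0 => g1.
    rewrite -[leRHS]mule1 -g1 -integralZl//; last exact: intg_gdens.
    apply: ge0_le_integral => //.
    + by apply: measurableT_comp => //; have /measurable_int := ia (X w).
    + apply/measurable_EFinP; apply: measurable_funM => //.
      by apply: intg_measurable (intg_gdens (X w) s0).
    + move=> a _; rewrite /F /= lee_fin normrM (ger0_norm (gdens_ge0 _ _)).
      by rewrite ler_wpM2r ?gdens_ge0.
have mgw a : measurable_fun setT (fun w => gdens s (X w - a)).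
  by apply: measurableT_comp; [exact: measurable_gdens|exact: measurable_funB].
have [K Kg] : exists K : R, forall x : R, `|gdens s x| <= K.
  have [K K0 /(_ s (lexx s))[h _ _ _]] := gker_smooth s0.
  exists ((Num.sqrt (2 * pi))^-1 * K) => x; rewrite normrM ger0_norm ?invr_ge0 ?sqrtr_ge0//.
  by rewrite ler_wpM2l ?invr_ge0 ?sqrtr_ge0//; have [] := h x.
have iw a : intg (fun w => gdens s (X w - a)) by exact: (intg_bounded P (mgw a) (fun w => Kg _)).
have FE w : (\int[leb]_a F (w, a) = (I (fun a => phi a * gdens s (X w - a)))%:E)%E.
  by rewrite /F /= (integral_E (ia (X w))).
have GE a : (\int[P]_w F (w, a) = (phi a * E (fun w => gdens s (X w - a)))%:E)%E.
  by rewrite /F /= (integral_E (intgZ (phi a) (iw a))) (EZ _ (iw a)).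
split.
- have := integrable_fubini_F iFF; congr (_.-integrable _ _).
  by apply/funext => w; rewrite /fubini_F FE.
- have GG : fubini_G P F = EFin \o (fun a => phi a * E (fun w => gdens s (X w - a))).
    by apply/funext => a; rewrite /fubini_G GE.
  have mG : measurable_fun setT (fubini_G P F) by exact: measurable_fubini_G iFF.
  rewrite -GG; apply/integrableP; split=> //.
  apply: (le_lt_trans _ ((integrable21ltyP P leb mF).1 iFF)).
  apply: ge0_le_integral => //; [exact: measurableT_comp| |].
    apply: (measurable_fun_fubini_tonelli_G (m1 := P) (abse \o F)).
      exact: measurableT_comp.
    by move=> z; exact: abse_ge0.
  move=> a _; apply: le_abse_integral => //.
  by apply/measurable_EFinP; apply: intg_measurable (intgZ (phi a) (iw a)).
- rewrite /Rintegral; congr fine.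
  transitivity (\int[P]_w \int[leb]_a F (w, a))%E.
    by apply: eq_integral => w _; rewrite FE.
  by rewrite (Fubini iFF); apply: eq_integral => a _; rewrite GE.
Qed.

(** For fixed [s] the hypothesis is pointwise convergence of the densities of [X n] plus noise of
    variance [s], and Scheffe's lemma turns it into convergence of bounded tests. The noise is
    removed with an error uniform in [n] on the side of [X n], and by continuity in the variance in
    the limit law. *)
Lemma gauss_tests_lipschitz (X : nat -> Omega -> R) (v : R) (phi : R -> R) (C Lip : R) :
  0 < v -> (forall n, measurable_fun setT (X n)) ->
  (forall s a : R, 0 < s -> E (fun w => gker s (X n w - a)) @[n --> \oo] --> gker (s + v) (- a)) ->
  measurable_fun setT phi -> (forall x, `|phi x| <= C) ->
  (forall x y, `|phi x - phi y| <= Lip * `|x - y|) ->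
  E (fun w => phi (X n w)) @[n --> \oo] --> I (fun a => phi a * gdens v a).
Proof.
move=> v0 mX cvgX mphi phiC phiL; apply/cvgrPdist_le => eps eps0.
have e3 : 0 < eps / 3 by rewrite divr_gt0.
pose s k : R := k.+1%:R^-1.
have s0 k : 0 < s k by rewrite invr_gt0.
have h1 : \forall k \near \oo, Lip * (4 * Num.sqrt (s k)) <= eps / 3.
  have c : Lip * (4 * Num.sqrt (s k)) @[k --> \oo] --> (0 : R).
    have -> : (fun k => Lip * (4 * Num.sqrt (s k))) =
        (fun k : nat => (Lip * 4) / Num.sqrt k.+1%:R).
      by apply/funext => k; rewrite /s sqrtrV// mulrA.
    by have := cvg_div_sqrt (Lip * 4); rewrite -cvg_shiftS.
  by apply: (cvgr_le _ c).
have h2 : \forall k \near \oo, `|I (fun a => phi a * gdens v a) -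
    I (fun a => phi a * gdens (v + s k) a)| <= eps / 3.
  by have /cvgrPdist_le := smooth_gdens_cvg mphi phiC v0; apply.
have [k [hk1 hk2]] : exists k, Lip * (4 * Num.sqrt (s k)) <= eps / 3 /\
    `|I (fun a => phi a * gdens v a) - I (fun a => phi a * gdens (v + s k) a)| <= eps / 3.
  by have [N _ hN] := filterI h1 h2; exists N; have := hN N (leqnn N).
(* The density at [a] of [X n] plus noise of variance [s k]; [k] is now fixed, before [n]. *)
pose q n a := E (fun w => gdens (s k) (X n w - a)).
have vs : 0 < v + s k by rewrite addr_gt0.
have iq n : leb.-integrable setT (EFin \o q n).
  have [_ + _] := E_smoothing (phi := fun=> 1) (C := 1) (measurable_cst _)
    (fun=> ltac:(by rewrite normr1)) (s0 k) (mX n).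
  by congr (_.-integrable _ (_ \o _)); apply/funext => a; rewrite mul1r.
have q1 n : I (q n) = 1.
  have [_ _ h] := E_smoothing (phi := fun=> 1) (C := 1) (measurable_cst _)
    (fun=> ltac:(by rewrite normr1)) (s0 k) (mX n).
  have -> : q n = (fun a => 1 * q n a) by apply/funext => a; rewrite mul1r.
  rewrite -h -[RHS](E_cst P); apply: eqE => w.
  rewrite -[RHS](Rintegral_gdens (X n w) (s0 k)); apply: eqE => a.
  by rewrite mul1r.
have cvgq : I (fun a => phi a * q n a) @[n --> \oo] --> I (fun a => phi a * gdens (v + s k) a).
  apply: (scheffe_test (C := C)) => //.
  - exact: intg_gdens0.
  - by move=> n a; apply: E_ge0 => w; exact: gdens_ge0.
  - by move=> a; exact: gdens_ge0.
  - by move=> n; rewrite q1 Rintegral_gdens0.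
  - move=> a; rewrite -gdensN /gdens addrC.
    have -> : q ^~ a = (fun n => (Num.sqrt (2 * pi))^-1 * E (fun w => gker (s k) (X n w - a))).
      apply/funext => n; rewrite -EZ//.
      have [K K0 /(_ (s k) (lexx _))[hK _ _ _]] := gker_smooth (s0 k).
      apply: (intg_bounded P (c := K)) => [|w]; last by have [] := hK (X n w - a).
      by apply: measurableT_comp; [exact: measurable_gker|exact: measurable_funB].
    by apply: cvgMr; exact: cvgX.
near=> n.
have [iphis _ hE] := E_smoothing mphi phiC (s0 k) (mX n).
have iphi : intg (fun w => phi (X n w)).
  by apply: intg_bounded (fun w => phiC (X n w)); exact: measurableT_comp.
have b1 : `|E (fun w => I (fun a => phi a * gdens (s k) (X n w - a))) - E (fun w => phi (X n w))|
    <= Lip * (4 * Num.sqrt (s k)).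
  rewrite -(EB iphis iphi); apply: normr_E_bounded.
    by apply: intg_measurable (intgB iphis iphi).
  by move=> w; apply: smoothing_le => //; exact: s0.
have b2 : `|I (fun a => phi a * gdens (v + s k) a) - I (fun a => phi a * q n a)| <= eps / 3.
  by near: n; move/cvgrPdist_le : cvgq; apply.
rewrite hE in b1.
set A := I _ in hk2 *; set B := E _ in b1 *; set D := I _ in b1 b2; set F := I _ in hk2 b2.
have -> : A - B = (A - F) + (F - D) + (D - B) by ring.
have {}b1 := le_trans b1 hk1.
apply: (le_trans (ler_normD _ _)); apply: (le_trans (lerD (ler_normD _ _) b1)).
by move: hk2 b2; lra.
Unshelve. all: by end_near.
Qed.

End gauss_tests.

(** * Lipschitz approximation from below *)

Section inf_convolution.
Context (R : realType).
Variables (phi : R -> R) (C : R).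
Hypotheses (phi_cont : continuous phi) (phiC : forall x, `|phi x| <= C).

(** The Pasch-Hausdorff envelope, the largest [k]-Lipschitz function below [phi]. *)
Definition infconv (k : nat) (x : R) : R :=
  inf [set phi y + k%:R * `|x - y| | y in setT].

Let phi_ge x : - C <= phi x.
Proof. by have := phiC x; rewrite ler_norml => /andP[]. Qed.

Let infconv_ge_lb k x : lbound [set phi y + k%:R * `|x - y| | y in setT] (- C).
Proof.
move=> _ [y _ <-]; apply: (le_trans (phi_ge y)).
by rewrite lerDl mulr_ge0.
Qed.

Lemma infconv_le k x y : infconv k x <= phi y + k%:R * `|x - y|.
Proof. by apply: ge_inf; [exists (- C); exact: infconv_ge_lb|exists y]. Qed.

Lemma le_infconv k x (c : R) : (forall y, c <= phi y + k%:R * `|x - y|) -> c <= infconv k x.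
Proof.
move=> h; apply: lb_le_inf; last by move=> _ [y _ <-].
by exists (phi x + k%:R * `|x - x|), x.
Qed.

Lemma infconv_le_phi k x : infconv k x <= phi x.
Proof. by have := infconv_le k x x; rewrite subrr normr0 mulr0 addr0. Qed.

Lemma infconv_bounded k x : `|infconv k x| <= C.
Proof.
rewrite ler_norml; apply/andP; split.
  by apply: le_infconv => y; rewrite (le_trans (phi_ge y))// lerDl mulr_ge0.
apply: (le_trans (infconv_le_phi k x)).
by have := phiC x; rewrite ler_norml => /andP[].
Qed.

Lemma infconv_lipschitz k x y : `|infconv k x - infconv k y| <= k%:R * `|x - y|.
Proof.
have h a b : infconv k a - k%:R * `|a - b| <= infconv k b.
  apply: le_infconv => z; rewrite lerBlDr; apply: (le_trans (infconv_le k a z)).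
  rewrite -addrA lerD2l -mulrDr; apply: ler_wpM2l => //.
  have -> : a - z = (b - z) + (a - b) by ring.
  exact: ler_normD.
by rewrite ler_norml; apply/andP; split; [have := h y x; rewrite distrC|have := h x y]; lra.
Qed.

(** Points close to [x] lower the infimum by at most [eps], by continuity; farther points pay a
    penalty [k r >= 2 C], which makes up for the oscillation of [phi]. *)
Lemma infconv_cvg x : infconv k x @[k --> \oo] --> phi x.
Proof.
apply/cvgrPdist_le => eps eps0.
have /cvgrPdist_le/(_ _ eps0)/nbhs_ballP[r /= r0 hr] := @phi_cont x.
near=> k.
rewrite ger0_norm ?subr_ge0 ?infconv_le_phi//.
rewrite lerBlDr -lerBlDl; apply: le_infconv => y.
have [xy|xy] := ltP `|x - y| r.
  have := hr y xy; have := ler_norm (phi x - phi y) => h1 h2.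
  have : 0 <= k%:R * `|x - y| by rewrite mulr_ge0.
  by move: (le_trans h1 h2); lra.
have : k%:R * r <= k%:R * `|x - y| by rewrite ler_wpM2l.
have : 2 * C <= k%:R * r.
  by rewrite -ler_pdivrMr//; near: k; exact: nbhs_infty_ger.
have := phiC x; have := phi_ge y; rewrite ler_norml => ? /andP[_ ?].
by lra.
Unshelve. all: by end_near.
Qed.

Lemma measurable_infconv k : measurable_fun setT (infconv k).
Proof.
apply: continuous_measurable_fun => x; apply/cvgrPdist_le => eps eps0.
have k1 : 0 < k%:R + 1 :> R by rewrite ltr_wpDl.
near=> y.
apply: (le_trans (infconv_lipschitz k x y)).
apply: (@le_trans _ _ ((k%:R + 1) * `|x - y|)); first by rewrite ler_wpM2r// lerDl.
rewrite mulrC -ler_pdivlMr//; near: y.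
have h : 0 < eps / (k%:R + 1) by rewrite divr_gt0.
by have /cvgrPdist_le := @cvg_id _ (nbhs x); apply.
Unshelve. all: by end_near.
Qed.

End inf_convolution.

(** * From Lipschitz tests to weak convergence, and Slutsky's lemma *)

Section weak_convergence.
Context (R : realType) d (Omega : measurableType d) (P : probability Omega R).
Local Notation intg f := (P.-integrable setT (EFin \o f)).
Local Notation E f := (Rintegral P setT f).

Definition lipschitz_tests (X : nat -> Omega -> R) (Q : (R -> R) -> R) :=
  forall (phi : R -> R) (C Lip : R), measurable_fun setT phi ->
    (forall x, `|phi x| <= C) -> (forall x y, `|phi x - phi y| <= Lip * `|x - y|) ->
    E (fun w => phi (X n w)) @[n --> \oo] --> Q phi.

(** Lipschitz minorants of a bounded continuous function bound the lower limit from below; the same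
    bound for [- phi] takes care of the upper limit. *)
Lemma lipschitz_weak_cvg (X : nat -> Omega -> R) (Q : probability (measurableTypeR R) R) :
  (forall n, measurable_fun setT (X n)) ->
  lipschitz_tests X (fun phi => Rintegral Q setT phi) ->
  weak_cvg (fun n => pushforward P (X n : Omega -> measurableTypeR R)) Q.
Proof.
move=> mX hL phi phi_cont [C phiC].
have mcont (f : R -> R) : continuous f -> measurable_fun setT f by exact: continuous_measurable_fun.
have iP (f : R -> R) n c : measurable_fun setT f -> (forall x, `|f x| <= c) ->
    intg (fun w => f (X n w)).
  move=> mf fc; apply: (intg_bounded P (c := c)) => //.
  exact: (measurableT_comp mf (mX n)).
have iQ (f : R -> R) c : measurable_fun setT f -> (forall x, `|f x| <= c) ->
    Q.-integrable setT (EFin \o f).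
  by move=> mf fc; exact: (intg_bounded Q mf fc).
have lower (f : R -> R) : continuous f -> (forall x, `|f x| <= C) -> forall eps : R, 0 < eps ->
    \forall n \near \oo, Rintegral Q setT f - eps <= E (fun w => f (X n w)).
  move=> fcont fC eps eps0; have e2 : 0 < eps / 2 by rewrite divr_gt0.
  have mf := mcont _ fcont.
  have mk := measurable_infconv fC.
  have kC := infconv_bounded fC.
  have : Rintegral Q setT (infconv f k) @[k --> \oo] --> Rintegral Q setT f.
    apply: (E_cvg (Omega := measurableTypeR R) (g := fun=> C)) => //.
    - exact: (intg_cst Q C).
    - exact: infconv_cvg.
  move=> /cvgrPdist_le/(_ _ e2)[k _ /(_ k (leqnn k)) hk].
  have := hL _ C k%:R (mk k) (kC k) (infconv_lipschitz fC k).
  move=> /cvgrPdist_le/(_ _ e2); apply: filterS => n hn.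
  have : E (fun w => infconv f k (X n w)) <= E (fun w => f (X n w)).
    apply: E_le; [exact: iP (mk k) (kC k)|exact: iP fC|].
    by move=> w; exact: infconv_le_phi.
  have := ler_norm (Rintegral Q setT f - Rintegral Q setT (infconv f k)).
  have := ler_norm (Rintegral Q setT (infconv f k) - E (fun w => infconv f k (X n w))).
  by move: hk hn => /=; lra.
have mphi := mcont _ phi_cont.
have E1 n : (\int[pushforward P (X n : Omega -> measurableTypeR R)]_x (phi x)%:E)%E =
    (E (fun w => phi (X n w)))%:E.
  rewrite (@integral_pushforward _ _ _ (measurableTypeR R) R (X n) (mX n) P setT (EFin \o phi))//.
  - by rewrite -integral_E//; exact: iP phiC.
  - exact/measurable_EFinP.
  - exact: iP phiC.
have E2 : (\int[Q]_x (phi x)%:E)%E = (Rintegral Q setT phi)%:E.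
  by rewrite (@integral_E _ _ _ Q)//; exact: iQ phiC.
rewrite E2; under eq_fun do rewrite E1.
apply/fine_cvgP; split; first exact: nearW.
apply/cvgrPdist_le => eps eps0 /=.
have Nphi_cont : continuous (fun x => - phi x) by move=> x; apply: cvgN; exact: phi_cont.
have NphiC x : `|- phi x| <= C by rewrite normrN.
near=> n.
have h1 : Rintegral Q setT phi - eps <= E (fun w => phi (X n w)).
  by near: n; exact: lower.
have h2 : Rintegral Q setT (fun x => - phi x) - eps <= E (fun w => - phi (X n w)).
  by near: n; exact: (lower (fun x => - phi x)).
have eN d' (T' : measurableType d') (mu : {measure set T' -> \bar R}) (f : T' -> R) :
    mu.-integrable setT (EFin \o f) -> Rintegral mu setT (fun x => - f x) = - Rintegral mu setT f.
  by move=> iF; rewrite -mulN1r -(EZ _ iF); apply: eqE => x; rewrite mulN1r.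
rewrite (eN _ _ Q _ (iQ phi C mphi phiC)) (eN _ _ P _ (iP phi n C mphi phiC)) in h2.
by rewrite ler_norml; apply/andP; split; lra.
Unshelve. all: by end_near.
Qed.

(** Keeping [Q] an arbitrary functional makes one lemma serve both the normal limit and the point
    mass. *)
Lemma slutsky (X Y : nat -> Omega -> R) (Q : (R -> R) -> R) :
  (forall n, measurable_fun setT (X n)) -> (forall n, measurable_fun setT (Y n)) ->
  (forall eps : R, 0 < eps ->
    fine (P [set w | eps < `|Y n w|]) @[n --> \oo] --> (0 : R)) ->
  lipschitz_tests X Q -> lipschitz_tests (fun n w => X n w + Y n w) Q.
Proof.
move=> mX mY Y0 hX phi C Lip mphi phiC phiL.
have Lip0 : 0 <= Lip.
  by have := phiL 1 0; rewrite subr0 normr1 mulr1; apply: le_trans.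
have C0 : 0 <= C by exact: le_trans (phiC 0).
apply/cvgrPdist_le => eps eps0.
pose del := eps / 4 / (Lip + 1).
have L1 : 0 < Lip + 1 by rewrite ltr_wpDl.
have del0 : 0 < del by rewrite !divr_gt0.
have e4 : 0 < eps / 4 / (2 * C + 1) by rewrite !divr_gt0// ltr_wpDl// mulr_ge0.
have /cvgrPdist_le/(_ _ e4) hY := Y0 _ del0.
have e2 : 0 < eps / 2 by rewrite divr_gt0.
have /cvgrPdist_le/(_ _ e2) hXn := hX _ _ _ mphi phiC phiL.
near=> n.
have mXY : measurable_fun setT (fun w => X n w + Y n w) by exact: measurable_funD.
have i1 : intg (fun w => phi (X n w)).
  by apply: (intg_bounded P (c := C)) => //; exact: (measurableT_comp mphi (mX n)).
have i2 : intg (fun w => phi (X n w + Y n w)).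
  by apply: (intg_bounded P (c := C)) => //; exact: (measurableT_comp mphi mXY).
have mA : measurable [set w | del < `|Y n w|].
  apply: measurable_set_lt => //.
  exact: measurableT_comp.
have iA : intg (\1_[set w | del < `|Y n w|]).
  by have := intg_indic (intg_cst P 1) mA; under eq_fun do rewrite mul1r.
have PA : fine (P [set w | del < `|Y n w|]) <= eps / 4 / (2 * C + 1).
  have : `|0 - fine (P [set w | del < `|Y n w|])| <= eps / 4 / (2 * C + 1) by near: n.
  by rewrite sub0r normrN ger0_norm// fineP_ge0.
have b1 : `|E (fun w => phi (X n w)) - E (fun w => phi (X n w + Y n w))| <=
    Lip * del + 2 * C * fine (P [set w | del < `|Y n w|]).
  rewrite -(EB i1 i2) -(E_indic P mA) -(EZ _ iA) -(E_cst P (Lip * del)).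
  rewrite -(ED (intg_cst P _) (intgZ _ iA)).
  apply: normr_E_le; first by apply: intg_measurable (intgB i1 i2).
    by apply: intgD; [exact: intg_cst|exact: intgZ].
  move=> w; rewrite indicE /=; case: (boolP (w \in _)) => [_|/negP wA].
    rewrite mulr1; apply: (le_trans (ler_normB _ _)).
    have := mulr_ge0 Lip0 (ltW del0); have := phiC (X n w); have := phiC (X n w + Y n w); lra.
  rewrite mulr0 addr0; apply: (le_trans (phiL _ _)); apply: ler_wpM2l => //.
  rewrite opprD addrA subrr sub0r normrN leNgt; apply/negP => h; apply: wA.
  exact: mem_set.
have b2 : Lip * del <= eps / 4.
  rewrite /del mulrCA; apply: ler_piMr; first by rewrite divr_ge0// ltW.
  by rewrite ler_pdivrMr// mul1r lerDl.
have b3 : 2 * C * fine (P [set w | del < `|Y n w|]) <= eps / 4.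
  have C2 : 0 <= 2 * C by rewrite mulr_ge0.
  apply: (le_trans (ler_wpM2l C2 PA)).
  rewrite mulrCA; apply: ler_piMr; first by rewrite divr_ge0// ltW.
  by rewrite ler_pdivrMr ?mul1r ?lerDl// ltr_wpDl.
have b4 : `|Q phi - E (fun w => phi (X n w))| <= eps / 2 by near: n.
set a := E _ in b1 b4; set b := E _ in b1 *.
have -> : Q phi - b = (Q phi - a) + (a - b) by ring.
apply: (le_trans (ler_normD _ _)); lra.
Unshelve. all: by end_near.
Qed.

(** The integral is reached through the Radon-Nikodym derivative of [normal_prob], identified almost
    everywhere with the explicit density because both have the same integral over every measurable
    set. *)
Lemma integral_normal_prob (v : R) (phi : R -> R) (C : R) : 0 < v ->
  measurable_fun setT phi -> (forall x, `|phi x| <= C) ->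
  Rintegral (normal_prob 0 (Num.sqrt v)) setT phi =
  Rintegral (@lebesgue_measure R) setT (fun a => phi a * gdens v a).
Proof.
move=> v0 mphi phiC; rewrite /Rintegral; congr fine.
pose nu := [the probability (measurableTypeR R) R of normal_prob (0 : R) (Num.sqrt v)].
pose leb := [the {sigma_finite_measure set (measurableTypeR R) -> \bar R} of @lebesgue_measure R].
pose pdf (a : R) : \bar R := (normal_pdf 0 (Num.sqrt v) a)%:E.
pose D := Radon_Nikodym (charge_of_finite_measure nu) leb.
have dom : nu `<< leb by exact: normal_prob_dominates.
have iphi : nu.-integrable setT (EFin \o phi) by exact: (intg_bounded nu mphi phiC).
have iD : leb.-integrable setT D by exact: Radon_Nikodym_integrable.
have ipdf : leb.-integrable setT pdf by exact: integrable_normal_pdf.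
have eD : ae_eq leb setT D pdf.
  apply: integral_ae_eq => //; first exact: measurable_int ipdf.
  by move=> A _ mA; rewrite -Radon_Nikodym_integral.
rewrite -(Radon_Nikodym_change_of_variables (nu := nu) (mu := leb) dom measurableT iphi).
have mphiE : measurable_fun setT (EFin \o phi) by exact/measurable_EFinP.
transitivity (\int[leb]_x ((phi x)%:E * pdf x))%E.
  apply: ae_eq_integral => //.
  - by apply: emeasurable_funM => //; exact: measurable_int iD.
  - by apply: emeasurable_funM => //; exact: measurable_int ipdf.
  - by apply: ae_eqe_mul2l.
by apply: eq_integral => a _; rewrite /pdf -(gdens_normal 0 a v0) sub0r gdensN EFinM.
Qed.

End weak_convergence.

(** * Quenched limits along random times *)

Section union_bounds.
Context d (Omega : measurableType d) (R : realType) (P : probability Omega R).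

Lemma fineP_setU (A B : set Omega) : measurable A -> measurable B ->
  fine (P (A `|` B)) <= fine (P A) + fine (P B).
Proof.
move=> mA mB; rewrite -lee_fin EFinD -!PE//; last exact: measurableU.
exact: measureU2.
Qed.

Lemma le_fineP_ae (A B : set Omega) : measurable A -> measurable B ->
  {ae P, forall w, A w -> B w} -> fine (P A) <= fine (P B).
Proof.
move=> mA mB [N [mN PN sub]].
apply: (@le_trans _ _ (fine (P (B `|` N)))); last by rewrite measureU0.
apply: le_fineP => //; first exact: measurableU.
move=> w Aw; have [Bw|nB] := pselect (B w); [by left|right; apply: sub].
by move=> h; apply/nB/h.
Qed.

Definition union_of (I : eqType) (s : seq I) (A : I -> set Omega) : set Omega :=
  [set w | exists2 i, i \in s & A i w].

Lemma union_of_cons (I : eqType) (i : I) s A :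
  union_of (i :: s) A = A i `|` union_of s A.
Proof.
apply/seteqP; split => w.
  by move=> [j]; rewrite inE => /orP[/eqP ->|js] Aj; [left|right; exists j].
move=> [Ai|[j js Aj]]; first by exists i; rewrite ?inE ?eqxx.
by exists j; rewrite ?inE ?js ?orbT.
Qed.

Lemma union_of_nil (I : eqType) (A : I -> set Omega) : union_of [::] A = set0.
Proof. by apply/seteqP; split => w // []. Qed.

Lemma union_of_measurable (I : eqType) (s : seq I) A :
  (forall i, i \in s -> measurable (A i)) -> measurable (union_of s A).
Proof.
elim: s => [|i s IHs] mA; first by rewrite union_of_nil.
rewrite union_of_cons; apply: measurableU; first by apply: mA; rewrite inE eqxx.
by apply: IHs => j js; apply: mA; rewrite inE js orbT.
Qed.

Lemma union_of_prob (I : eqType) (s : seq I) (A : I -> set Omega) (p : I -> R) :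
  (forall i, i \in s -> measurable (A i)) ->
  (forall i, i \in s -> fine (P (A i)) <= p i) ->
  fine (P (union_of s A)) <= \sum_(i <- s) p i.
Proof.
elim: s => [|i s IHs] mA pA; first by rewrite union_of_nil measure0 big_nil.
have si j : j \in s -> j \in i :: s by rewrite inE => ->; rewrite orbT.
have ii : i \in i :: s by rewrite inE eqxx.
rewrite union_of_cons big_cons; apply: (le_trans (fineP_setU _ _)).
- exact: mA.
- by apply: union_of_measurable => j /si; exact: mA.
- apply: lerD; first exact: pA.
  by apply: IHs => j /si; [exact: mA|exact: pA].
Qed.

End union_bounds.

(** A positive quotient [q] satisfies [q + 1 <= 2 q], so rounding down loses at most a factor 2. *)
Lemma divn_window (p m : nat) : (0 < p)%N -> (2 * p <= m)%N ->
  (m <= 4 * p * (m %/ (2 * p)))%N /\ (2 * p * (m %/ (2 * p)) <= m)%N.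
Proof.
move=> p0 pm; have d0 : (0 < 2 * p)%N by rewrite muln_gt0.
have h1 := ltn_ceil m d0; have h2 := leq_trunc_div m (2 * p).
have q1 : (0 < m %/ (2 * p))%N by rewrite divn_gt0.
move: (m %/ (2 * p))%N h1 h2 q1 => q h1 h2 q1; split; last by rewrite mulnC.
apply: (leq_trans (ltnW h1)).
have -> : (4 * p * q = (q + q) * (2 * p))%N by ring.
by rewrite leq_mul2r; apply/orP; right; lia.
Qed.

(** Otherwise the increasing partial sums of the harmonic series would be bounded. *)
Lemma harmonic_tail (R : realType) (a : nat) (c : R) :
  exists2 b : nat, (a < b)%N & c <= \sum_(a <= k < b) (k%:R)^-1.
Proof.
apply: contrapT => nb; apply: (@dvg_harmonic R).
apply: nondecreasing_is_cvgn.
  apply/nondecreasing_seqP => n; rewrite /series /= big_nat_recr//= lerDl.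
  by rewrite invr_ge0.
exists (\sum_(0 <= k < a) (k.+1%:R)^-1 + `|c|) => _ [n _ <-].
have : \sum_(0 <= k < a) (k.+1%:R)^-1 + 0 <= \sum_(0 <= k < a) (k.+1%:R)^-1 + `|c| by rewrite lerD2l.
rewrite addr0 => h.
have [na|an] := leqP n a.
  apply: le_trans h; rewrite /series /= (@big_cat_nat _ _ _ n 0 a)//= lerDl.
  by apply: sumr_ge0 => i _; rewrite invr_ge0.
rewrite /series /= (@big_cat_nat _ _ _ a)//=; last exact: ltnW.
rewrite lerD2l; apply: le_trans (ler_norm c).
rewrite leNgt; apply/negP => hc; apply: nb; exists n.+1; first exact: leqW.
apply: (le_trans (ltW hc)).
have -> : \sum_(a <= k < n) harmonic k = \sum_(a.+1 <= k < n.+1) (k%:R)^-1 :> R.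
  by rewrite big_add1.
rewrite [leRHS]big_ltn; last by rewrite ltnS ltnW.
by rewrite lerDr invr_ge0.
Qed.

Section tail_test.
Context (R : realType).

(** A continuous function between the indicators of [b + 1 <= |x|] and [b <= |x|], on which weak
    convergence can be tested. *)
Definition tail_test (b x : R) : R := Num.min 1 (Num.max 0 (`|x| - b)).

Lemma tail_test_lipschitz b x y : `|tail_test b x - tail_test b y| <= `|x - y|.
Proof.
have : `| `|x| - `|y| | <= `|x - y| by exact: ler_dist_dist.
rewrite /tail_test; move: (`|x|) (`|y|) (`|x - y|) => u v z.
rewrite ler_norml => /andP[h1 h2]; rewrite ler_norml /Num.min /Num.max.
by case: ifPn; case: ifPn; case: ifPn; case: ifPn; rewrite -?leNgt; lra.
Qed.

Lemma tail_test_cont b : continuous (tail_test b).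
Proof.
move=> x; apply/cvgrPdist_le => eps eps0; near=> y.
apply: (le_trans (tail_test_lipschitz _ _ _)).
by near: y; exact: cvgr_dist_le.
Unshelve. all: by end_near.
Qed.

Lemma tail_test01 b x : 0 <= tail_test b x <= 1.
Proof. by rewrite /tail_test ge_min lexx /= le_min ler01 le_max lexx. Qed.

Lemma le_tail_test b x : b + 1 <= `|x| -> tail_test b x = 1.
Proof.
move=> h; rewrite /tail_test; have h1 : 1 <= `|x| - b by lra.
by rewrite max_r ?min_l// (le_trans ler01).
Qed.

Lemma tail_test_le b x : ~ b <= `|x| -> tail_test b x = 0.
Proof.
move=> /negP; rewrite -ltNge => h; rewrite /tail_test max_l; last by lra.
by rewrite min_r.
Qed.

End tail_test.

(** * Tightness along random times forced by a quenched limit *)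

Section quenched.
Context d (Omega : measurableType d) (R : realType) (P : probability Omega R).

Lemma sum_fineP_trivIset (A : nat -> set Omega) (B : set Omega) (N : nat) :
  (forall i, measurable (A i)) -> measurable B -> trivIset setT A ->
  \sum_(i < N) fine (P (A i `&` B)) <= fine (P B).
Proof.
move=> mA mB tA; have mAB i : measurable (A i `&` B) by exact: measurableI.
have tAB := trivIset_setIr (G := fun=> B) tA.
rewrite -lee_fin -sumEFin.
apply: (@le_trans _ _ (P (\big[setU/set0]_(i < N) (A i `&` B)))).
  rewrite (measure_bigsetU P mAB tAB) le_eqVlt; apply/orP; left; apply/eqP.
  by apply: eq_bigr => i _; rewrite -PE.
rewrite -PE//; apply: le_measure; rewrite ?inE//; first exact: bigsetU_measurable.
by rewrite -(bigcup_mkord _ (fun i => A i `&` B)); apply: bigcup_sub => i _ w [].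
Qed.

Variables (G : set (set Omega)) (X : nat -> Omega -> R).
Hypothesis Gm : G `<=` measurable.
Hypothesis mX : forall n, measurable_fun setT (X n).
Variable K : nat -> R.-pker (g_sigma_algebraType G) ~> measurableTypeR R.
Hypothesis KX : forall n, is_reg_cond_distr P (X n) (K n).
Variable Q : probability (measurableTypeR R) R.
Hypothesis KQ : {ae P, forall w, weak_cvg (fun n => K n w) Q}.

Lemma tail_measurable (b : R) : measurable ([set x | b <= `|x|] : set (measurableTypeR R)).
Proof.
rewrite -[X in measurable X]setTI; exact: measurable_fun_ler.
Qed.

Lemma integral_tail (nu : {measure set (measurableTypeR R) -> \bar R}) (b : R) :
  (\int[nu]_x (\1_[set x | (b <= `|x|)%R] x)%:E = nu [set x | (b <= `|x|)%R])%E.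
Proof. by rewrite integral_indic ?setIT//; exact: tail_measurable. Qed.

(** Because [Q] does not depend on [w], one [b] works for almost every [w]; only the rank [N]
    varies. A tail of mass 1/8 under [Q] leaves strict room below 1/4. *)
Lemma quenched_tail : exists b : R, {ae P, forall w, exists N : nat, forall n, (N <= n)%N ->
  (K n w [set x | (b <= `|x|)%R] <= (4^-1)%:E)%E}.
Proof.
have [b hb] : exists b : nat, (Q [set x | (b%:R <= `|x|)%R] <= (8^-1)%:E)%E.
  pose F (b : nat) : set (measurableTypeR R) := [set x | b%:R <= `|x|].
  have mF b : measurable (F b) by exact: tail_measurable.
  have F0 : \bigcap_n F n = set0.
    apply/seteqP; split => // x /= h.
    have := h (Num.truncn `|x|).+1 I; rewrite /F /= leNgt => /negP; apply.
    exact: truncnS_gt.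
  have nF : {homo F : n m / (n <= m)%N >-> (m <= n)%O}.
    by move=> n m nm; apply/subsetPset => x; apply: le_trans; rewrite ler_nat.
  have Ffin : (Q (F 0%N) < +oo)%E by rewrite ltey_eq fin_num_measure.
  have mI : measurable (\bigcap_n F n) by rewrite F0.
  have := nonincreasing_cvg_mu Ffin mF mI nF.
  rewrite F0 measure0 => cv.
  have h : nbhs (0 : \bar R) [set y : \bar R | (y < (8^-1)%:E)%E].
    by apply: open_ereal_lt'; rewrite lte_fin invr_gt0.
  have [b _ hb] := cv _ h; exists b; apply: ltW; exact: (hb b (leqnn _)).
exists (b%:R + 1); apply: (@filterS _ _ (ae_filter_ringOfSetsType P) _ _ _ KQ) => w cvw.
pose phi := @tail_test R b%:R.
have phiC : exists C : R, forall x, `|phi x| <= C.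
  exists 1 => x; have /andP[h0 h1] := tail_test01 b%:R x.
  by rewrite ger0_norm.
have mphi : measurable_fun setT (phi : measurableTypeR R -> R).
  by apply: continuous_measurable_fun; exact: tail_test_cont.
have cv := cvw phi (@tail_test_cont _ _) phiC.
have phi0 x : (0 <= (phi x)%:E)%E by rewrite lee_fin; have /andP[] := tail_test01 b%:R x.
have IQ : (\int[Q]_x (phi x)%:E < (4^-1)%:E)%E.
  apply: (@le_lt_trans _ _ (8^-1)%:E); last by rewrite lte_fin ltf_pV2 ?posrE// ltr_nat.
  apply: le_trans hb; rewrite -(integral_tail Q).
  apply: ge0_le_integral => //.
  - exact/measurable_EFinP.
  - by apply/measurable_EFinP; apply: measurable_indic; exact: tail_measurable.
  - move=> x _; rewrite lee_fin indicE.
    have [h|h] := pselect (b%:R <= `|x|).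
      by rewrite mem_set//; have /andP[] := tail_test01 b%:R x.
    by rewrite memNset// /phi tail_test_le.
have [N _ hN] := cv _ (open_ereal_lt' IQ).
exists N => n Nn; apply: le_trans (ltW (hN n Nn)).
rewrite -(integral_tail (K n w)).
apply: ge0_le_integral => //.
- by apply/measurable_EFinP; apply: measurable_indic; exact: tail_measurable.
- exact/measurable_EFinP.
- move=> x _; rewrite lee_fin indicE.
  have [h|h] := pselect (b%:R + 1 <= `|x|).
    by rewrite mem_set// /phi le_tail_test.
  by rewrite memNset//; have /andP[] := tail_test01 b%:R x.
Qed.

(** Outside an event [V n0] of probability at most 1/4, all kernels of index at least [n0] have tail
    at most 1/4. Integrating a kernel over [A i], a set of the conditioning sigma-algebra, gives
    exactly the probability in the sum, so the total is at most 1/4 + 1/4. *)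
Lemma quenched_random_time : exists (b : R) (n0 : nat),
  forall (N : nat) (A : nat -> set Omega) (t : nat -> nat),
    (forall i, <<s G >> (A i)) -> trivIset setT A -> (forall i, (n0 <= t i)%N) ->
    \sum_(i < N) fine (P (A i `&` [set w | b <= `|X (t i) w|])) <= 2^-1.
Proof.
have [b hb] := quenched_tail.
pose D : set (measurableTypeR R) := [set x | b <= `|x|].
have mD : measurable D by exact: tail_measurable.
have mK n : measurable_fun (setT : set Omega) (fun w : Omega => K n w D).
  move=> _ B mB; rewrite setTI; apply: (sigma_sub_measurable Gm).
  by have := measurable_kernel (K n) D mD measurableT B mB; rewrite setTI.
pose V (n0 : nat) := \bigcup_(n in [set n | (n0 <= n)%N]) [set w : Omega | ((4^-1)%:E < K n w D)%E].
have mV n0 : measurable (V n0).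
  apply: bigcup_measurable => n _.
  rewrite -[X in measurable X]setTI; exact: emeasurable_fun_o_infty.
have mI : measurable (\bigcap_n V n) by exact: bigcap_measurable.
have nV : {homo V : n m / (n <= m)%N >-> (m <= n)%O}.
  by move=> n m nm; apply/subsetPset => w [k /= mk hk]; exists k => //=; exact: leq_trans mk.
have Vfin : (P (V 0%N) < +oo)%E by rewrite ltey_eq fin_num_measure.
have PI : P (\bigcap_n V n) = 0%E.
  apply: measure_negligible => //; move: hb => [Z [mZ PZ sub]].
  exists Z; split => // w Vw; apply: sub => -[N hN].
  by have [n /= Nn] := Vw N I; rewrite ltNge hN.
have [n0 hn0] : exists n0, fine (P (V n0)) <= 4^-1.
  have cv : (P \o V) n @[n --> \oo] --> 0%E.
    by rewrite -PI; exact: nonincreasing_cvg_mu.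
  have h : nbhs (0 : \bar R) [set y : \bar R | (y < (4^-1)%:E)%E].
    by apply: open_ereal_lt'; rewrite lte_fin invr_gt0.
  have [n0 _ hn0] := cv _ h; exists n0.
  by rewrite -lee_fin -PE//; apply: ltW; exact: (hn0 n0 (leqnn _)).
exists b, n0 => N A t sA tA n0t.
have mA i : measurable (A i) by apply: (sigma_sub_measurable Gm); exact: sA.
have each i : fine (P (A i `&` [set w | b <= `|X (t i) w|])) <=
    4^-1 * fine (P (A i)) + fine (P (A i `&` V n0)).
  have mXD : measurable (X (t i) @^-1` D).
    by have := mX (t i) measurableT mD; rewrite setTI.
  rewrite -lee_fin -PE; last exact: measurableI.
  rewrite -(KX (t i) (sA i) mD) EFinD EFinM -!PE//; last exact: measurableI.
  rewrite -(integral_cst P (mA i)) setIC -integral_indic// -ge0_integralD//.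
  - apply: ge0_le_integral => //.
    + by apply: measurable_funTS; exact: mK.
    + apply: emeasurable_funD => //.
      by apply/measurable_EFinP; apply: measurable_funTS; exact: measurable_indic.
    + move=> w _; rewrite indicE.
      have [h|h] := pselect (V n0 w).
        rewrite mem_set// -EFinD; apply: (@le_trans _ _ 1%:E).
          rewrite -(@prob_kernel _ _ _ _ _ (K (t i)) w); apply: le_measure; rewrite ?inE//.
        by rewrite lee_fin lerDr.
      rewrite memNset//= adde0 leNgt; apply/negP => h'; apply: h; by exists (t i); [exact: n0t|].
  - by move=> w _; rewrite lee_fin.
  - by apply/measurable_EFinP; apply: measurable_funTS; exact: measurable_indic.
apply: (@le_trans _ _ (\sum_(i < N) (4^-1 * fine (P (A i)) + fine (P (A i `&` V n0))))).
  by apply: ler_sum => i _; exact: each.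
rewrite big_split /= -mulr_sumr.
have h1 : \sum_(i < N) fine (P (A i)) <= 1.
  have := sum_fineP_trivIset N mA measurableT tA; under eq_bigr do rewrite setIT.
  by rewrite probability_setT.
have h2 := le_trans (sum_fineP_trivIset N mA (mV n0) tA) hn0.
lra.
Qed.

End quenched.

(** * The coboundary *)

(** Valid also for [n < l]: the two sums on the right then overlap and their common terms cancel. *)
Lemma telescope_shift (R : zmodType) (a : nat -> R) (l n : nat) :
  \sum_(1 <= i < n.+1) (a i - a (i + l)%N) =
  \sum_(1 <= i < l.+1) a i - \sum_(1 <= i < l.+1) a (i + n)%N.
Proof.
elim: n => [|n IHn].
  rewrite big_geq//; under [X in _ - X]eq_bigr do rewrite addn0.
  by rewrite subrr.
rewrite big_nat_recr//= IHn.
have : \sum_(1 <= i < l.+1) a (i + n.+1)%N + a n.+1 =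
       \sum_(1 <= i < l.+1) a (i + n)%N + a (n.+1 + l)%N.
  have -> : a (n.+1 + l)%N = a (l.+1 + n)%N by congr a; lia.
  rewrite -(@big_nat_recr _ _ _ l.+1 1 (fun i => a (i + n)%N))//=.
  rewrite [RHS]big_nat_recl// addrC; congr (_ + _).
  by apply: eq_bigr => i _; congr a; lia.
set x := \sum_(1 <= i < l.+1) a (i + n.+1)%N; set y := \sum_(1 <= i < l.+1) a (i + n)%N.
move=> h; rewrite -addrA; congr (_ + _).
have -> : x = y + a (n.+1 + l)%N - a n.+1 by rewrite -h addrK.
by rewrite opprB opprD addrCA.
Qed.

Section sqr_norm.
Context d (Omega : measurableType d) (R : realType) (P : probability Omega R).
Local Notation intg f := (P.-integrable setT (EFin \o f)).
Local Notation E f := (Rintegral P setT f).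

Lemma sqr_Lnorm (g : Omega -> R) : measurable_fun setT g ->
  (Lnorm P 2%:E (EFin \o g) < +oo)%E ->
  intg (fun w => g w ^+ 2) /\
  E (fun w => g w ^+ 2) = fine (Lnorm P 2%:E (EFin \o g)) ^+ 2.
Proof.
move=> mg Nfin.
have N0 : (0 <= Lnorm P 2%:E (EFin \o g))%E by exact: Lnorm_ge0.
have e1 : (\int[P]_w (g w ^+ 2)%:E = (fine (Lnorm P 2%:E (EFin \o g)) ^+ 2)%:E)%E.
  have h : (2 : R) != 0 by [].
  have := powR_Lnorm P (EFin \o g) h.
  have -> : (\int[P]_x (`|(EFin \o g) x| `^ 2) = \int[P]_w (g w ^+ 2)%:E)%E.
    by apply: eq_integral => w _; rewrite /= powR_mulrn// -normrX ger0_norm// sqr_ge0.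
  move=> <-; case: (Lnorm P 2%:E (EFin \o g)) N0 Nfin => // r r0 _.
  by rewrite /= powR_mulrn.
have ig : intg (fun w => g w ^+ 2).
  apply/integrableP; split; first exact/measurable_EFinP/measurable_funX.
  under eq_integral do rewrite /= ger0_norm ?sqr_ge0//.
  by rewrite e1 ltry.
by split=> //; apply: EFin_inj; rewrite -integral_E.
Qed.

(** From [|g| <= del + g^2 / del]. If [del] is at least the L2 norm, this bounds the L1 norm by
    [2 del]; if the second moment is 0, it bounds it by every [del]. *)
Lemma E_norm_le_sqr (g : Omega -> R) (del : R) : measurable_fun setT g ->
  intg (fun w => g w ^+ 2) -> 0 < del ->
  intg g /\ E (fun w => `|g w|) <= del + E (fun w => g w ^+ 2) / del.
Proof.
move=> mg ig del0; pose h w := del + del^-1 * g w ^+ 2.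
have ih : intg h by apply: intgD; [exact: intg_cst|exact: intgZ].
have gh w : `|g w| <= h w.
  rewrite /h -sqr_normr; set x := `|g w|; have x0 : 0 <= x by exact: normr_ge0.
  rewrite -(ler_pM2r del0).
  have -> : (del + del^-1 * x ^+ 2) * del = del ^+ 2 + x ^+ 2 by field; rewrite gt_eqF.
  have := sqr_ge0 (x - del); nra.
split; first exact: intg_le ih gh.
have -> : del + E (fun w => g w ^+ 2) / del = E h.
  by rewrite (ED (intg_cst P del) (intgZ _ ig)) E_cst (EZ _ ig) mulrC.
by apply: E_le => //; exact/intg_norm/(intg_le mg ih gh).
Qed.

End sqr_norm.

(** * The levels of the coboundary and their Birkhoff sums *)

Section construction.
Context (R : realType) (ell M : nat -> nat).
Hypotheses (ell1_gt0 : (0 < ell 1)%N)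
  (ell_incr : forall k : nat, (1 <= k)%N -> (ell k < ell k.+1)%N)
  (M0 : (M 0 = 1)%N) (M1_gt0 : (0 < M 1)%N)
  (M_incr : forall k : nat, (1 <= k)%N -> (M k < M k.+1)%N)
  (M_ell : forall k : nat, (1 <= k)%N -> (2 * ell k <= M k)%N).
Hypothesis summable_ell_M :
    (\sum_(1 <= k <oo)
        ((Num.sqrt (k%:R * (ell k)%:R))^-1
         + (ell k)%:R ^+ 2 * Num.sqrt ((M k.-1)%:R / (M k)%:R) : R)%:E
      < +oo)%E.

(** The second summand of the convergent series. It dominates [M k.-1 / M k] and [ell k / M k],
    hence the probabilities of early activity, and it measures the levels below [k] against
    [sqrt (M k)]. *)
Definition gap (k : nat) : R := (ell k)%:R ^+ 2 * Num.sqrt ((M k.-1)%:R / (M k)%:R).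

Lemma gap_ge0 k : 0 <= gap k.
Proof. by rewrite mulr_ge0 ?sqr_ge0 ?sqrtr_ge0. Qed.

Lemma ell_ge k : (1 <= k)%N -> (k <= ell k)%N.
Proof.
elim: k => // -[|k] IHk _; first exact: ell1_gt0.
by apply: leq_ltn_trans (ell_incr _) => //; exact: IHk.
Qed.

Lemma M_gt0 k : (0 < M k)%N.
Proof.
case: k => [|k]; first by rewrite M0.
apply: leq_trans (M_ell _) => //.
by rewrite muln_gt0 /=; apply: leq_trans (ell_ge _).
Qed.

Lemma ell_mono j k : (1 <= j)%N -> (j <= k)%N -> (ell j <= ell k)%N.
Proof.
move=> j1; elim: k => [|k IHk]; first by case: j j1.
rewrite leq_eqVlt => /orP[/eqP -> //|]; rewrite ltnS => jk.
by apply: (leq_trans (IHk jk)); apply/ltnW/ell_incr/(leq_trans j1 jk).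
Qed.

Lemma M_mono j k : (j <= k)%N -> (M j <= M k)%N.
Proof.
elim: k => [|k IHk]; first by rewrite leqn0 => /eqP ->.
rewrite leq_eqVlt => /orP[/eqP -> //|]; rewrite ltnS => jk.
apply: (leq_trans (IHk jk)); case: k {IHk jk} => [|k]; first by rewrite M0.
exact/ltnW/M_incr.
Qed.

Lemma M_ge k : (k <= M k)%N.
Proof.
case: k => [|k]; first by [].
apply: (leq_trans (ell_ge _)) => //; apply: (leq_trans _ (M_ell _)) => //.
by rewrite leq_pmull.
Qed.

Lemma gap_tail (eps : R) : 0 < eps -> exists a : nat, forall a' b : nat, (a <= a')%N ->
  \sum_(a' <= k < b) gap k <= eps.
Proof.
move=> eps0.
have g0 k : (0 <= (gap k.+1)%:E)%E by rewrite lee_fin gap_ge0.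
have fin : (\sum_(0 <= k <oo) (gap k.+1)%:E < +oo)%E.
  apply: le_lt_trans summable_ell_M.
  rewrite -(nneseries_addn 1 (f := fun k => _%:E)); last first.
    by move=> k; rewrite lee_fin addr_ge0 ?invr_ge0 ?sqrtr_ge0// mulr_ge0 ?sqr_ge0 ?sqrtr_ge0.
  apply: lee_nneseries => [k _ _ //|k _]; rewrite addn1 lee_fin /gap.
  by rewrite lerDr invr_ge0 sqrtr_ge0.
have := nneseries_tail_cvg (P := xpredT) fin (fun k _ => g0 k).
move=> /fine_cvgP[_ /cvgrPdist_le/(_ _ eps0)[N _ hN]].
exists N.+1 => a' b Na'.
have [ba|ab] := leqP b a'; first by rewrite big_geq// ltW.
case: a' Na' ab => // a' Na' ab; case: b ab => // b ab.
have := hN a' Na'; rewrite /= sub0r normrN => h.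
rewrite big_add1 /=; apply: le_trans h.
apply: le_trans (ler_norm _).
have afin : (\sum_(a' <= k <oo) (gap k.+1)%:E \is a fin_num)%E.
  rewrite ge0_fin_numE; last exact: nneseries_ge0.
  apply: le_lt_trans fin; rewrite [leRHS](nneseries_split 0 a')// add0n.
  by rewrite leeDr// sume_ge0.
rewrite -lee_fin fineK//= -sumEFin.
by apply: nneseries_lim_ge.
Qed.

Let natM_gt0 k : 0 < (M k)%:R :> R. Proof. by rewrite ltr0n M_gt0. Qed.

Lemma le_sqrt01 (x : R) : 0 <= x <= 1 -> x <= Num.sqrt x.
Proof.
move=> /andP[x0 x1]; rewrite -{1}[x]sqr_sqrtr// expr2 ler_piMr ?sqrtr_ge0//.
by rewrite -sqrtr1 ler_wsqrtr.
Qed.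

Lemma ratio_le_gap k : (1 <= k)%N -> (M k.-1)%:R / (M k)%:R <= gap k.
Proof.
move=> k1; apply: (@le_trans _ _ (Num.sqrt ((M k.-1)%:R / (M k)%:R))).
  apply: le_sqrt01; rewrite divr_ge0//= ler_pdivrMr// mul1r ler_nat.
  by apply: M_mono; exact: leq_pred.
rewrite ler_peMl ?sqrtr_ge0// expr_ge1// ler1n.
by apply: leq_trans (ell_ge k1).
Qed.

Lemma ell_div_M_le_gap k : (1 <= k)%N -> (ell k)%:R / (M k)%:R <= gap k.
Proof.
move=> k1; have l1 : 1 <= (ell k)%:R :> R by rewrite ler1n; apply: leq_trans (ell_ge k1).
apply: (@le_trans _ _ ((ell k)%:R ^+ 2 * (M k)%:R^-1)).
  by apply: ler_wpM2r; rewrite ?invr_ge0// expr2 ler_peMl// (le_trans _ l1).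
apply: ler_wpM2l; first exact: sqr_ge0.
have h : (M k)%:R^-1 <= (M k.-1)%:R / (M k)%:R :> R.
  by rewrite ler_peMl ?invr_ge0// ler1n M_gt0.
apply: (le_trans h); apply: le_sqrt01; rewrite divr_ge0//= ler_pdivrMr// mul1r ler_nat.
by apply: M_mono; exact: leq_pred.
Qed.

Context d (Omega : measurableType d) (P : probability Omega R).
Local Notation intg f := (P.-integrable setT (EFin \o f)).
Local Notation E f := (Rintegral P setT f).
Variables (T Tinv : Omega -> Omega).
Hypotheses (TK : cancel T Tinv) (TinvK : cancel Tinv T).
Hypothesis mTinv : measurable_fun setT Tinv.
Hypothesis T_pres : measure_preserving P T.
Variable e : nat -> Omega -> R.
Hypothesis me : forall k : nat, (1 <= k)%N -> measurable_fun setT (e k).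
Hypotheses (e_pos : forall k : nat, (1 <= k)%N ->
    P (e k @^-1` [set Num.sqrt (M k)%:R / (ell k)%:R])
    = ((2 * k%:R * (M k)%:R)^-1)%:E)
  (e_neg : forall k : nat, (1 <= k)%N ->
    P (e k @^-1` [set - (Num.sqrt (M k)%:R / (ell k)%:R)])
    = ((2 * k%:R * (M k)%:R)^-1)%:E)
  (e_zero : forall k : nat, (1 <= k)%N ->
    P (e k @^-1` [set 0]) = (1 - (k%:R * (M k)%:R)^-1)%:E).

Local Notation coord := (coordinate T Tinv e).
Definition jump (k : nat) : R := Num.sqrt (M k)%:R / (ell k)%:R.

Lemma jump_gt0 k : (1 <= k)%N -> 0 < jump k.
Proof.
move=> k1; rewrite divr_gt0 ?sqrtr_gt0// ltr0n.
exact: leq_trans (ell_ge k1).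
Qed.

(** The three-point laws of the [e k] turned into one pathwise statement for all times and levels,
    stable under [T]. *)
Definition regular (w : Omega) := forall (i : int) (k : nat), (1 <= k)%N ->
  coord (i, k) w = 0 \/ `|coord (i, k) w| = jump k.

Lemma preim_measurable k (B : set R) : (1 <= k)%N -> measurable B ->
  measurable (e k @^-1` B).
Proof. by move=> k1 mB; have := me k1 measurableT mB; rewrite setTI. Qed.

Lemma coord_nz_measurable (i : int) k : (1 <= k)%N -> measurable [set w | coord (i, k) w != 0].
Proof.
move=> k1; have := measurable_coord TK mTinv T_pres me (ik := (i, k)) k1.
move=> /(_ measurableT (~` [set 0])); rewrite setTI.
have -> : [set w | coord (i, k) w != 0] = coord (i, k) @^-1` (~` [set 0]).
  by apply/seteqP; split => w /eqP.
by apply; apply: measurableC; exact: measurable_set1.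
Qed.

Lemma coord_nz_prob (i : int) k : (1 <= k)%N ->
  fine (P [set w | coord (i, k) w != 0]) = (k%:R * (M k)%:R)^-1.
Proof.
move=> k1; have [_ hi] := mp_iterz TK mTinv T_pres i.
have m0 : measurable (e k @^-1` [set 0]) by apply: preim_measurable.
have -> : [set w | coord (i, k) w != 0] = iterz T Tinv i @^-1` (~` (e k @^-1` [set 0])).
  by apply/seteqP; split => w /eqP.
rewrite hi; last exact: measurableC.
rewrite probability_setC// e_zero//= ; ring.
Qed.

Lemma regular_ae : {ae P, forall w, regular w}.
Proof.
pose Q (ik : int * nat) w := coord ik w = 0 \/ `|coord ik w| = jump ik.2.
(* The countably many pairs are enumerated by [unpickle], so that the null sets can be collected
   over [nat]. *)
suff : {ae P, forall w, forall n : nat, if unpickle n is Some ik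
    then (1 <= (ik : int * nat).2)%N -> Q ik w else True}.
  apply: filterS => w h i k k1.
  by have := h (pickle (i, k)); rewrite pickleK; apply.
apply: ae_foralln => n; case: (unpickle n) => [[i k]|]; last exact: aeW.
have [k1|k1] := boolP (1 <= k)%N; last exact: aeW.
pose A := e k @^-1` [set 0]; pose B := e k @^-1` [set jump k]; pose C := e k @^-1` [set - jump k].
have mA : measurable A by exact: preim_measurable.
have mB : measurable B by exact: preim_measurable.
have mC : measurable C by exact: preim_measurable.
have j0 := jump_gt0 k1.
(* The three prescribed values are distinct since [jump k > 0], and their probabilities add up to
   1. *)
have PABC : P (A `|` B `|` C) = 1%E.
  rewrite measureU//; last 2 first.
    exact: measurableU.
    apply/seteqP; split => // w [[hA|hB] hC].
      have : - jump k = 0 by rewrite -hC hA.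
      by move=> h; exfalso; move: j0; lra.
    have : - jump k = jump k by rewrite -hC hB.
    by move=> h; exfalso; move: j0; lra.
  rewrite measureU//; last first.
    apply/seteqP; split => // w [hA hB].
    have : jump k = 0 by rewrite -hB hA.
    by move=> h; exfalso; move: j0; lra.
  transitivity ((1 - (k%:R * (M k)%:R)^-1 : R)%:E + ((2 * k%:R * (M k)%:R)^-1 : R)%:E +
      ((2 * k%:R * (M k)%:R)^-1 : R)%:E)%E.
    by congr (_ + _ + _)%E; [exact: e_zero|exact: e_pos|exact: e_neg].
  rewrite -!EFinD; congr EFin; field.
  by rewrite !pnatr_eq0 -!lt0n k1 M_gt0.
have [_ hi] := mp_iterz TK mTinv T_pres i.
have mABC : measurable (A `|` B `|` C).
  by apply: measurableU => //; exact: measurableU.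
exists (iterz T Tinv i @^-1` (~` (A `|` B `|` C))); split.
- have [mi _] := mp_iterz TK mTinv T_pres i.
  rewrite -[X in measurable X]setTI; apply: mi => //; exact: measurableC.
- apply: (etrans (hi _ (measurableC mABC))).
  by rewrite probability_setC// PABC subee.
- move=> w /= nQ [[h|h]|h]; apply: nQ => _; rewrite /Q /coord /koopman /=.
  + by left.
  + by right; rewrite h gtr0_norm.
  + by right; rewrite h normrN gtr0_norm.
Qed.

(** The sum of [U^(i - N_k) h_k] over [1 <= i <= ell k], which telescoping leaves over. The
    coordinate at time [s - N_k], with [0 < s < 2 ell k], enters with a triangular weight, equal to
    [ell k] at the centre [s = ell k]. *)
Definition bump (k : nat) (w : Omega) : R :=
  \sum_(1 <= i < (ell k).+1) \sum_(0 <= j < ell k)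
    coord ((i + j)%:Z - (partial_shift M k)%:Z, k) w.

Lemma coord_iter (n : nat) (i : int) k w :
  coord (i, k) (iter n T w) = coord (i + n%:Z, k) w.
Proof. by rewrite /coordinate /koopman /= -[iter n T w]/(iterz T Tinv n%:Z w) (iterzD TK TinvK). Qed.

Lemma birkhoff_coboundary k n w :
  birkhoff_sum T Tinv (koopman T Tinv (- (partial_shift M k)%:Z)
    (coboundary T Tinv ell e k)) n w = bump k w - bump k (iter n T w).
Proof.
pose N := (partial_shift M k)%:Z.
pose b (t : nat) := \sum_(0 <= j < ell k) coord ((t + j)%:Z - N, k) w.
have blockE (t : nat) : koopman T Tinv (t%:Z - N) (block T Tinv ell e k) w = b t.
  rewrite /koopman /block /=; apply: eq_bigr => j _.
  rewrite /coordinate /koopman /=.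
  rewrite -[iter j T _]/(iterz T Tinv j%:Z _) -(iterzD TK TinvK); congr (e k (iterz _ _ _ w)).
  by rewrite PoszD; ring.
rewrite /birkhoff_sum.
rewrite (eq_bigr (fun i : nat => b i - b (i + ell k)%N)); last first.
  move=> i _; rewrite (koopmanD TK TinvK) addrC -!blockE [LHS]/koopman /= /coboundary.
  congr (_ - _); rewrite /koopman /= -[iter _ T _]/(iterz T Tinv (ell k)%:Z _) -(iterzD TK TinvK); congr (block _ _ _ _ _ (iterz _ _ _ w)).
  by rewrite PoszD; ring.
rewrite telescope_shift; congr (_ - _).
rewrite /bump; apply: eq_bigr => i _; apply: eq_bigr => j _.
rewrite coord_iter; congr (coordinate _ _ _ (_, _) _).
by rewrite !PoszD -/N; ring.
Qed.

Lemma birkhoff_f_partial K n w : birkhoff_sum T Tinv (f_partial T Tinv ell M e K) n w =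
  \sum_(1 <= k < K.+1) (bump k w - bump k (iter n T w)).
Proof.
rewrite /birkhoff_sum /koopman /f_partial.
rewrite exchange_big_nat /=; apply: eq_bigr => k _.
by rewrite -birkhoff_coboundary.
Qed.

Definition active (k n : nat) : set Omega :=
  \big[setU/set0]_(t < n) [set w | coord (t.+1%:Z - (partial_shift M k)%:Z, k) w != 0].

Lemma activeP k n w : ~ active k n w -> forall t : nat, (0 < t <= n)%N ->
  coord (t%:Z - (partial_shift M k)%:Z, k) w = 0.
Proof.
rewrite /active -(bigcup_mkord _ (fun t : nat =>
  [set w | coord (t.+1%:Z - (partial_shift M k)%:Z, k) w != 0])) => nA [//|t] /andP[_ tn].
by apply/eqP/negPn/negP => h; apply: nA; exists t.
Qed.

Lemma active_measurable k n : (1 <= k)%N -> measurable (active k n).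
Proof.
move=> k1; apply: bigsetU_measurable => t _; exact: coord_nz_measurable.
Qed.

Lemma active_prob k n : (1 <= k)%N -> fine (P (active k n)) <= n%:R / (k%:R * (M k)%:R).
Proof.
move=> k1.
have mA t : measurable [set w | coord (t.+1%:Z - (partial_shift M k)%:Z, k) w != 0].
  exact: coord_nz_measurable.
rewrite -lee_fin -(PE P (active_measurable n k1)).
apply: (le_trans (Boole_inequality P (n := n) (fun t _ => mA t))).
rewrite le_eqVlt; apply/orP; left; apply/eqP.
transitivity (\sum_(t < n) ((k%:R * (M k)%:R)^-1 : R)%:E)%E.
  apply: eq_bigr => t _; rewrite -(coord_nz_prob (t.+1%:Z - (partial_shift M k)%:Z) k1).
  exact: (PE P (mA t)).
by rewrite sumEFin sumr_const card_ord -[_ *+ n]mulr_natr mulrC.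
Qed.

Lemma bump_eq0 k w : ~ active k (2 * ell k) w -> bump k w = 0.
Proof.
move=> nA; rewrite /bump big_nat_cond big1// => i /andP[/andP[i1 il] _].
rewrite big_nat_cond big1// => j /andP[/andP[_ jl] _].
by apply: (activeP nA); clear -i1 il jl; lia.
Qed.

Lemma bump_iter_eq0 k n w : ~ active k (n + 2 * ell k) w -> bump k (iter n T w) = 0.
Proof.
move=> nA; rewrite /bump big_nat_cond big1// => i /andP[/andP[i1 il] _].
rewrite big_nat_cond big1// => j /andP[/andP[_ jl] _].
rewrite coord_iter.
have -> : (i + j)%:Z - (partial_shift M k)%:Z + n%:Z =
  (i + j + n)%:Z - (partial_shift M k)%:Z by rewrite !PoszD; ring.
by apply: (activeP nA); clear -i1 il jl; lia.
Qed.

Lemma bump_le k w : (1 <= k)%N -> regular w ->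
  `|bump k w| <= (ell k)%:R * Num.sqrt (M k)%:R.
Proof.
move=> k1 rw; have l0 : (0 < ell k)%N by exact: leq_trans (ell_ge k1).
have c (i : int) : `|coord (i, k) w| <= jump k.
  by have [->|->//] := rw i k k1; rewrite normr0 ltW// jump_gt0.
apply: (le_trans (ler_norm_sum _ _ _)).
apply: (@le_trans _ _ (\sum_(1 <= i < (ell k).+1) (ell k)%:R * jump k)).
  apply: ler_sum => i _; apply: (le_trans (ler_norm_sum _ _ _)).
  apply: (@le_trans _ _ (\sum_(0 <= j < ell k) jump k)); first exact: ler_sum.
  by rewrite sumr_const_nat subn0 -[_ *+ ell k]mulr_natr mulrC.
rewrite sumr_const_nat subn1 -[_ *+ _]mulr_natr /jump le_eqVlt; apply/orP; left; apply/eqP.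
by field; rewrite pnatr_eq0 -lt0n.
Qed.

Lemma regular_iter n w : regular w -> regular (iter n T w).
Proof. by move=> rw i k k1; rewrite coord_iter; exact: rw. Qed.

Variable f : Omega -> R.
Hypothesis mf : measurable_fun setT f.
Hypothesis f_sum : Lnorm P 2%:E (EFin \o (f \- f_partial T Tinv ell M e n))
      @[n --> \oo] --> 0%E.

Local Notation fK K := (f_partial T Tinv ell M e K).
Local Notation S := (birkhoff_sum T Tinv).

Lemma measurable_koopman (i : int) (g : Omega -> R) :
  measurable_fun setT g -> measurable_fun setT (koopman T Tinv i g).
Proof.
by move=> mg; apply: measurableT_comp => //; have [] := mp_iterz TK mTinv T_pres i.
Qed.

Lemma measurable_birkhoff (g : Omega -> R) n :
  measurable_fun setT g -> measurable_fun setT (S g n).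
Proof. by move=> mg; apply: measurable_sum => i; exact: measurable_koopman. Qed.

Lemma measurable_f_partial K : measurable_fun setT (fK K).
Proof.
have -> : fK K = fun w => \sum_(0 <= k < K)
    koopman T Tinv (- (partial_shift M k.+1)%:Z) (coboundary T Tinv ell e k.+1) w.
  by apply/funext => w; rewrite /f_partial big_add1.
apply: measurable_sum => k; apply: measurable_koopman.
have mb : measurable_fun setT (block T Tinv ell e k.+1).
  by apply: measurable_sum => i; apply: measurable_koopman; exact: me.
by apply: measurable_funB => //; exact: measurable_koopman.
Qed.

Lemma E_birkhoff_le (g : Omega -> R) n : intg g ->
  E (fun w => `|S g n w|) <= n%:R * E (fun w => `|g w|).
Proof.
move=> ig; have iS : intg (S g n) by exact: (intg_birkhoff TK mTinv T_pres).
apply: (@le_trans _ _ (E (fun w => \sum_(1 <= i < n.+1) koopman T Tinv i%:Z (fun w => `|g w|) w))).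
  apply: E_le; [exact: intg_norm| |].
    by apply: intg_sum => i; exact: (intg_koopman TK mTinv T_pres i%:Z (intg_norm ig)).
  by move=> w; exact: ler_norm_sum.
have iN (i : nat) : intg (koopman T Tinv i%:Z (fun w => `|g w|)).
  exact: (intg_koopman TK mTinv T_pres i%:Z (intg_norm ig)).
rewrite (E_sum (index_iota 1 n.+1) iN).
rewrite (eq_bigr (fun=> E (fun w => `|g w|))); last first.
  by move=> i _; exact: (E_koopman TK mTinv T_pres i%:Z (intg_norm ig)).
by rewrite sumr_const_nat subn1 mulr_natl.
Qed.

(** Over a bounded horizon L2 convergence suffices: [E |S_n g|] is at most [n E |g|], and Markov's
    inequality concludes. [K0] depends on the horizon [N]. *)
Lemma birkhoff_approx (N : nat) (eps : R) : 0 < eps -> exists K0 : nat,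
  forall K n : nat, (K0 <= K)%N -> (n <= N)%N ->
  fine (P [set w | eps <= `|S f n w - S (fK K) n w|]) <= eps.
Proof.
move=> eps0.
(* Chosen so that [N.+1 * (2 * r) = eps ^+ 2]; Markov's inequality then divides by [eps]. *)
pose r : R := eps ^+ 2 / (2 * N.+1%:R).
have r0 : 0 < r by rewrite divr_gt0 ?exprn_gt0// mulr_gt0.
have hL : \forall K \near \oo, (Lnorm P 2%:E (EFin \o (f \- fK K)%R) < r%:E)%E.
  have h : nbhs (0 : \bar R) [set y : \bar R | (y < r%:E)%E].
    by apply: open_ereal_lt'; rewrite lte_fin.
  exact: f_sum h.
case: hL => K0 _ hK0; exists K0 => K n KK nN.
have {}hK0 := hK0 K KK; pose g := f \- fK K.
have mg : measurable_fun setT g by apply: measurable_funB => //; exact: measurable_f_partial.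
have Nfin : (Lnorm P 2%:E (EFin \o g) < +oo)%E by apply: lt_trans hK0 _; rewrite ltry.
have [ig2 Eg2] := sqr_Lnorm mg Nfin.
have [ig Eg] := E_norm_le_sqr mg ig2 r0.
have N0 : (0 <= Lnorm P 2%:E (EFin \o g))%E by exact: Lnorm_ge0.
have Eg2r : E (fun w => g w ^+ 2) <= r ^+ 2.
  rewrite Eg2 lerXn2r ?nnegrE ?fine_ge0 ?(ltW r0)//.
  rewrite -lee_fin fineK; first exact: ltW.
  by rewrite ge0_fin_numE.
have Egr : E (fun w => `|g w|) <= 2 * r.
  apply: (le_trans Eg); rewrite mulr_natl mulr2n lerD2l ler_pdivrMr//.
have -> : [set w | eps <= `|S f n w - S (fK K) n w|] = [set w | eps <= `|S g n w|].
  by apply/funext => w /=; rewrite /birkhoff_sum -sumrB.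
have iS : intg (S g n) by exact: (intg_birkhoff TK mTinv T_pres).
apply: (le_trans (markov_E eps0 iS)).
rewrite ler_pdivrMr// -expr2.
have h := E_birkhoff_le n ig.
apply: (le_trans h); apply: (@le_trans _ _ (N.+1%:R * (2 * r))).
  apply: ler_pM => //; first by apply: E_ge0.
  by rewrite ler_nat ltnW.
have z0 : N.+1%:R != 0 :> R by rewrite pnatr_eq0.
rewrite /r le_eqVlt; apply/orP; left; apply/eqP.
by move: (N.+1%:R) z0 => z z0; field.
Qed.

(** Three regimes. Levels below [k0] contribute at most the constant [Cst], lost against [sqrt n].
    Levels from [k0] to [K] vanish outside a small event, at time 0 and, by invariance, at time [n].
    What lies beyond [K], chosen after [n], is small in probability. *)
Lemma f_negligible (eps : R) : 0 < eps ->
  fine (P [set w | eps < `|S f n w / Num.sqrt n%:R|]) @[n --> \oo] --> (0 : R).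
Proof.
move=> eps0; apply/cvgrPdist_le => eta eta0.
(* Each level will cost [4 * gap k], so a tail of at most [eta / 8] leaves [eta / 2]. *)
have eta8 : 0 < eta / 8 by rewrite divr_gt0.
have [k0' hk0] := gap_tail eta8.
pose k0 := k0'.+1.
pose Cst : R := \sum_(1 <= k < k0) 2 * ((ell k)%:R * Num.sqrt (M k)%:R).
near=> n.
have n_gt0 : (0 < n)%N by near: n; exact: nbhs_infty_gt.
have sn0 : 0 < Num.sqrt n%:R :> R by rewrite sqrtr_gt0 ltr0n.
have hC : Cst + eps < eps * Num.sqrt n%:R.
  rewrite -ltr_pdivrMr//; apply: (le_lt_trans (ler_norm _)).
  by near: n; apply: (cvgr0_norm_lt _ (cvg_div_sqrt (Cst + eps))).
rewrite sub0r normrN ger0_norm ?fineP_ge0//.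
(* [del <= eps] serves the comparison with [Cst + eps], and [del <= eta / 2] the probability
   budget. *)
pose del := Num.min eps (eta / 2).
have del0 : 0 < del by rewrite lt_min eps0 divr_gt0.
have [K0 hK0] := birkhoff_approx n del0.
pose K := maxn K0 k0.
have {}hK0 := hK0 K n (leq_maxl _ _) (leqnn _).
pose A k : set Omega := active k (2 * ell k).
pose B k : set Omega := iter n T @^-1` (A k).
have [mTn PTn] := mp_iterz TK mTinv T_pres n%:Z.
have mA k : (k0 <= k)%N -> measurable (A k).
  move=> kk; apply: (active_measurable).
  exact: leq_trans kk.
have mB k : (k0 <= k)%N -> measurable (B k).
  move=> kk; rewrite -[X in measurable X]setTI; apply: mTn => //; exact: mA.
pose U := union_of (index_iota k0 K.+1) (fun k => A k `|` B k).
have mAB k : k \in index_iota k0 K.+1 -> measurable (A k `|` B k).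
  by rewrite mem_index_iota => /andP[kk _]; apply: measurableU; [exact: mA|exact: mB].
have mU : measurable U by exact: union_of_measurable.
have PU : fine (P U) <= eta / 2.
  apply: (@le_trans _ _ (\sum_(k <- index_iota k0 K.+1) 4 * gap k)).
    apply: union_of_prob => // k kin; move: (kin); rewrite mem_index_iota => /andP[kk _].
    have k1 : (1 <= k)%N by exact: leq_trans kk.
    apply: (le_trans (fineP_setU P (mA k kk) (mB k kk))).
    have -> : P (B k) = P (A k) by apply: PTn; exact: mA.
    have : fine (P (A k)) <= 2 * gap k.
      apply: (le_trans (active_prob _ k1)).
      apply: (@le_trans _ _ (2 * ((ell k)%:R / (M k)%:R))); last first.
        apply: ler_wpM2l => //; exact: (ell_div_M_le_gap k1).
      rewrite natrM -mulrA; apply: ler_wpM2l => //.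
      apply: ler_wpM2l => //; rewrite lef_pV2 ?posrE ?mulr_gt0 ?ltr0n ?(M_gt0)//.
      by rewrite ler_peMl// ler1n.
    move=> h; have -> : 4 * gap k = 2 * gap k + 2 * gap k by ring.
    exact: lerD.
  rewrite -mulr_sumr; have -> : eta / 2 = 4 * (eta / 8) by field.
  by apply: ler_wpM2l => //; apply: hk0.
pose D : set Omega := [set w | del <= `|S f n w - S (fK K) n w|].
have mSf : measurable_fun setT (S f n) by exact: measurable_birkhoff.
have mSK : measurable_fun setT (S (fK K) n) by apply/measurable_birkhoff/measurable_f_partial.
have mD : measurable D.
  apply: measurable_set_le => //.
  by apply: measurableT_comp => //; exact: measurable_funB.
have mL : measurable [set w | eps < `|S f n w / Num.sqrt n%:R|].
  apply: measurable_set_lt => //.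
  by apply: measurableT_comp => //; apply: measurable_funM.
have mDU : measurable (D `|` U) by exact: measurableU.
have -> : eta = eta / 2 + eta / 2 by field.
apply: (@le_trans _ _ (fine (P (D `|` U)))); last first.
  apply: (le_trans (fineP_setU P mD mU)); apply: lerD => //.
  by apply: (le_trans hK0); rewrite ge_min lexx orbT.
apply: le_fineP_ae => //.
have := regular_ae.
apply: filterS => w rw /= big.
apply: contrapT => /not_orP[nD nU].
have {}nD : `|S f n w - S (fK K) n w| < del by rewrite ltNge; apply/negP.
have zero k : (k0 <= k)%N -> (k < K.+1)%N -> bump k w - bump k (iter n T w) = 0.
  move=> kk kK; have kin : k \in index_iota k0 K.+1 by rewrite mem_index_iota kk.
  by rewrite !bump_eq0 ?subr0// => h; apply: nU; exists k => //; [right|left].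
have SK : `|S (fK K) n w| <= Cst.
  rewrite (birkhoff_f_partial) (@big_cat_nat _ _ _ k0)//=; last exact: (leqW (leq_maxr K0 k0)).
  rewrite [X in _ + X]big_nat_cond [X in _ + X]big1 ?addr0; last first.
    by move=> k /andP[/andP[kk kK] _]; exact: zero.
  apply: (le_trans (ler_norm_sum _ _ _)); rewrite /Cst big_nat_cond [leRHS]big_nat_cond.
  apply: ler_sum => k /andP[/andP[k1 _] _].
  have -> : 2 * ((ell k)%:R * Num.sqrt (M k)%:R) =
    (ell k)%:R * Num.sqrt (M k)%:R + (ell k)%:R * Num.sqrt (M k)%:R :> R by ring.
  apply: (le_trans (ler_normB _ _)); apply: lerD.
    exact: (bump_le).
  by apply: (bump_le) => //; exact: regular_iter.
move: big; rewrite normrM normfV (ger0_norm (ltW sn0)) ltr_pdivlMr// ltNge => /negP; apply.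
apply: le_trans (ltW hC).
have -> : S f n w = S (fK K) n w + (S f n w - S (fK K) n w) by ring.
apply: (le_trans (ler_normD _ _)); apply: lerD => //.
by apply: (le_trans (ltW nD)); rewrite ge_min lexx.
Unshelve. all: by end_near.
Qed.

(** * Spikes: large Birkhoff sums at times known to the past *)

Hypothesis e_indep : mutually_independent P coord_dom (coordinate T Tinv e).

Local Notation F0 := (past_gen T Tinv e 0).
Local Notation shift k := (partial_shift M k)%:Z.

Definition isolated (k n : nat) (w : Omega) : Prop :=
  forall s : nat, (0 < s < 2 * ell k)%N -> s != ell k ->
    coord ((n + s)%:Z - shift k, k) w = 0.

(** For each [i] exactly one [j], namely [ell k - i], reaches the central time; every other
    coordinate of the bump vanishes by isolation. *)
Lemma bump_spike k n w : (1 <= k)%N -> isolated k n w ->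
  bump k (iter n T w) = (ell k)%:R * coord ((n + ell k)%:Z - shift k, k) w.
Proof.
move=> k1 iso; have l0 : (0 < ell k)%N by exact: leq_trans (ell_ge k1).
rewrite /bump mulr_natl.
transitivity (\sum_(1 <= i < (ell k).+1) coord ((n + ell k)%:Z - shift k, k) w); last first.
  by rewrite sumr_const_nat subn1.
rewrite big_nat_cond [RHS]big_nat_cond; apply: eq_bigr => i /andP[/andP[i1 il] _].
have li : (ell k - i < ell k)%N by rewrite ltn_subrL l0 i1.
rewrite big_mkord (bigD1 (Ordinal li)) //= big1 ?addr0.
  rewrite (coord_iter); congr (coordinate _ _ _ (_, _) _).
  have -> : (i + (ell k - i) = ell k)%N by rewrite subnKC.
  by rewrite PoszD; ring.
move=> j jl; rewrite (coord_iter).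
have -> : (i + j)%:Z - shift k + n%:Z = (n + (i + j))%:Z - shift k by rewrite !PoszD; ring.
have jlt := ltn_ord j.
apply: iso; first by clear -i1 il jlt; lia.
apply: contraNneq jl => h; apply/eqP/val_inj => /=.
by rewrite -[LHS](addKn i) h.
Qed.

(** Level [k] contributes exactly [sqrt (M k)], the product of [jump k] and the weight [ell k].
    Levels above [k] vanish at both ends, because [n <= M k <= M j.-1]. The levels below, fewer than
    [ell k] in number, contribute at most [2 ell k sqrt (M k.-1)] each, altogether at most
    [2 gap k sqrt (M k)], which is at most half of the main term. *)
Lemma birkhoff_large K k n w : regular w -> (1 <= k)%N -> (k <= K)%N -> (n <= M k)%N ->
  gap k <= 4^-1 -> coord ((n + ell k)%:Z - shift k, k) w != 0 -> isolated k n w ->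
  (forall j, (k <= j)%N -> (j <= K)%N -> ~ active j (M j.-1 + 2 * ell j) w) ->
  Num.sqrt (M k)%:R / 2 <= `|S (fK K) n w|.
Proof.
move=> rw k1 kK nM gk nz iso quiet.
have sM0 : 0 < Num.sqrt (M k)%:R :> R.
  by rewrite sqrtr_gt0 ltr0n (M_gt0).
have l0 : 0 < (ell k)%:R :> R.
  by rewrite ltr0n; exact: leq_trans (ell_ge k1).
have bump0 j : (k <= j)%N -> (j <= K)%N -> bump j w = 0.
  move=> kj jK; apply: bump_eq0 => h; apply: (quiet j kj jK).
  move: h; rewrite /active -!(bigcup_mkord _ (fun t : nat =>
    [set w | coord (t.+1%:Z - shift j, j) w != 0])) => -[t /= tl h].
  by exists t => //=; apply: leq_trans tl (leq_addl _ _).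
have bumpT0 j : (k < j)%N -> (j <= K)%N -> bump j (iter n T w) = 0.
  move=> kj jK; apply: (bump_iter_eq0) => h; apply: (quiet j (ltnW kj) jK).
  move: h; rewrite /active -!(bigcup_mkord _ (fun t : nat =>
    [set w | coord (t.+1%:Z - shift j, j) w != 0])) => -[t /= tl h].
  exists t => //=; apply: leq_trans tl _; rewrite leq_add2r; apply: (leq_trans nM).
  by apply: (M_mono); case: j kj {jK h} => // j; rewrite ltnS.
rewrite (birkhoff_f_partial) (@big_cat_nat _ _ _ k)//=; last exact: leqW.
rewrite [X in _ + X]big_ltn ?ltnS// [X in _ + (_ + X)]big_nat_cond.
rewrite [X in _ + (_ + X)]big1 ?addr0; last first.
  by move=> j /andP[/andP[kj jK] _]; rewrite bump0 ?bumpT0 ?subrr// ltnW.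
rewrite bump0// sub0r bump_spike//.
set c := coord _ w; have cE : `|(ell k)%:R * c| = Num.sqrt (M k)%:R.
  rewrite normrM (ger0_norm (ltW l0)).
  have [c0|->] := rw ((n + ell k)%:Z - shift k) k k1; first by move: nz; rewrite /c c0 eqxx.
  by rewrite /jump mulrC divfK// gt_eqF.
set low := \sum_(1 <= j < k) _.
have lowE : `|low| <= Num.sqrt (M k)%:R / 2.
  apply: (le_trans (ler_norm_sum _ _ _)).
  pose z : R := 2 * (ell k)%:R * Num.sqrt (M k.-1)%:R.
  apply: (@le_trans _ _ (\sum_(1 <= j < k) z)).
    rewrite big_nat_cond [leRHS]big_nat_cond; apply: ler_sum => j /andP[/andP[j1 jk] _].
    have b x : regular x -> `|bump j x| <= (ell k)%:R * Num.sqrt (M k.-1)%:R.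
      move=> rx; apply: (le_trans (bump_le j1 rx)).
      apply: ler_pM; rewrite ?sqrtr_ge0//; first by rewrite ler_nat (ell_mono j1)// ltnW.
      rewrite ler_wsqrtr// ler_nat; apply: (M_mono).
      by case: k jk {k1 kK nM gk nz iso quiet sM0 l0 bump0 bumpT0 c cE low z} => // k; rewrite ltnS.
    have -> : z = (ell k)%:R * Num.sqrt (M k.-1)%:R + (ell k)%:R * Num.sqrt (M k.-1)%:R by rewrite /z; ring.
    apply: (le_trans (ler_normB _ _)); apply: lerD; first exact: b.
    by apply: b; exact: (regular_iter).
  rewrite sumr_const_nat -[_ *+ _]mulr_natl.
  have z0 : 0 <= z by rewrite !mulr_ge0 ?sqrtr_ge0.
  apply: (@le_trans _ _ ((ell k)%:R * z)).
    apply: ler_wpM2r => //; rewrite ler_nat; apply: (leq_trans (leq_subr _ _)).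
    exact: (ell_ge k1).
  have -> : (ell k)%:R * z = 2 * gap k * Num.sqrt (M k)%:R.
    rewrite /z /gap sqrtrM// sqrtrV// -[_^-1](mulr1 _).
    by field; rewrite gt_eqF.
  move: gk sM0; move: (gap k) (Num.sqrt (M k)%:R) => g x gk x0; nra.
rewrite distrC; apply: le_trans (lerB_dist _ _); rewrite cE; move: lowE; lra.
Qed.

Lemma pair_prob (i i' : int) k : (1 <= k)%N -> i != i' ->
  measurable ([set w | coord (i, k) w != 0] `&` [set w | coord (i', k) w != 0]) /\
  fine (P ([set w | coord (i, k) w != 0] `&` [set w | coord (i', k) w != 0])) =
    (k%:R * (M k)%:R)^-1 ^+ 2.
Proof.
move=> k1 ii'.
have mc (j : int) := coord_nz_measurable j k1.
split; first exact: measurableI.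
have mB : measurable (~` [set 0] : set (measurableTypeR R)).
  by apply: measurableC; exact: measurable_set1.
have E (j : int) : coord (j, k) @^-1` (~` [set 0]) = [set w | coord (j, k) w != 0].
  by apply/seteqP; split => w /eqP.
have := @e_indep [:: (i, k); (i', k)] (fun=> ~` [set 0]).
rewrite !big_cons big_nil mule1 (E i) (E i').
have -> : \bigcap_(ik in [set ik | ik \in [:: (i, k); (i', k)]]) (coord ik @^-1` (~` [set 0])) =
    [set w | coord (i, k) w != 0] `&` [set w | coord (i', k) w != 0].
  rewrite -(E i) -(E i'); apply/seteqP; split => w.
    by move=> h; split; apply: h; rewrite /= !inE eqxx ?orbT.
  by move=> [h h'] ik /=; rewrite !inE => /orP[] /eqP ->.
move=> ->; last 3 first.
- by rewrite /= inE andbT; apply: contraNneq ii' => -[->].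
- by move=> ik; rewrite !inE => /orP[] /eqP ->.
- by [].
by rewrite fineM ?fin_num_measure// !(coord_nz_prob _ k1) expr2.
Qed.

Lemma all_zero_prob (s : seq (int * nat)) : uniq s ->
  (forall ik, ik \in s -> (1 <= ik.2)%N) ->
  fine (P (~` union_of s (fun ik => [set w | coord ik w != 0]))) =
  \prod_(ik <- s) (1 - (ik.2%:R * (M ik.2)%:R)^-1).
Proof.
move=> us s1; pose B (_ : int * nat) : set (measurableTypeR R) := [set 0].
have mB ik : measurable (B ik) by exact: measurable_set1.
have -> : ~` union_of s (fun ik => [set w | coord ik w != 0]) =
  \bigcap_(ik in [set ik | ik \in s]) (coord ik @^-1` B ik).
  apply/seteqP; split => w.
    by move=> h ik /= iks; apply/eqP/negPn/negP => h'; apply: h; exists ik.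
  by move=> h [ik iks /=]; rewrite (h ik iks) eqxx.
rewrite (e_indep us s1 mB).
have step ik : ik \in s -> P (coord ik @^-1` B ik) = (1 - (ik.2%:R * (M ik.2)%:R)^-1)%:E.
  move=> /s1 k1; have [_ hi] := mp_iterz TK mTinv T_pres ik.1.
  apply: etrans (e_zero k1); apply: (hi (e ik.2 @^-1` [set 0])).
  by have := me k1 measurableT (mB ik); rewrite setTI.
rewrite big_seq_cond (eq_bigr (fun ik => (1 - (ik.2%:R * (M ik.2)%:R)^-1 : R)%:E)); last first.
  by move=> ik /andP[iks _]; exact: step.
by rewrite -big_seq_cond prodEFin.
Qed.

(** Index of the coordinate that carries the central weight [ell k] in [bump k] after [n] steps. *)
Definition spike (kn : nat * nat) : int * nat := ((kn.2 + ell kn.1)%:Z - shift kn.1, kn.1).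

Definition spike_set (kn : nat * nat) : set Omega := [set w | coord (spike kn) w != 0].

(** Intersecting with the spike makes each term a product of two small probabilities, so that the
    union over a window, with its order of [M k] times, stays small. *)
Definition crowded (kn : nat * nat) : set Omega :=
  union_of [seq s <- index_iota 1 (2 * ell kn.1) | s != ell kn.1]
    (fun s => [set w | coord ((kn.2 + s)%:Z - shift kn.1, kn.1) w != 0] `&` spike_set kn).

Lemma not_crowded kn w : spike_set kn w -> ~ crowded kn w -> isolated kn.1 kn.2 w.
Proof.
move=> sw nc s s1 sl; apply/eqP/negPn/negP => h; apply: nc.
by exists s => //; rewrite mem_filter sl mem_index_iota.
Qed.

Lemma crowded_prob kn : (1 <= kn.1)%N -> measurable (crowded kn) /\
  fine (P (crowded kn)) <= 2 * (ell kn.1)%:R * (kn.1%:R * (M kn.1)%:R)^-1 ^+ 2.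
Proof.
case: kn => k n /= k1.
have pp s : s != ell k ->
    measurable ([set w | coord ((n + s)%:Z - shift k, k) w != 0] `&` spike_set (k, n)) /\
    fine (P ([set w | coord ((n + s)%:Z - shift k, k) w != 0] `&` spike_set (k, n))) =
    (k%:R * (M k)%:R)^-1 ^+ 2.
  move=> sl; apply: (pair_prob k1).
  apply: contraNneq sl => /(congr1 (fun x => x + shift k)); rewrite !subrK => -[].
  by move/eqP; rewrite eqn_add2l.
split; first by apply: union_of_measurable => s; rewrite mem_filter => /andP[/pp[]].
apply: (@le_trans _ _ (\sum_(s <- [seq s <- index_iota 1 (2 * ell k) | s != ell k])
    (k%:R * (M k)%:R)^-1 ^+ 2)).
  apply: union_of_prob => s; rewrite mem_filter => /andP[/pp[//]].
  by move=> _ ->.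
rewrite big_const_seq count_predT iter_addr_0 -[_ *+ _]mulr_natl.
apply: ler_wpM2r; first exact: sqr_ge0.
rewrite -natrM ler_nat size_filter; apply: (leq_trans (count_size _ _)).
by rewrite size_iota leq_subr.
Qed.

(* The times [q < n <= 2 q] with [q = M k %/ (2 * p)], for the levels [a <= k < b];
   they are so small that [spike (k, n)] has a nonpositive time index. *)
Definition windows (p a b : nat) : seq (nat * nat) :=
  [seq (k, n) | k <- index_iota a b, n <- index_iota (M k %/ (2 * p)).+1 (2 * (M k %/ (2 * p))).+1].

Lemma mem_windows p a b k n : ((k, n) \in windows p a b) =
  [&& (a <= k)%N, (k < b)%N, (M k %/ (2 * p) < n)%N & (n <= 2 * (M k %/ (2 * p)))%N].
Proof.
apply/allpairsPdep/idP => [[k' [n' [kk nn [-> ->]]]]|/and4P[ak kb qn nq]].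
  by move: kk nn; rewrite !mem_index_iota => /andP[-> ->] /andP[-> ?].
by exists k, n; rewrite !mem_index_iota ak kb qn.
Qed.

Lemma windows_uniq p a b : uniq (windows p a b).
Proof.
apply: allpairs_uniq_dep.
- exact: iota_uniq.
- by move=> k _; exact: iota_uniq.
- by move=> [k n] [k' n'] _ _ /= [-> ->].
Qed.

Lemma sum_windows p a b (F : nat -> R) :
  \sum_(kn <- windows p a b) F kn.1 =
  \sum_(a <= k < b) (M k %/ (2 * p))%:R * F k.
Proof.
rewrite /windows big_allpairs_dep; apply: eq_bigr => k _ /=.
by rewrite sumr_const_nat subSS mul2n -addnn addnK mulr_natl.
Qed.

Lemma spike_inj : injective spike.
Proof.
move=> [k n] [k' n'] [/= h kk]; move: h; rewrite kk => /(congr1 (fun x => x + shift k')).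
by rewrite !subrK => -[] /eqP; rewrite eqn_add2r => /eqP ->.
Qed.

(** Distinct pairs [(k, n)] give distinct, hence independent, coordinates, and [1 - x <= expR (- x)]
    bounds the probability that no spike occurs. A window has at least [M k / (4 p)] times, each of
    probability [1 / (k M k)], whence the harmonic sum. *)
Lemma spike_union_prob p a b : (0 < p)%N -> (2 * p <= a)%N -> (1 <= a)%N ->
  1 - expR (- (\sum_(a <= k < b) (k%:R)^-1 / (4 * p%:R))) <=
  fine (P (union_of (windows p a b) spike_set)).
Proof.
move=> p0 pa a1.
have w1 kn : kn \in windows p a b -> (1 <= kn.1)%N.
  by case: kn => k n; rewrite mem_windows => /and4P[ak _ _ _]; exact: leq_trans ak.
have mU : measurable (union_of (windows p a b) spike_set).
  apply: union_of_measurable => kn /w1 k1.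
  exact: (coord_nz_measurable _ k1).
have -> : fine (P (union_of (windows p a b) spike_set)) =
    1 - fine (P (~` union_of (windows p a b) spike_set)).
  rewrite probability_setC// [in RHS](PE P mU) /=; ring.
rewrite lerD2l lerN2.
have -> : union_of (windows p a b) spike_set =
    union_of (map spike (windows p a b)) (fun ik => [set w | coord ik w != 0]).
  apply/seteqP; split => w.
    by move=> [kn kin h]; exists (spike kn) => //; exact: map_f.
  by move=> [ik /mapP[kn kin ->] h]; exists kn.
rewrite (all_zero_prob); last 2 first.
- by rewrite map_inj_uniq ?windows_uniq//; exact: spike_inj.
- by move=> ik /mapP[kn /w1 k1 ->].
rewrite big_map.
apply: (@le_trans _ _ (\prod_(kn <- windows p a b) expR (- (kn.1%:R * (M kn.1)%:R)^-1))).
  rewrite big_seq_cond [leRHS]big_seq_cond; apply: ler_prod => kn /andP[/w1 k1 _] /=.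
  rewrite expR_ge1Dx andbT subr_ge0 invf_le1 ?mulr_gt0 ?ltr0n ?(M_gt0)//.
  by rewrite -natrM ler1n muln_gt0 k1 (M_gt0).
rewrite -expR_sum ler_expR sumrN lerN2.
rewrite (sum_windows p a b (fun k => (k%:R * (M k)%:R)^-1)).
rewrite big_nat_cond [leRHS]big_nat_cond; apply: ler_sum => k /andP[/andP[ak kb] _].
have k1 : (1 <= k)%N by exact: leq_trans ak.
have pM : (2 * p <= M k)%N.
  by apply: (leq_trans (leq_trans pa ak)); exact: (M_ge).
have [h _] := divn_window p0 pM.
have kR : 0 < k%:R :> R by rewrite ltr0n.
have MR : 0 < (M k)%:R :> R by rewrite ltr0n (M_gt0).
have pR : 0 < p%:R :> R by rewrite ltr0n.
have hR : (M k)%:R <= 4 * p%:R * (M k %/ (2 * p))%:R :> R by rewrite -!natrM ler_nat.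
rewrite [(k%:R * (M k)%:R)^-1]invfM mulrCA; apply: ler_wpM2l; first by rewrite invr_ge0 ltW.
rewrite ler_pdivlMr//; rewrite mulrC ler_pdivrMr ?mulr_gt0//.
by rewrite mulrC.
Qed.

(** A spike occurs with probability at least 7/8. Outside a bad event of probability at most 1/8,
    the first spike in the list [L] fixes the time, and [birkhoff_large] gives the size of the sum
    there. *)
Lemma random_time_lower (s n0 : nat) : exists (n : nat) (A : nat -> set Omega) (t : nat -> nat),
  [/\ forall i, <<s F0 >> (A i), trivIset setT A, forall i, (n0 <= t i)%N /\ (0 < t i)%N &
    3 / 4 <= \sum_(i < n) fine (P (A i `&` [set w | s%:R * Num.sqrt (t i)%:R <= `|S f (t i) w|]))].
Proof.
(* [sqrt p = 2 (s + 1)], so half of [sqrt (M k)] is at least [(s + 1) sqrt n]; the surplus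
   [sqrt n >= 1] absorbs the truncation error. *)
pose p := (4 * s.+1 ^ 2)%N.
have p0 : (0 < p)%N by rewrite muln_gt0 expn_gt0.
have p4 : (4 <= p)%N by rewrite leq_pmulr// expn_gt0.
have e64 : 0 < 64^-1 :> R by rewrite invr_gt0.
have [a1 ha1] := gap_tail e64.
(* The first term places all windows beyond [n0] and ensures [2 * p <= M k]; [a1] makes the tail of
   [gap] small. *)
pose a := (4 * p * n0.+1 + a1)%N.
have aa1 : (a1 <= a)%N by exact: leq_addl.
have pa : (4 * p * n0.+1 <= a)%N by exact: leq_addr.
have p2a : (2 * p <= a)%N.
  apply: (leq_trans _ pa); rewrite -[X in (X <= _)%N]muln1; apply: leq_mul => //.
  by rewrite leq_mul2r orbT.
have a_gt0 : (1 <= a)%N by apply: leq_trans p2a; rewrite muln_gt0.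
(* Enough harmonic mass for an exponent of 3; [expR (- 3) <= 1/8] because [expR 1 >= 2]. *)
have [b ab hb] := harmonic_tail a (3 * (4 * p%:R) : R).
pose L := windows p a b; pose D := spike_set.
have wL k n : (k, n) \in L -> [/\ (a <= k)%N, (k < b)%N, (1 <= k)%N, (n0 <= n)%N && (0 < n)%N & (p * n <= M k)%N].
  rewrite mem_windows => /and4P[ak kb qn nq].
  have k1 : (1 <= k)%N by exact: leq_trans ak.
  have kM : (k <= M k)%N by exact: (M_ge).
  have pM : (2 * p <= M k)%N by exact: leq_trans (leq_trans p2a ak) kM.
  have [h1 h2] := divn_window p0 pM.
  split=> //; last first.
    apply: leq_trans h2; have -> : (2 * p * (M k %/ (2 * p)) = p * (2 * (M k %/ (2 * p))))%N by ring.
    by rewrite leq_mul2l nq orbT.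
  apply/andP; split; last exact: leq_trans qn.
  apply: (leq_trans _ (ltnW qn)).
  have p40 : (0 < 4 * p)%N by rewrite muln_gt0.
  rewrite -(leq_pmul2l p40); apply: leq_trans h1.
  apply: leq_trans kM; apply: leq_trans ak; apply: leq_trans pa.
  by rewrite leq_mul2l leqnSn orbT.
have mD kn : kn \in L -> measurable (D kn).
  case: kn => k n /wL[_ _ k1 _ _].
  exact: (coord_nz_measurable _ k1).
have sD kn : kn \in L -> <<s F0 >> (D kn).
  case: kn => k n /wL[_ _ k1 _ pn].
  apply: sub_sigma_algebra; exists (spike (k, n)).
    (* [4 n <= p n <= M k] and [2 ell k <= M k] give [n + ell k <= M k <= N_k]: the spike belongs to
       the past. *)
    split=> //=; rewrite subr_le0 lez_nat.
    have MN : (M k <= partial_shift M k)%N.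
      by rewrite /partial_shift big_nat_recr//= leq_addl.
    apply: (leq_trans _ MN).
    have h1 : (4 * n <= M k)%N by apply: leq_trans pn; rewrite leq_mul2r p4 orbT.
    have h2 := M_ell k1.
    by clear -h1 h2; lia.
  exists (~` [set 0]); first by apply: measurableC; exact: measurable_set1.
  by rewrite setTI; apply/seteqP; split => w /eqP.
have PD : 7 / 8 <= fine (P (union_of L D)).
  apply: le_trans (spike_union_prob b p0 p2a a_gt0).
  have h3 : expR (- (\sum_(a <= k < b) (k%:R)^-1 / (4 * p%:R))) <= 8^-1 :> R.
    have pR : 0 < 4 * p%:R :> R by rewrite mulr_gt0 ?ltr0n.
    apply: (@le_trans _ _ (expR (- 3))).
      by rewrite ler_expR lerN2 -mulr_suml ler_pdivlMr.
    rewrite expRN lef_pV2 ?posrE ?expR_gt0//.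
    have -> : (3 : R) = 1 + 1 + 1 by ring.
    have h := expR_ge1Dx (1 : R); rewrite !expRD; nra.
  move: h3; lra.
(* The bound 1 controls the truncation error itself; the other makes a union over [L] cost at most
   1/16. *)
pose eps := Num.min (1 : R) ((16 * (size L).+1%:R)^-1).
have eps0 : 0 < eps by rewrite lt_min ltr01 invr_gt0 mulr_gt0.
have [K0 hK0] := birkhoff_approx (M b) eps0.
pose K := maxn K0 b.
pose far n := [set w | eps <= `|S f n w - S (fK K) n w|].
have mSf n : measurable_fun setT (S f n) by exact: (measurable_birkhoff n mf).
have mSK n : measurable_fun setT (S (fK K) n).
  by apply: (measurable_birkhoff n); exact: (measurable_f_partial).
have mfar n : measurable (far n).
  apply: measurable_set_le => //.
  by apply: measurableT_comp => //; exact: measurable_funB.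
pose B1 := union_of (index_iota a K.+1) (fun j => active j (M j.-1 + 2 * ell j)).
pose B2 := union_of L crowded.
pose B3 := union_of L (fun kn => far kn.2).
have m1 j : j \in index_iota a K.+1 -> measurable (active j (M j.-1 + 2 * ell j)).
  rewrite mem_index_iota => /andP[aj _].
  by apply: (active_measurable); exact: leq_trans aj.
have m2 kn : kn \in L -> measurable (crowded kn).
  by case: kn => k n /wL[_ _ k1 _ _]; exact: (@crowded_prob (k, n) k1).1.
have mB1 : measurable B1 by exact: union_of_measurable.
have mB2 : measurable B2 by exact: union_of_measurable.
have mB3 : measurable B3 by apply: union_of_measurable => kn _.
have PB1 : fine (P B1) <= 3 / 64.
  apply: (@le_trans _ _ (\sum_(j <- index_iota a K.+1) 3 * gap j)).
    apply: union_of_prob => // j jin; move: (jin); rewrite mem_index_iota => /andP[aj _].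
    have j1 : (1 <= j)%N by exact: leq_trans aj.
    apply: (le_trans (active_prob _ j1)).
    have MR : 0 < (M j)%:R :> R by rewrite ltr0n (M_gt0).
    apply: (@le_trans _ _ ((M j.-1 + 2 * ell j)%N%:R / (M j)%:R)).
      have jR : 0 < j%:R :> R by rewrite ltr0n.
      apply: ler_wpM2l => //; rewrite lef_pV2 ?posrE ?mulr_gt0//.
      by rewrite ler_peMl ?ler1n// ltW.
    have g1 := ratio_le_gap j1.
    have g2 := ell_div_M_le_gap j1.
    rewrite natrD natrM mulrDl -mulrA; move: g1 g2; lra.
  rewrite -mulr_sumr; have := ha1 a K.+1 aa1; lra.
have PB2 : fine (P B2) <= 64^-1.
  apply: le_trans (ha1 a b aa1).
  apply: (@le_trans _ _ (\sum_(kn <- L) 2 * (ell kn.1)%:R * (kn.1%:R * (M kn.1)%:R)^-1 ^+ 2)).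
    apply: union_of_prob => // -[k n] /wL[_ _ k1 _ _].
    exact: (@crowded_prob (k, n) k1).2.
  rewrite (sum_windows p a b (fun k => 2 * (ell k)%:R * (k%:R * (M k)%:R)^-1 ^+ 2)).
  rewrite big_nat_cond [leRHS]big_nat_cond; apply: ler_sum => k /andP[/andP[ak kb] _].
  have k1 : (1 <= k)%N by exact: leq_trans ak.
  apply: le_trans (ell_div_M_le_gap k1).
  have MR : 0 < (M k)%:R :> R by rewrite ltr0n (M_gt0).
  have kR : 1 <= k%:R :> R by rewrite ler1n.
  have qR : 2 * (M k %/ (2 * p))%:R <= (M k)%:R :> R.
    rewrite -natrM ler_nat; apply: leq_trans (leq_trunc_div (M k) (2 * p)).
    by rewrite mulnC leq_mul2l leq_pmulr ?orbT.
  have lR : 0 <= (ell k)%:R :> R by [].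
  move: ((M k %/ (2 * p))%:R) qR => q qR.
  rewrite ler_pdivlMr// exprVn.
  have -> : q * (2 * (ell k)%:R * ((k%:R * (M k)%:R) ^+ 2)^-1) * (M k)%:R =
     (ell k)%:R * ((2 * q) / (M k)%:R / k%:R ^+ 2).
    by field; rewrite !gt_eqF// (lt_le_trans _ kR).
  rewrite ler_piMr// ler_pdivrMr ?exprn_gt0// ?(lt_le_trans _ kR)//.
  rewrite mul1r ler_pdivrMr//; apply: (le_trans qR).
  by apply: ler_peMl; [exact: ltW|rewrite expr_ge1].
have PB3 : fine (P B3) <= 16^-1.
  apply: (@le_trans _ _ (\sum_(kn <- L) eps)).
    apply: union_of_prob => [kn _|[k n] /wL[_ kb k1 _ pn]]; first exact: mfar.
    apply: hK0; first exact: leq_maxl.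
    apply: leq_trans (M_mono (ltnW kb)).
    by apply: leq_trans pn; rewrite leq_pmull.
  rewrite big_const_seq count_predT iter_addr_0 -[_ *+ _]mulr_natl.
  apply: (@le_trans _ _ ((size L).+1%:R * (16 * (size L).+1%:R)^-1)).
    apply: ler_pM => //; [exact: ltW|by rewrite ler_nat|by rewrite ge_min lexx orbT].
  have z0 : (size L).+1%:R != 0 :> R by rewrite pnatr_eq0.
  rewrite le_eqVlt; apply/orP; left; apply/eqP.
  by move: ((size L).+1%:R) z0 => z z0; field.
(* Budget: 3/64 for early activity, 1/64 for crowding, 1/16 for truncation. *)
pose bad := B1 `|` B2 `|` B3.
have mbad : measurable bad by apply: measurableU => //; exact: measurableU.
have Pbad : fine (P bad) <= 8^-1.
  apply: (le_trans (fineP_setU P (measurableU _ _ mB1 mB2) mB3)).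
  have := fineP_setU P mB1 mB2; move: PB1 PB2 PB3; lra.
(* [seqDU] makes the spike events disjoint without leaving [F0]. Beyond the list, [F] is empty and
   the time is the default [n0.+1], which is still admissible. *)
pose F i := nth set0 (map D L) i.
pose A := seqDU F; pose t i := (nth (0, n0.+1)%N L i).2.
have FE i : (i < size L)%N -> F i = D (nth (0, n0.+1)%N L i).
  by move=> iL; rewrite /F (nth_map (0, n0.+1)%N).
have sF i : <<s F0 >> (F i).
  have [iL|iL] := ltnP i (size L); first by rewrite FE//; apply: sD; exact: mem_nth.
  by rewrite /F nth_default ?size_map//; exact: (@measurable0 _ (g_sigma_algebraType F0)).
have sA i : <<s F0 >> (A i).
  apply: sigmaD => //.
  by apply: (@bigsetU_measurable _ (g_sigma_algebraType F0)) => j _; exact: sF.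
have mA i : measurable (A i).
  exact: (sigma_sub_measurable (@past_measurable _ _ _ _ _ _ TK mTinv T_pres _ me 0) (sA i)).
have tA : trivIset setT A by exact: trivIset_seqDU.
exists (size L), A, t; split => //.
  move=> i; have [iL|iL] := ltnP i (size L); last by rewrite /t nth_default.
  rewrite /t; have := mem_nth (0, n0.+1)%N iL; case: (nth _ _ _) => k n /wL[_ _ _ /andP[h1 h2] _]; by split.
have sumA : \sum_(i < size L) fine (P (A i)) = fine (P (union_of L D)).
  have -> : union_of L D = \big[setU/set0]_(i < size L) A i.
    rewrite -bigsetU_seqDU -(bigcup_mkord _ F); apply/seteqP; split => w.
      move=> [kn knL h]; exists (index kn L) => /=; first by rewrite index_mem.
      by rewrite FE ?index_mem// nth_index.
    by move=> [i /= iL]; rewrite FE// => h; exists (nth (0, n0.+1)%N L i) => //; exact: mem_nth.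
  rewrite (measure_bigsetU P mA tA) -[LHS]/(fine (\sum_(i < size L) fine (P (A i)))%:E) -sumEFin.
  by congr fine; apply: eq_bigr => i _; rewrite -PE.
pose Z i := [set w | s%:R * Num.sqrt (t i)%:R <= `|S f (t i) w|].
have mZ i : measurable (Z i).
  apply: measurable_set_le => //.
  exact: measurableT_comp.
have each i : (i < size L)%N -> fine (P (A i)) <= fine (P (A i `&` Z i)) + fine (P (A i `&` bad)).
  move=> iL.
  have mAZ : measurable (A i `&` Z i) by exact: measurableI.
  have mAb : measurable (A i `&` bad) by exact: measurableI.
  apply: le_trans (fineP_setU P mAZ mAb).
  apply: le_fineP_ae => //; first exact: measurableU.
  have := regular_ae.
  apply: filterS => w rw Aw; rewrite -setIUr; split => //.
  have [hbad|nbad] := pselect (bad w); [by right|left].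
  have knL := mem_nth (0, n0.+1)%N iL.
  have Dw : D (nth (0, n0.+1)%N L i) w by move: Aw => -[]; rewrite FE.
  rewrite /Z /= /t; move: knL Dw; case: (nth _ _ _) => k n knL Dw /=.
  have [ak kb k1 /andP[_ n1] pn] := wL k n knL.
  have nfar : `|S f n w - S (fK K) n w| < 1.
    rewrite ltNge; apply/negP => h; apply: nbad; right; exists (k, n) => //=.
    by apply: le_trans h; rewrite /eps ge_min lexx.
  have iso : isolated k n w.
    by apply: (@not_crowded (k, n)) => // h; apply: nbad; left; right; exists (k, n).
  have quiet j : (k <= j)%N -> (j <= K)%N -> ~ active j (M j.-1 + 2 * ell j) w.
    move=> kj jK h; apply: nbad; left; left; exists j => //.
    by rewrite mem_index_iota (leq_trans ak kj).
  have gk : gap k <= 4^-1.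
    have := ha1 k k.+1 (leq_trans aa1 ak); rewrite big_nat1; lra.
  have kK : (k <= K)%N by apply: leq_trans (ltnW kb) (leq_maxr _ _).
  have nM : (n <= M k)%N by apply: leq_trans pn; rewrite leq_pmull.
  have big := birkhoff_large rw k1 kK nM gk Dw iso quiet.
  have sn1 : 1 <= Num.sqrt n%:R :> R.
    have : Num.sqrt 1 <= Num.sqrt n%:R :> R by rewrite ler_wsqrtr// ler1n.
    by rewrite sqrtr1.
  have sM : 2 * s.+1%:R * Num.sqrt n%:R <= Num.sqrt (M k)%:R :> R.
    have -> : 2 * s.+1%:R = Num.sqrt (p%:R) :> R.
      rewrite /p natrM natrX (_ : 4 = 2 ^+ 2 :> R); last by ring.
      by rewrite -exprMn sqrtr_sqr ger0_norm// mulr_ge0.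
    by rewrite -sqrtrM// ler_wsqrtr// -natrM ler_nat.
  have h1 : s.+1%:R = s%:R + 1 :> R by rewrite -natr1.
  have h2 := lerB_dist (S (fK K) n w) (S (fK K) n w - S f n w).
  rewrite subKr distrC in h2.
  move: big sM sn1 nfar h2; rewrite h1; lra.
have : \sum_(i < size L) fine (P (A i)) <=
    \sum_(i < size L) (fine (P (A i `&` Z i)) + fine (P (A i `&` bad))).
  by apply: ler_sum => i _; apply: each; exact: ltn_ord.
rewrite big_split /= sumA.
have := sum_fineP_trivIset P (size L) mA mbad tA.
move: PD Pbad; lra.
Qed.

End construction.

(** * Conclusion *)

Lemma Lfun2P d (Omega : measurableType d) (R : realType) (P : probability Omega R)
    (g : Omega -> R) : g \in Lfun P 2%:E ->
  measurable_fun setT g /\ (Lnorm P 2%:E (EFin \o g) < +oo)%E.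
Proof. by rewrite inE => /andP[]; rewrite !inE. Qed.

Section conclusion.
Context d (Omega : measurableType d) (R : realType) (P : probability Omega R).
Local Notation intg f := (P.-integrable setT (EFin \o f)).
Local Notation E f := (Rintegral P setT f).
Variables (T Tinv : Omega -> Omega).
Hypotheses (TK : cancel T Tinv) (TinvK : cancel Tinv T).
Hypothesis mTinv : measurable_fun setT Tinv.
Hypothesis T_pres : measure_preserving P T.
Variable e : nat -> Omega -> R.
Hypothesis me : forall k : nat, (1 <= k)%N -> measurable_fun setT (e k).
Hypothesis e_indep : mutually_independent P coord_dom (coordinate T Tinv e).
Local Notation S := (birkhoff_sum T Tinv).
Local Notation F0 := (past_gen T Tinv e 0).
Variable m : Omega -> R.
Hypothesis mF0 : gmeas F0 m.
Hypothesis im2 : intg (fun w => m w ^+ 2).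
Hypothesis m_mart : forall A, <<s F0 >> A -> E (fun w => m (T w) * \1_A w) = 0.

Let F0m : F0 `<=` measurable.
Proof. exact: (past_measurable TK mTinv T_pres me). Qed.

Let mm : measurable_fun setT m.
Proof. exact: (gmeas_measurable F0m mF0). Qed.

Lemma normalized_sumD (g h : Omega -> R) n :
  normalized_sum T Tinv (g \+ h) n =
  (fun w => S g n w / Num.sqrt n%:R + S h n w / Num.sqrt n%:R).
Proof.
by apply/funext => w; rewrite /normalized_sum -mulrDl /birkhoff_sum -big_split.
Qed.

Lemma normalized_measurable (g : Omega -> R) n : measurable_fun setT g ->
  measurable_fun setT (fun w => S g n w / Num.sqrt n%:R).
Proof.
by move=> mg; apply: measurable_funM => //; exact: (measurable_birkhoff TK mTinv T_pres).
Qed.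

Lemma mart_cond :
  is_cond_exp P F0 (m \o T) (fun=> 0) ->
  forall A, <<s F0 >> A -> E (fun w => m (T w) * \1_A w) = 0.
Proof.
move=> [_ _ h] A sA.
have mA : measurable A := sigma_sub_measurable F0m sA.
have := h A sA; rewrite integral0 => h0.
rewrite /Rintegral; have -> : (\int[P]_w (m (T w) * \1_A w)%:E = 0)%E; last by [].
rewrite [RHS]h0 [RHS]integral_mkcond; apply: eq_integral => w _.
rewrite /patch indicE /=; case: (w \in A); first by rewrite mulr1.
by rewrite mulr0.
Qed.

Lemma martingale_clt : 0 < E (fun w => m w ^+ 2) ->
  lipschitz_tests P (fun n w => S m n w / Num.sqrt n%:R)
    (fun phi => Rintegral (normal_prob 0 (Num.sqrt (E (fun w => m w ^+ 2)))) setT phi).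
Proof.
move=> v0 phi C Lip mphi phiC phiL.
rewrite (integral_normal_prob v0 mphi phiC).
apply: (gauss_tests_lipschitz v0 _ _ mphi phiC phiL).
  by move=> n; exact: normalized_measurable.
exact: (lindeberg TK TinvK mTinv T_pres me e_indep mF0 im2 m_mart).
Qed.

(** The L1 norm of [m] is below every [del], hence zero; Slutsky's lemma is applied to the zero
    sequence perturbed by [S_n(m) / sqrt n]. *)
Lemma degenerate_clt : E (fun w => m w ^+ 2) = 0 ->
  lipschitz_tests P (fun n w => S m n w / Num.sqrt n%:R)
    (fun phi => Rintegral (dirac (0 : measurableTypeR R)) setT phi).
Proof.
move=> v0; have im : intg m by exact: (sqr_intg TK mTinv T_pres me mF0 im2).
have Em0 : E (fun w => `|m w|) <= 0.
  apply/ler_addgt0Pl => del del0; rewrite addr0.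
  by have [_] := E_norm_le_sqr mm im2 del0; rewrite v0 mul0r addr0.
have -> : (fun n w => S m n w / Num.sqrt n%:R) = (fun n w => 0 + S m n w / Num.sqrt n%:R).
  by apply/funext => n; apply/funext => w; rewrite add0r.
apply: (@slutsky _ _ _ P (fun _ _ => 0)) => //.
- by move=> n; exact: normalized_measurable.
- move=> eps eps0.
  have -> : (fun n => fine (P [set w | eps < `|S m n w / Num.sqrt n%:R|])) = (fun=> 0); last exact: cvg_cst.
  apply/funext => n; apply/eqP; rewrite eq_le fineP_ge0 andbT.
  have mX := normalized_measurable n mm.
  have iX : intg (fun w => S m n w / Num.sqrt n%:R).
    under eq_fun do rewrite mulrC.
    by apply: intgZ; exact: (intg_birkhoff TK mTinv T_pres).
  apply: (@le_trans _ _ (fine (P [set w | eps <= `|S m n w / Num.sqrt n%:R|]))).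
    apply: le_fineP => [| |w /= /ltW //].
      apply: measurable_set_lt => //.
      exact: measurableT_comp.
    apply: measurable_set_le => //.
    exact: measurableT_comp.
  apply: (le_trans (markov_E eps0 iX)).
  rewrite ler_pdivrMr// mul0r.
  have -> : (fun w => `|S m n w / Num.sqrt n%:R|) = (fun w => (Num.sqrt n%:R)^-1 * `|S m n w|).
    by apply/funext => w; rewrite normrM mulrC (ger0_norm (x := _^-1)) ?invr_ge0.
  rewrite EZ; last exact/intg_norm/(intg_birkhoff TK mTinv T_pres).
  rewrite mulr_ge0_le0 ?invr_ge0//.
  apply: (le_trans (E_birkhoff_le TK mTinv T_pres n im)).
  by rewrite mulr_ge0_le0.
- move=> phi C Lip mphi phiC _; rewrite E_cst.
  have -> : Rintegral (dirac (0 : measurableTypeR R)) setT phi = phi 0.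
    rewrite /Rintegral integral_dirac//=; first by rewrite indicT mul1r.
    exact/measurable_EFinP.
  exact: cvg_cst.
Qed.

Variable f : Omega -> R.
Hypothesis mf : measurable_fun setT f.
Hypothesis f_negl : forall eps : R, 0 < eps ->
  fine (P [set w | eps < `|S f n w / Num.sqrt n%:R|]) @[n --> \oo] --> (0 : R).

Lemma normalized_sum_cvg :
  weak_cvg (fun n => pushforward P
     (normalized_sum T Tinv (m \+ f) n : Omega -> measurableTypeR R))
    (centered_normal (E (fun w => m w ^+ 2))).
Proof.
have -> : normalized_sum T Tinv (m \+ f) =
    (fun n w => S m n w / Num.sqrt n%:R + S f n w / Num.sqrt n%:R).
  by apply/funext => n; exact: normalized_sumD.
have mX n : measurable_fun setT (fun w => S m n w / Num.sqrt n%:R + S f n w / Num.sqrt n%:R).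
  by apply: measurable_funD; exact: normalized_measurable.
have tests Q : lipschitz_tests P (fun n w => S m n w / Num.sqrt n%:R) Q ->
    lipschitz_tests P (fun n w => S m n w / Num.sqrt n%:R + S f n w / Num.sqrt n%:R) Q.
  by apply: slutsky => // n; exact: normalized_measurable.
rewrite /centered_normal; case: eqP => v0.
  exact/(lipschitz_weak_cvg mX)/tests/degenerate_clt.
apply: (lipschitz_weak_cvg mX); apply/tests/martingale_clt.
by rewrite lt_neqAle eq_sym; apply/andP; split; [exact/eqP|apply: E_ge0 => w; exact: sqr_ge0].
Qed.

Hypothesis f_large : forall s n0 : nat, exists (n : nat) (A : nat -> set Omega) (t : nat -> nat),
  [/\ forall i, <<s F0 >> (A i), trivIset setT A, forall i, (n0 <= t i)%N /\ (0 < t i)%N &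
    3 / 4 <= \sum_(i < n) fine (P (A i `&` [set w | s%:R * Num.sqrt (t i)%:R <= `|S f (t i) w|]))].

(** If [|S_n(f)| >= s sqrt n] with [s >= |b| + C], then either the martingale part exceeds
    [C sqrt n] or the normalized sum is at least [b] in absolute value. Summed along the random time
    this gives [3/4 <= 1/2 + 1/8]. *)
Lemma not_quenched (K : nat -> R.-pker (g_sigma_algebraType F0) ~> measurableTypeR R) :
  (forall n, is_reg_cond_distr P (normalized_sum T Tinv (m \+ f) n) (K n)) ->
  ~ exists G : probability (measurableTypeR R) R, {ae P, forall w, weak_cvg (fun n => K n w) G}.
Proof.
move=> KX [G KG].
have mX n : measurable_fun setT (normalized_sum T Tinv (m \+ f) n).
  by rewrite normalized_sumD; apply: measurable_funD; exact: normalized_measurable.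
have [b [n0 hb]] := quenched_random_time F0m mX KX KG.
have e8 : 0 < 8^-1 :> R by rewrite invr_gt0.
have [C C0 hC] := random_time_tight TK TinvK mTinv T_pres me mF0 im2 m_mart e8.
pose s := (Num.truncn (`|b| + C)).+1.
have sb : `|b| + C <= s%:R by apply: ltW; exact: truncnS_gt.
have [n [A [t [sA tA ht hA]]]] := f_large s n0.
have hb' := hb n A t sA tA (fun i => (ht i).1).
have hC' := hC n A t sA tA (fun i => (ht i).2).
have mA i : measurable (A i) by exact: (sigma_sub_measurable F0m (sA i)).
have mS (g : Omega -> R) k : measurable_fun setT g -> measurable_fun setT (fun w => `|S g k w|).
  by move=> mg; have h := measurable_birkhoff TK mTinv T_pres k mg; exact: measurableT_comp.
have each i : fine (P (A i `&` [set w | s%:R * Num.sqrt (t i)%:R <= `|S f (t i) w|])) <=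
    fine (P (A i `&` [set w | b <= `|normalized_sum T Tinv (m \+ f) (t i) w|])) +
    fine (P (A i `&` [set w | C * Num.sqrt (t i)%:R < `|S m (t i) w|])).
  have m1 : measurable [set w | s%:R * Num.sqrt (t i)%:R <= `|S f (t i) w|].
    by apply: measurable_set_le => //; exact: mS.
  have m2 : measurable [set w | b <= `|normalized_sum T Tinv (m \+ f) (t i) w|].
    apply: measurable_set_le => //.
    exact: measurableT_comp.
  have m3 : measurable [set w | C * Num.sqrt (t i)%:R < `|S m (t i) w|].
    by apply: measurable_set_lt => //; exact: mS.
  apply: le_trans (fineP_setU P (measurableI _ _ (mA i) m2) (measurableI _ _ (mA i) m3)).
  apply: le_fineP; [exact: measurableI|by apply: measurableU; exact: measurableI|].
  move=> w [Aw /= large].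
  have [h|/negP h] := boolP (C * Num.sqrt (t i)%:R < `|S m (t i) w|); [by right|left; split=> //=].
  move/negP: h; rewrite -leNgt => h.
  have r0 : 0 < Num.sqrt (t i)%:R :> R by rewrite sqrtr_gt0 ltr0n; exact: (ht i).2.
  rewrite normalized_sumD -mulrDl normrM normfV (ger0_norm (ltW r0)) ler_pdivlMr//.
  have h2 := lerB_dist (S f (t i) w) (- S m (t i) w).
  rewrite opprK normrN [S f _ _ + _]addrC in h2.
  apply: le_trans h2; have := ler_norm b.
  move: large h sb r0; move: (Num.sqrt _) (`|S f _ _|) (`|S m _ _|) => r x y; nra.
have : \sum_(i < n) fine (P (A i `&` [set w | s%:R * Num.sqrt (t i)%:R <= `|S f (t i) w|])) <=
  \sum_(i < n) (fine (P (A i `&` [set w | b <= `|normalized_sum T Tinv (m \+ f) (t i) w|])) +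
    fine (P (A i `&` [set w | C * Num.sqrt (t i)%:R < `|S m (t i) w|]))).
  by apply: ler_sum => i _; exact: each.
rewrite big_split /=; move: hA hb' hC'; lra.
Qed.

End conclusion.

Theorem corollary2 (R : realType)
  (ell M : nat -> nat)
  (ell1_gt0 : (0 < ell 1)%N)
  (ell_incr : forall k : nat, (1 <= k)%N -> (ell k < ell k.+1)%N)
  (M0 : (M 0 = 1)%N)
  (M1_gt0 : (0 < M 1)%N)
  (M_incr : forall k : nat, (1 <= k)%N -> (M k < M k.+1)%N)
  (M_ell : forall k : nat, (1 <= k)%N -> (2 * ell k <= M k)%N)
  (summable_ell_M :
    (\sum_(1 <= k <oo)
        ((Num.sqrt (k%:R * (ell k)%:R))^-1
         + (ell k)%:R ^+ 2 * Num.sqrt ((M k.-1)%:R / (M k)%:R) : R)%:E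
      < +oo)%E)
  (d : measure_display) (Omega : measurableType d) (mu : probability Omega R)
  (T Tinv : Omega -> Omega)
  (TK : cancel T Tinv) (TinvK : cancel Tinv T)
  (mTinv : measurable_fun setT Tinv)
  (T_pres : measure_preserving mu T)
  (T_erg : ergodic mu T)
  (e : nat -> Omega -> R)
  (me : forall k : nat, (1 <= k)%N -> measurable_fun setT (e k))
  (e_indep : mutually_independent mu
    [set ik : int * nat | (1 <= ik.2)%N]
    (fun ik => koopman T Tinv ik.1 (e ik.2)))
  (e_pos : forall k : nat, (1 <= k)%N ->
    mu (e k @^-1` [set Num.sqrt (M k)%:R / (ell k)%:R])
    = ((2 * k%:R * (M k)%:R)^-1)%:E)
  (e_neg : forall k : nat, (1 <= k)%N ->
    mu (e k @^-1` [set - (Num.sqrt (M k)%:R / (ell k)%:R)])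
    = ((2 * k%:R * (M k)%:R)^-1)%:E)
  (e_zero : forall k : nat, (1 <= k)%N ->
    mu (e k @^-1` [set 0]) = (1 - (k%:R * (M k)%:R)^-1)%:E)
  (f : Omega -> R)
  (f_L2 : f \in Lfun mu 2%:E)
  (f_sum :
    Lnorm mu 2%:E (EFin \o (f \- f_partial T Tinv ell M e n))
      @[n --> \oo] --> 0%E)
  (m : Omega -> R)
  (m_L2 : m \in Lfun mu 2%:E)
  (m_F0 : measurable_fun setT
    (m : g_sigma_algebraType (past_gen T Tinv e 0) -> measurableTypeR R))
  (m_mart : is_cond_exp mu (past_gen T Tinv e 0) (m \o T) (fun=> 0)) :
  weak_cvg
    (fun n => pushforward mu
       (normalized_sum T Tinv (m \+ f) n
          : Omega -> measurableTypeR R))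
    (centered_normal (fine (Lnorm mu 2%:E (EFin \o m)) ^+ 2))
  /\
  (forall K : nat ->
      R.-pker (g_sigma_algebraType (past_gen T Tinv e 0)) ~> measurableTypeR R,
    (forall n : nat,
      is_reg_cond_distr mu (normalized_sum T Tinv (m \+ f) n)
        (K n)) ->
    ~ exists G : probability (measurableTypeR R) R,
        {ae mu, forall w, weak_cvg (fun n => K n w) G}).
Proof.
have [mf _] := Lfun2P f_L2.
have [mm Nm] := Lfun2P m_L2.
have [im2 <-] := sqr_Lnorm mm Nm.
have mart := mart_cond TK mTinv T_pres me m_mart.
split.
  apply: (normalized_sum_cvg TK TinvK mTinv T_pres me e_indep m_F0 im2 mart mf).
  move=> eps; exact: (f_negligible ell1_gt0 ell_incr M0 M1_gt0 M_incr M_ell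
    summable_ell_M TK TinvK mTinv T_pres me e_pos e_neg e_zero mf f_sum).
apply: (not_quenched TK TinvK mTinv T_pres me m_F0 im2 mart mf).
exact: (random_time_lower ell1_gt0 ell_incr M0 M1_gt0 M_incr M_ell
    summable_ell_M TK TinvK mTinv T_pres me e_pos e_neg e_zero mf f_sum e_indep).
Qed.
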